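(* Let $C$ be a cusp in $(\mathbb{C}^2,0)$ with Puiseux pair $(m,n)$ and let $E$ be its cuspidal divisor. Let $\mathcal{F}$ be a totally $E$-dicritical foliation in $(\mathbb{C}^2,0)$, defined by $\omega_{\mathcal F}=0$, with $C$ as invariant curve. If $\mathcal F$ satisfies the total transversality property and $$\nu_E(\omega_{\mathcal F})\le c(\Gamma_C)-c(\Lambda_C)+2(n+m)-1,$$ then the foliation $\mathcal F$ is $\Lambda$-constant.
   Context: All objects are holomorphic germs at $0\in\mathbb{C}^2$. A foliation $\mathcal{F}$ is defined by $\omega_{\mathcal F}=0$ with $\omega_{\mathcal F}=A\,dx+B\,dy$, $A,B\in\mathbb{C}\{x,y\}$, $\gcd(A,B)=1$. For an irreducible curve $C$ with primitive parametrization $\gamma(t)$: $\nu_C(h)=\operatorname{ord}_t h(\gamma(t))$, and $\nu_C(\omega)=\operatorname{ord}_t(\alpha(t))+1$ for a 1-form $\omega$ with $\gamma^*\omega=\alpha(t)\,dt$ ($\infty$ if $\gamma^*\omega=0$). $C$ is an invariant curve of $\mathcal F$ if $\gamma^*\omega_{\mathcal F}=0$. A cusp with Puiseux pair $(m,n)$ is an irreducible plane curve germ with only one Puiseux pair $(m,n)$, $2\le n<m$, $\gcd(n,m)=1$. Its semigroup is $\Gamma_C=\{\nu_C(h)\}=\langle n,m\rangle$; $\Lambda_C$ is the set of (finite) differential values $\nu_C(\omega)$ of 1-forms, a $\Gamma_C$-semimodule. The conductor $c(\Gamma_C)$ (resp. $c(\Lambda_C)$) is the smallest non-negative integer such that every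 integer greater than or equal to it belongs to $\Gamma_C$ (resp. $\Lambda_C$). The basis of $\Lambda_C$ is the unique strictly increasing sequence $(\lambda_{-1},\lambda_0,\ldots,\lambda_s)$, $s$ minimal, with $\Lambda_C=\bigcup_{i=-1}^s(\lambda_i+\Gamma_C)$. A minimal standard basis for $C$ is a list of 1-forms $(\omega_{-1},\ldots,\omega_s)$ with $\nu_C(\omega_i)=\lambda_i$; fix one, and let $\mathcal{G}_i$ be the foliation defined by $\omega_i=0$. Let $\pi:M\to(\mathbb{C}^2,0)$ be the minimal reduction of singularities of $C$, $D=\pi^{-1}(0)$, and let the cuspidal divisor $E$ be the irreducible component of $D$ met by the strict transform of $C$. For a 1-form $\omega$, $\nu_E(\omega)=\max\{\ell: u^{-\ell}\pi^*\omega\in\Omega^1_{M,P}[\log E]\}$, where $P\in E$, $u=0$ is a reduced local equation of $E$ at $P$ and $\Omega^1_{M,P}[\log E]$ is the module of germs of logarithmic 1-forms along $E$ at $P$. A foliation $\mathcal{F}$ is totally $E$-dicritical if its strict transform $\pi^*\mathcal{F}$ is transversal to $E$ and has normal crossings with $D$ at each point of $E$. Then for every point $P\in E$ that is not a singular point of $D$ there is an invariant curve $C_P$ of $\mathcal F$ whose strict transform is nonsingular and transversal to $E$ at $P$; $\operatorname{Curv}_E(\mathcal F)=\operatorname{Cusp}_E(\mathcal F)$ is the set of these curves; they are cusps with Puiseux pair $(m,n)$. $\mathcal F$ is $\Lambda$-constant if $\Lambda_{C_1}=\Lambda_{C_2}$ for all $C_1,C_2\in\operatorname{Cusp}_E(\mathcal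 F)$. The jacobian curve $\mathcal{J}_{\mathcal{F},\mathcal{G}}$ of two foliations is the curve $J_{\mathcal F,\mathcal G}=0$, where $\omega_{\mathcal F}\wedge\omega_{\mathcal G}=J_{\mathcal F,\mathcal G}\,dx\wedge dy$. $\mathcal F$ and $\mathcal G$ have the $E$-transversality property if the strict transform of $\mathcal{J}_{\mathcal{F},\mathcal{G}}$ by $\pi$ does not intersect $E$. $\mathcal F$ satisfies the total transversality property if $\mathcal F$ and $\mathcal G_\ell$ have the $E$-transversality property for $\ell=-1,0,1,\ldots,s$. *)

(* Defs.v *)
(* Complex numbers are R[i] for R : realType. *)
From HB Require Import structures.
From mathcomp Require Import all_boot all_order all_algebra.
From mathcomp Require Import boolp reals.
From mathcomp Require Import complex.

Set Implicit Arguments.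
Unset Strict Implicit.
Unset Printing Implicit Defensive.

Import Order.TTheory GRing.Theory Num.Theory.
Local Open Scope ring_scope.


Record fps (K : Type) := FPS { fps_coef :> nat -> K }.

HB.instance Definition _ (K : Type) := gen_eqMixin (fps K).
HB.instance Definition _ (K : Type) := gen_choiceMixin (fps K).

Lemma fpsP (K : Type) (f g : fps K) : (forall k, f k = g k) -> f = g.
Proof. by case: f g => [f] [g] /= fg; congr FPS; apply/funext. Qed.

Section FpsRing.
Variable K : comNzRingType.
Implicit Types f g h : fps K.

Definition fps_zero : fps K := FPS (fun=> 0).
Definition fps_opp f : fps K := FPS (fun k => - f k).
Definition fps_add f g : fps K := FPS (fun k => f k + g k).

Lemma fps_addA : associative fps_add.
Proof. by move=> f g h; apply: fpsP => k /=; rewrite addrA. Qed.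
Lemma fps_addC : commutative fps_add.
Proof. by move=> f g; apply: fpsP => k /=; rewrite addrC. Qed.
Lemma fps_add0 : left_id fps_zero fps_add.
Proof. by move=> f; apply: fpsP => k /=; rewrite add0r. Qed.
Lemma fps_addN : left_inverse fps_zero fps_opp fps_add.
Proof. by move=> f; apply: fpsP => k /=; rewrite addNr. Qed.

HB.instance Definition _ :=
  GRing.isZmodule.Build (fps K) fps_addA fps_addC fps_add0 fps_addN.

Definition fpsC (c : K) : fps K := FPS (fun k => if k == 0%N then c else 0).
Definition fps_mul f g : fps K :=
  FPS (fun k => \sum_(i < k.+1) f i * g (k - i)%N).

Let trunc N f : {poly K} := \poly_(i < N) f i.

Let trunc_mul N f g k : (k < N)%N -> (trunc N f * trunc N g)`_k = fps_mul f g k.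
Proof.
move=> kN; rewrite coefM /=; apply: eq_bigr => i _; rewrite !coef_poly.
have ik : (i <= k)%N by rewrite -ltnS.
by rewrite (leq_ltn_trans ik kN) (leq_ltn_trans (leq_subr i k) kN).
Qed.

Let coef_trunc N f k : (k < N)%N -> (trunc N f)`_k = f k.
Proof. by move=> kN; rewrite coef_poly kN. Qed.

Lemma fps_mulC : commutative fps_mul.
Proof.
by move=> f g; apply: fpsP => k; rewrite -!(@trunc_mul k.+1) // mulrC.
Qed.

Lemma fps_mulA : associative fps_mul.
Proof.
move=> f g h; apply: fpsP => k.
transitivity ((trunc k.+1 f * (trunc k.+1 g * trunc k.+1 h))`_k).
  rewrite coefM /=; apply: eq_bigr => i _.
  by rewrite coef_trunc // trunc_mul // ltnS leq_subr.
rewrite mulrA coefM /=; apply: eq_bigr => i _.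
by rewrite trunc_mul // coef_trunc // ltnS leq_subr.
Qed.

Lemma fps_mul1 : left_id (fpsC 1) fps_mul.
Proof.
move=> f; apply: fpsP => k /=; rewrite big_ord_recl /= mul1r subn0.
by rewrite big1 ?addr0 // => i _; rewrite mul0r.
Qed.

Lemma fps_mulDl : left_distributive fps_mul fps_add.
Proof.
move=> f g h; apply: fpsP => k /=; rewrite -big_split /=.
by apply: eq_bigr => i _; rewrite mulrDl.
Qed.

Lemma fps_1neq0 : fpsC 1 != 0.
Proof.
apply/eqP => /(congr1 (fun f : fps K => f 0%N)) /= /eqP.
by rewrite oner_eq0.
Qed.

HB.instance Definition _ := GRing.Zmodule_isComNzRing.Build (fps K)
  fps_mulA fps_mulC fps_mul1 fps_mulDl fps_1neq0.

Definition fpsX : fps K := FPS (fun k => (k == 1%N)%:R).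
Definition fps_deriv f : fps K := FPS (fun k => f k.+1 *+ k.+1).

(* Meaningful when [s] has no constant term. *)
Definition fps_comp f (s : fps K) : fps K :=
  FPS (fun k => \sum_(i < k.+1) f i * (s ^+ i) k).

Definition fps_order f (k : nat) : Prop :=
  f k <> 0 /\ forall i, (i < k)%N -> f i = 0.

End FpsRing.

(* In a series f in x and y, [f i j] is the coefficient of x^i y^j. *)

Notation fps2 K := (fps (fps K)).

Section Fps2.
Variable K : comNzRingType.
Implicit Types f g : fps2 K.

Definition X : fps2 K := fpsX (fps K).
Definition Y : fps2 K := fpsC (fpsX K).
Definition cst (c : K) : fps2 K := fpsC (fpsC c).

Definition dX f : fps2 K := fps_deriv f.
Definition dY f : fps2 K := FPS (fun i => fps_deriv (f i)).

(* f(u, v) and f(g(t)); meaningful when u, v, g have no constant term, so that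
   the terms of higher degree do not contribute. *)
Definition subst2 f (p : fps2 K * fps2 K) : fps2 K :=
  FPS (fun a => FPS (fun b =>
    \sum_(i < (a + b).+1) \sum_(j < (a + b).+1)
      f i j * (p.1 ^+ i * p.2 ^+ j) a b)).

Definition subst1 f (g : fps K * fps K) : fps K :=
  FPS (fun k => \sum_(i < k.+1) \sum_(j < k.+1)
    f i j * (g.1 ^+ i * g.2 ^+ j) k).

End Fps2.

Arguments X {K}.
Arguments Y {K}.

Section Germs.
Variable R : realType.
Local Notation C := R[i].
Local Open Scope complex_scope.

Definition convergent1 (f : fps C) : Prop :=
  exists M r : R, forall k, `|f k| <= (M * r ^+ k)%:C.

Definition convergent2 (f : fps2 C) : Prop :=
  exists M r : R, forall i j, `|f i j| <= (M * r ^+ (i + j))%:C.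


Definition dvd2 (f g : fps2 C) : Prop :=
  exists2 h, convergent2 h & g = h * f.

Definition unit2 (f : fps2 C) : Prop := dvd2 f 1.

Definition coprime2 (f g : fps2 C) : Prop :=
  forall h, convergent2 h -> dvd2 h f -> dvd2 h g -> unit2 h.

(* A 1-form [w] stands for w.1 dx + w.2 dy. *)

Definition form1 := (fps2 C * fps2 C)%type.

Definition is_form1 (w : form1) : Prop := convergent2 w.1 /\ convergent2 w.2.

Definition foliation (w : form1) : Prop := is_form1 w /\ coprime2 w.1 w.2.

Definition d1 (f : fps2 C) : form1 := (dX f, dY f).

Definition scale1 (f : fps2 C) (w : form1) : form1 := (f * w.1, f * w.2).

(* The coefficient of dx /\ dy in w /\ w'; for two foliations this is the
   equation of the jacobian curve. *)
Definition wedge (w w' : form1) : fps2 C := w.1 * w'.2 - w.2 * w'.1.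

Definition pull2 (p : fps2 C * fps2 C) (w : form1) : form1 :=
  (subst2 w.1 p * dX p.1 + subst2 w.2 p * dX p.2,
   subst2 w.1 p * dY p.1 + subst2 w.2 p * dY p.2).

(* Irreducible curves are given by primitive parametrizations. *)

Definition param := (fps C * fps C)%type.

Definition is_param (g : param) : Prop :=
  [/\ convergent1 g.1, convergent1 g.2, g.1 0%N = 0 & g.2 0%N = 0].

Definition reparam (g : param) (s : fps C) : param :=
  (fps_comp g.1 s, fps_comp g.2 s).

(* In particular a constant [g] is not primitive (take s = t^2). *)
Definition branch (g : param) : Prop :=
  is_param g /\
  forall (d : param) (s : fps C), is_param d -> convergent1 s -> s 0%N = 0 ->
    g = reparam d s -> s 1%N <> 0.

(* The coefficient alpha of g^* w = alpha(t) dt. *)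
Definition pull1 (g : param) (w : form1) : fps C :=
  subst1 w.1 g * fps_deriv g.1 + subst1 w.2 g * fps_deriv g.2.

Definition invariant_curve (w : form1) (g : param) : Prop := pull1 g w = 0.

Definition fun_value (g : param) (h : fps2 C) (k : nat) : Prop :=
  fps_order (subst1 h g) k.

Definition form_value (g : param) (w : form1) (k : nat) : Prop :=
  exists2 j, fps_order (pull1 g w) j & k = j.+1.

Definition Gamma (g : param) (k : nat) : Prop :=
  exists2 h, convergent2 h & fun_value g h k.

Definition Lambda (g : param) (k : nat) : Prop :=
  exists2 w, is_form1 w & form_value g w k.

Definition swap_param (g : param) : param := (g.2, g.1).

(* Puiseux expansion with respect to a coordinate of minimal order along the
   branch: for a suitable parameter, x = t^n and y = \sum_i a_i t^i, where m is
   the least exponent with nonzero coefficient that is not a multiple of n. As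
   m and n are coprime, (m, n) is then the only Puiseux pair. *)
Definition puiseux (m n : nat) (g : param) : Prop :=
  exists s : fps C, [/\ convergent1 s, s 0%N = 0, s 1%N <> 0,
    (reparam g s).1 = fpsX C ^+ n &
    (reparam g s).2 m <> 0 /\
    forall i, (i < m)%N -> ~~ (n %| i)%N -> (reparam g s).2 i = 0].

Definition cusp (m n : nat) (g : param) : Prop :=
  [/\ branch g, (2 <= n < m)%N, coprime n m &
      puiseux m n g \/ puiseux m n (swap_param g)].

Definition conductor (S : nat -> Prop) (c : nat) : Prop :=
  (forall k, (c <= k)%N -> S k) /\
  forall d, (forall k, (d <= k)%N -> S k) -> (c <= d)%N.

Definition spans (g : param) (lam : seq nat) : Prop :=
  sorted ltn lam /\
  forall k, Lambda g k <->
    exists l c, [/\ l \in lam, Gamma g c & k = (l + c)%N].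

Definition Lambda_basis (g : param) (lam : seq nat) : Prop :=
  spans g lam /\ forall lam', spans g lam' -> (size lam <= size lam')%N.

(* The entry of index i of the lists is the one written with index i - 1 in
   (lambda_{-1}, ..., lambda_s) and (omega_{-1}, ..., omega_s). *)
Definition min_std_basis (g : param) (lam : seq nat) (ws : seq form1) : Prop :=
  [/\ Lambda_basis g lam, size ws = size lam &
      forall i, (i < size lam)%N ->
        is_form1 (nth 0 ws i) /\ form_value g (nth 0 ws i) (nth 0%N lam i)].


(* A point infinitely near the origin is encoded by the sequence of directions
   met by successive blow-ups of points. Local coordinates (x', y') at the new
   point are given by (x, y) = (x', x' (y' + c)) for the direction [Some c],
   with exceptional divisor x' = 0, and by (x, y) = (x' y', y') for the vertical
   direction [None], with exceptional divisor y' = 0. *)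
Definition near_point := seq (option C).

(* The germ at the point [p] of the composition of the blow-ups. *)
Fixpoint blowup (p : near_point) : fps2 C * fps2 C :=
  if p is d :: p' then
    let uv := blowup p' in
    if d is Some c then (uv.1, uv.1 * (uv.2 + cst c)) else (uv.1 * uv.2, uv.2)
  else (X, Y).

(* For z = X or z = Y: the axis z = 0 is a component of the germ at [p] of the
   total exceptional divisor D, the inverse image of the origin. All the
   components of D at [p] are of this form. *)
Definition in_D (p : near_point) (z : fps2 C) : Prop :=
  dvd2 z (blowup p).1 /\ dvd2 z (blowup p).2.

Definition D_subset (p : near_point) (f : fps2 C) : Prop :=
  (in_D p X -> dvd2 X f) /\ (in_D p Y -> dvd2 Y f).

Definition singular_point_D (p : near_point) : Prop := in_D p X /\ in_D p Y.

Definition coordinates (u v : fps2 C) : Prop :=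
  [/\ convergent2 u, convergent2 v, u 0%N 0%N = 0, v 0%N 0%N = 0 &
      wedge (d1 u) (d1 v) 0%N 0%N <> 0].

(* [g'] parametrizes the strict transform at [p] of the curve [g]; there is
   none when the strict transform does not pass through [p]. *)
Definition strict_curve (p : near_point) (g g' : param) : Prop :=
  [/\ is_param g', subst1 (blowup p).1 g' = g.1 &
      subst1 (blowup p).2 g' = g.2].

Definition normal_crossings_at (g : param) (p : near_point) : Prop :=
  exists g' : param, strict_curve p g g' /\
  exists u v, [/\ coordinates u v, subst1 u g' = 0 & D_subset p (u * v)].

(* The minimal reduction of singularities of [g] blows up, as long as necessary,
   the point of the strict transform of [g]; hence it is determined by the
   shortest sequence of points of [g] ending with normal crossings. The last
   blown-up point is [q]; the points of the divisor created by this blow-up are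
   the [rcons q c], with c in P^1(C) = [option C]. *)
Definition cuspidal_divisor (g : param) (q : near_point) : Prop :=
  (exists c, normal_crossings_at g (rcons q c)) /\
  forall p, normal_crossings_at g p -> ((size q).+1 <= size p)%N.

(* The reduced equation of E at [rcons q c], and the other coordinate. *)
Definition eqE (c : option C) : fps2 C := if c is Some _ then X else Y.
Definition coE (c : option C) : fps2 C := if c is Some _ then Y else X.

(* With u = 0 the equation of E and (u, v) the coordinates at [rcons q c], the
   form u^{-l} pi^* w is equal to a du/u + b dv, with a and b holomorphic. *)
Definition log_divisible (q : near_point) (c : option C) (w : form1) (l : nat) :=
  exists a b, [/\ convergent2 a, convergent2 b &
    scale1 (eqE c) (pull2 (blowup (rcons q c)) w) =
    scale1 (eqE c ^+ l) (scale1 a (d1 (eqE c)) +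
                         scale1 (eqE c * b) (d1 (coE c)))].

(* nu_E w = l, computed at the point [rcons q c] of E; negative exponents need
   not be considered, since l = 0 always satisfies [log_divisible]. *)
Definition nu_E (q : near_point) (c : option C) (w : form1) (l : nat) : Prop :=
  log_divisible q c w l /\ forall k, log_divisible q c w k -> (k <= l)%N.


Definition strict_foliation (p : near_point) (w w' : form1) : Prop :=
  foliation w' /\
  exists2 h, convergent2 h & pull2 (blowup p) w = scale1 h w'.

Definition transversal_E (c : option C) (w : form1) : Prop :=
  wedge w (d1 (eqE c)) 0%N 0%N <> 0.

(* In suitable coordinates the foliation is du = 0 and D is contained
   in u v = 0. *)
Definition fol_normal_crossings (p : near_point) (w : form1) : Prop :=
  exists u v,
    [/\ coordinates u v, wedge w (d1 u) = 0 & D_subset p (u * v)].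

Definition totally_dicritical (q : near_point) (w : form1) : Prop :=
  forall c, exists w', [/\ strict_foliation (rcons q c) w w',
    transversal_E c w' & fol_normal_crossings (rcons q c) w'].

(* The last condition says that the strict transform is transversal to E, and
   implies that it is nonsingular. *)
Definition Cusp_E (q : near_point) (w : form1) (g : param) : Prop :=
  [/\ branch g, invariant_curve w g &
      exists c g', [/\ ~ singular_point_D (rcons q c),
        strict_curve (rcons q c) g g' & subst1 (eqE c) g' 1%N <> 0]].

Definition Lambda_constant (q : near_point) (w : form1) : Prop :=
  forall g1 g2, Cusp_E q w g1 -> Cusp_E q w g2 ->
    forall k, Lambda g1 k <-> Lambda g2 k.

(* [f'] is an equation at [p] of the strict transform of the curve f = 0. *)
Definition strict_equation (p : near_point) (f f' : fps2 C) : Prop :=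
  convergent2 f' /\ exists i j : nat,
  [/\ subst2 f (blowup p) = X ^+ i * Y ^+ j * f',
      (0 < i)%N -> in_D p X, (0 < j)%N -> in_D p Y,
      in_D p X -> ~ dvd2 X f' & in_D p Y -> ~ dvd2 Y f'].

Definition E_transversality (q : near_point) (w w' : form1) : Prop :=
  forall c, exists2 f', strict_equation (rcons q c) (wedge w w') f' &
    f' 0%N 0%N <> 0.

(* By minimality of the basis, the forms of a minimal standard basis have
   coprime coefficients: [wedge w (nth 0 ws i)] is therefore an equation of the
   jacobian curve of the foliations defined by [w] and [nth 0 ws i]. *)
Definition total_transversality (q : near_point) (ws : seq form1) (w : form1) :
    Prop :=
  forall i, (i < size ws)%N -> E_transversality q w (nth 0 ws i).

End Germs.

(* Main.v *)
Require Import Defs.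
From HB Require Import structures.
From mathcomp Require Import all_boot all_order all_algebra.
From mathcomp Require Import boolp reals.
From mathcomp Require Import complex.
From mathcomp Require Import ring zify.

(* Let J_eta be the coefficient of omega /\ eta and nu the exponent such that
   pi^* omega is u^nu times a form transversal to E. Comparing pi^* omega,
   pi^* eta and pi^* (omega /\ eta) along a curve C' of Cusp_E(omega) gives
     nu_C' (eta) + nu = ord_C' (J_eta) + n + m.
   Let x and y be coordinates of orders n and m on C; after the blow-ups they
   have the same orders on C'. An order on C' smaller than n m is then the order
   of the function for the weights n and m, as a single monomial has this weight,
   and so it does not depend on C'. By the bound on nu, this applies to J_eta as
   soon as nu_C' (eta) < c(Lambda_C): the semimodules of C and C' coincide below
   c(Lambda_C). Transversality makes the orders of the J_(omega_i) independent of
   C', hence lambda_i is a value for C', and Lambda_C is contained in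
   Lambda_C'. *)

Set Implicit Arguments.
Unset Strict Implicit.
Unset Printing Implicit Defensive.

Import Order.TTheory GRing.Theory Num.Theory.
Local Open Scope ring_scope.

(** * Power series *)

(** The bound on nu is what brings the order r of J_eta on C' below n m: if nu_C' (eta) <
    c(Lambda_C), the comparison formula gives r <= c(Gamma_C) + n + m - 2, and c(Gamma_C) <= (n -
    1)(m - 1). The obstacle is that E is known only through a shortest sequence of infinitely near
    points. The shape of this sequence is recovered from the adapted coordinates: at each point x
    and y become, up to units, monomials in local coordinates on which C has coprime orders, and a
    blow-up is one subtraction of Euclid's algorithm on these orders. Normal crossings cannot occur
    at such a point; once the orders are (1, 1), both coordinates are exceptional and the next
    blow-up creates E. Exponents found at different points of E agree because the order of a
    pull-back along the last exceptional curve is a multiplicity at the point blown up, whatever the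
    direction. The computations are formal. Convergence is the issue when minimality of the sequence
    is used: a smooth branch must have a convergent equation, which is obtained by Lagrange
    inversion. *)

Section Fps.
Variable K : comNzRingType.
Implicit Types f g : fps K.

Lemma fpsD f g k : (f + g) k = f k + g k. Proof. by []. Qed.
Lemma fpsN f k : (- f) k = - f k. Proof. by []. Qed.
Lemma fpsB f g k : (f - g) k = f k - g k. Proof. by []. Qed.
Lemma fps1 k : (1 : fps K) k = (k == 0%N)%:R.
Proof. by rewrite /= ; case: eqP. Qed.
Lemma fpsM f g k : (f * g) k = \sum_(i < k.+1) f i * g (k - i)%N.
Proof. by []. Qed.
Lemma fpsM0 f g : (f * g) 0%N = f 0%N * g 0%N.
Proof. by rewrite fpsM big_ord_recl big_ord0 addr0. Qed.
Lemma fps_sum (I : Type) (r : seq I) (P : pred I) (F : I -> fps K) k :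
  (\sum_(i <- r | P i) F i) k = \sum_(i <- r | P i) F i k.
Proof. by elim/big_rec2: _ => //= i x y _ <-. Qed.

Lemma fpsC_is_additive : zmod_morphism (@fpsC K).
Proof. by move=> a b; apply: fpsP => k /=; case: eqP; rewrite ?subr0. Qed.
Lemma fpsC_is_monoid : monoid_morphism (@fpsC K).
Proof.
split=> // a b; apply: fpsP => k; rewrite fpsM big_ord_recl /= subn0.
rewrite big1 ?addr0 => [|i _]; last by rewrite mul0r.
by case: eqP; rewrite ?mulr0.
Qed.
HB.instance Definition _ :=
  GRing.isZmodMorphism.Build K (fps K) (@fpsC K) fpsC_is_additive.
HB.instance Definition _ :=
  GRing.isMonoidMorphism.Build K (fps K) (@fpsC K) fpsC_is_monoid.

Lemma fpsCM c f k : (fpsC c * f) k = c * f k.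
Proof.
rewrite fpsM big_ord_recl /= subn0 big1 ?addr0 // => i _.
by rewrite mul0r.
Qed.

Lemma fpsXMS f k : (fpsX K * f) k.+1 = f k.
Proof.
rewrite fpsM big_ord_recl /= mul0r add0r big_ord_recl /= mul1r.
rewrite subSS subn0 big1 ?addr0 // => i _.
by rewrite mul0r.
Qed.
Lemma fpsXM0 f : (fpsX K * f) 0%N = 0.
Proof. by rewrite fpsM0 mul0r. Qed.

Lemma fpsXn_mul n f k :
  (fpsX K ^+ n * f) k = if (k < n)%N then 0 else f (k - n)%N.
Proof.
elim: n k => [|n IHn] k; first by rewrite mul1r subn0.
rewrite exprS -mulrA; case: k => [|k]; first by rewrite fpsXM0.
by rewrite fpsXMS IHn ltnS subSS.
Qed.

Lemma fpsXn n k : (fpsX K ^+ n) k = (k == n)%:R.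
Proof.
have := fpsXn_mul n 1 k; rewrite mulr1 => ->; rewrite fps1 subn_eq0.
by case: ltngtP.
Qed.

Lemma fpsXnI n : injective ( *%R (fpsX K ^+ n)).
Proof.
move=> f g E; apply: fpsP => k.
have : (fpsX K ^+ n * f) (k + n)%N = (fpsX K ^+ n * g) (k + n)%N by rewrite E.
by rewrite !fpsXn_mul ltnNge leq_addl /= addnK.
Qed.

Lemma fps_div_Xn n f : (forall k, (k < n)%N -> f k = 0) ->
  f = fpsX K ^+ n * FPS (fun k => f (n + k)%N).
Proof.
move=> f0; apply: fpsP => k; rewrite fpsXn_mul; case: ltnP => [/f0 //|nk] /=.
by rewrite subnKC.
Qed.

Definition trunc N f : {poly K} := \poly_(i < N) f i.

Lemma coef_truncM N f g k : (k < N)%N -> (trunc N f * trunc N g)`_k = (f * g) k.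
Proof.
move=> kN; rewrite coefM /=; apply: eq_bigr => i _; rewrite !coef_poly.
have ik : (i <= k)%N by rewrite -ltnS.
by rewrite (leq_ltn_trans ik kN) (leq_ltn_trans (leq_subr i k) kN).
Qed.

Lemma fps_derivD f g : fps_deriv (f + g) = fps_deriv f + fps_deriv g.
Proof. by apply: fpsP => k /=; rewrite mulrnDl. Qed.
(** The coefficient of degree [k] depends only on terms of degree at most [k + 1], so the Leibniz
    rule is inherited from polynomials truncated below degree [k + 2]. *)
Lemma fps_derivM f g :
  fps_deriv (f * g) = fps_deriv f * g + f * fps_deriv g.
Proof.
apply: fpsP => k; rewrite fpsD.
transitivity ((trunc k.+2 f * trunc k.+2 g)^`()`_k).
  by rewrite coef_deriv coef_truncM.
rewrite derivM coefD.
have trD h i : (i <= k)%N -> (trunc k.+2 h)^`()`_i = fps_deriv h i.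
  by move=> ik; rewrite coef_deriv coef_poly ltnS ltnS ik.
have tr h i : (i <= k)%N -> (trunc k.+2 h)`_i = h i.
  by move=> ik; rewrite coef_poly ltnS leqW.
congr (_ + _).
  rewrite coefM fpsM; apply: eq_bigr => i _.
  by rewrite (tr g _ (leq_subr i k)) (trD f i (ltn_ord i)).
rewrite coefM fpsM; apply: eq_bigr => i _.
by rewrite (tr f i (ltn_ord i)) (trD g _ (leq_subr i k)).
Qed.
Lemma fps_derivC (c : K) : fps_deriv (fpsC c) = 0.
Proof. by apply: fpsP => k /=; rewrite mul0rn. Qed.
Lemma fps_derivX : fps_deriv (fpsX K) = 1.
Proof.
apply: fpsP => k; rewrite fps1 /= eqSS.
by case: k => [|k] //; exact: mul0rn.
Qed.
Lemma fps_deriv_sum (I : Type) (r : seq I) (F : I -> fps K) :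
  fps_deriv (\sum_(i <- r) F i) = \sum_(i <- r) fps_deriv (F i).
Proof.
elim/big_rec2: _ => [|i x y _ <-]; last exact: fps_derivD.
by apply: fpsP => k /=; rewrite mul0rn.
Qed.

End Fps.

(** * Values of series as limits of partial sums in a filtered ring *)

Section Eval.

(* Substitutions into series in one and in two variables are treated at once:
   they are continuous for a separated multiplicative filtration. *)
Record filtration (T : comNzRingType) (V : nat -> T -> Prop) : Prop :=
  Filtration {
    filt_all : forall x, V 0%N x;
    filt0 : forall N, V N 0;
    filtD : forall N x y, V N x -> V N y -> V N (x + y);
    filtM : forall a b x y, V a x -> V b y -> V (a + b)%N (x * y);
    filt_le : forall a b x, (a <= b)%N -> V b x -> V a x;
    filt_sep : forall x, (forall N, V N x) -> x = 0 }.

Variables (K T : comNzRingType) (V : nat -> T -> Prop) (io : {rmorphism K -> T}).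
Hypothesis VV : filtration V.
Implicit Types (f g : fps2 K) (x y r : T).

Lemma filtZ N x y : V N y -> V N (x * y).
Proof.
by move=> Vy; rewrite -[N]add0n; apply: filtM VV _ _ _ _ (filt_all VV x) Vy.
Qed.
Lemma filtN N x : V N x -> V N (- x).
Proof. by move=> Vx; rewrite -mulN1r; apply: filtZ. Qed.
Lemma filtB N x y : V N x -> V N y -> V N (x - y).
Proof. by move=> Vx Vy; apply: filtD => //; apply: filtN. Qed.
Lemma filt_sum N (I : Type) (s : seq I) (P : pred I) (F : I -> T) :
  (forall i, P i -> V N (F i)) -> V N (\sum_(i <- s | P i) F i).
Proof.
by move=> VF; elim/big_ind: _ => [|u v|//]; [apply: filt0|apply: filtD].
Qed.
Lemma filtX N x i : V 1%N x -> (N <= i)%N -> V N (x ^+ i).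
Proof.
move=> Vx; suff Vi : V i (x ^+ i) by move=> Ni; apply: (filt_le VV Ni).
elim: i => [|i IH]; first exact: filt_all.
by rewrite exprS -add1n; apply: (filtM VV).
Qed.

Definition peval1 N (a : nat -> T) x := \sum_(i < N) a i * x ^+ i.

(** Both sides are values at [x] of polynomials that agree in degrees below [N]; the higher powers
    of [x] lie in [V N]. *)
Lemma peval1M N (a b : nat -> T) x : V 1%N x ->
  V N (peval1 N a x * peval1 N b x -
       peval1 N (fun k => \sum_(i < k.+1) a i * b (k - i)%N) x).
Proof.
move=> Vx; pose A := \poly_(i < N) a i; pose B := \poly_(i < N) b i.
pose c k := \sum_(i < k.+1) a i * b (k - i)%N.
have -> : peval1 N a x * peval1 N b x - peval1 N c x =
    (A * B - \poly_(i < N) c i).[x].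
  by rewrite hornerD hornerN hornerM !horner_poly.
rewrite horner_coef; apply: filt_sum => i _.
have [iN|Ni] := ltnP i N; last by apply: filtZ; apply: filtX.
rewrite coefB coef_poly iN coefM (_ : \sum_(_ < _) _ = c i); last first.
  apply: eq_bigr => j _; rewrite !coef_poly.
  have ji : (j <= i)%N by rewrite -ltnS.
  by rewrite (leq_ltn_trans ji iN) (leq_ltn_trans (leq_subr j i) iN).
by rewrite subrr mul0r; apply: filt0.
Qed.

Definition peval N f x y : T :=
  \sum_(i < N) \sum_(j < N) io (f i j) * (x ^+ i * y ^+ j).

Lemma pevalE N f x y : peval N f x y =
  peval1 N (fun i => peval1 N (fun j => io (f i j)) y) x.
Proof.
apply: eq_bigr => i _; rewrite mulr_suml; apply: eq_bigr => j _.
by rewrite -mulrA [y ^+ j * _]mulrC.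
Qed.

Lemma pevalD N f g x y : peval N (f + g) x y = peval N f x y + peval N g x y.
Proof.
rewrite -big_split; apply: eq_bigr => i _; rewrite -big_split.
by apply: eq_bigr => j _; rewrite !fpsD rmorphD mulrDl.
Qed.

Lemma peval_filt M N f x y : V 1%N x -> V 1%N y ->
  (forall i j, (i + j < M)%N -> f i j = 0) -> V M (peval N f x y).
Proof.
move=> Vx Vy f0; apply: filt_sum => i _; apply: filt_sum => j _.
have [/f0 ->|ij] := ltnP (i + j) M; first by rewrite rmorph0 mul0r; apply: filt0.
apply: filtZ; apply: (filt_le VV ij).
by apply: (filtM VV); apply: filtX.
Qed.

(** The one-variable estimate is used twice: in [x], with the partial sums in [y] as coefficients,
    and then in [y] inside each coefficient. *)
Lemma pevalM N f g x y : V 1%N x -> V 1%N y ->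
  V N (peval N f x y * peval N g x y - peval N (f * g) x y).
Proof.
move=> Vx Vy; rewrite !pevalE.
set a := fun i => _; set b := fun i : nat => peval1 N (fun j => io (g i j)) y.
have H := @peval1M N a b x Vx.
rewrite -[_ - _](subrKA (peval1 N (fun k => \sum_(i < k.+1) a i * b (k - i)%N) x)).
apply: (filtD VV) => //; rewrite /peval1 -sumrB; apply: filt_sum => i _.
rewrite -mulrBl mulrC; apply: filtZ.
rewrite (_ : \sum_(j < N) _ = \sum_(k < i.+1) peval1 N (fun l =>
   \sum_(j < l.+1) io (f k j) * io (g (i - k)%N (l - j)%N)) y); last first.
  rewrite exchange_big; apply: eq_bigr => j _ /=.
  rewrite -mulr_suml fps_sum rmorph_sum; congr (_ * _).
  apply: eq_bigr => k _; rewrite fpsM rmorph_sum.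
  by apply: eq_bigr => l _; rewrite rmorphM.
by rewrite -sumrB; apply: filt_sum => k _; apply: peval1M.
Qed.

(** The value is characterized and not constructed: identities between substitutions then follow
    from [is_eval_uniq], as the filtration is separated. *)
Definition is_eval f x y r := forall N, V N (r - peval N f x y).

Lemma is_eval_uniq f x y r r' : is_eval f x y r -> is_eval f x y r' -> r = r'.
Proof.
move=> H H'; apply/eqP; rewrite -subr_eq0; apply/eqP; apply: (filt_sep VV) => N.
have -> : r - r' = (r - peval N f x y) - (r' - peval N f x y).
  by rewrite opprB addrA subrK.
by apply: filtB.
Qed.

Lemma is_evalD f g x y r s :
  is_eval f x y r -> is_eval g x y s -> is_eval (f + g) x y (r + s).
Proof.
by move=> Hr Hs N; rewrite pevalD opprD addrACA; apply: (filtD VV).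
Qed.

Lemma is_evalM f g x y r s : V 1%N x -> V 1%N y ->
  is_eval f x y r -> is_eval g x y s -> is_eval (f * g) x y (r * s).
Proof.
move=> Vx Vy Hr Hs N; rewrite -[_ - _](subrKA (peval N f x y * peval N g x y)).
apply: (filtD VV); last exact: pevalM.
rewrite -[r * s - _](subrKA (r * peval N g x y)) -mulrBr -mulrBl.
by apply: (filtD VV); [|rewrite mulrC]; apply: filtZ.
Qed.

Lemma is_eval_filt M f x y r : V 1%N x -> V 1%N y ->
  (forall i j, (i + j < M)%N -> f i j = 0) -> is_eval f x y r -> V M r.
Proof.
move=> Vx Vy f0 Hr; rewrite -[r](subrK (peval M f x y)).
by apply: (filtD VV) => //; apply: peval_filt.
Qed.

Lemma peval_cst N c x y : (0 < N)%N -> peval N (cst c) x y = io c.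
Proof.
case: N => // N _; rewrite /peval big_ord_recl big_ord_recl /= !mulr1.
rewrite big1 ?addr0 => [|i _]; last by rewrite rmorph0 mul0r.
rewrite big1 ?addr0 // => i _.
by rewrite big1 // => j _; rewrite rmorph0 mul0r.
Qed.

Lemma is_eval_cst c x y : is_eval (cst c) x y (io c).
Proof.
case=> [|N]; first exact: filt_all.
by rewrite peval_cst // subrr; apply: filt0.
Qed.

Lemma is_eval_X x y : V 1%N x -> is_eval X x y x.
Proof.
move=> Vx [|[|N]]; first exact: filt_all.
  rewrite /peval big_ord1 big_ord1 /= rmorph0 mul0r subr0 //.
rewrite /peval big_ord_recl big1 ?add0r => [|j _]; last first.
  by rewrite /= rmorph0 mul0r.
rewrite big_ord_recl big_ord_recl /= rmorph1 !mul1r mulr1.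
rewrite big1 ?addr0 => [|j _]; last by rewrite /= rmorph0 mul0r.
rewrite big1 ?addr0 => [|i _]; first by rewrite subrr; apply: filt0.
by rewrite big1 // => j _ /=; rewrite rmorph0 mul0r.
Qed.

Lemma is_eval_Y x y : V 1%N y -> is_eval Y x y y.
Proof.
move=> Vy [|[|N]]; first exact: filt_all.
  by rewrite /peval big_ord1 big_ord1 /= rmorph0 mul0r subr0.
rewrite /peval big_ord_recl [X in _ - (_ + X)]big1 ?addr0 => [|i _]; last first.
  by rewrite big1 // => j _ /=; rewrite rmorph0 mul0r.
rewrite big_ord_recl big_ord_recl /= rmorph0 rmorph1 !mul1r mul0r add0r.
rewrite big1 ?addr0 => [|j _]; last by rewrite mul0r.
by rewrite expr1 subrr; apply: filt0.
Qed.

End Eval.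

(** * Substitution *)

Arguments subst1 : simpl never.
Arguments subst2 : simpl never.

Section Subst.
Variable K : comNzRingType.
Implicit Types (f : fps2 K) (h : fps K) (g : fps K * fps K)
  (p : fps2 K * fps2 K).

Definition van1 N h := forall k, (k < N)%N -> h k = 0.
Definition van2 N f := forall i j, (i + j < N)%N -> f i j = 0.

Lemma van1_filtration : filtration van1.
Proof.
split=> //.
- by move=> N x y x0 y0 k kN; rewrite fpsD x0 ?y0 ?addr0.
- move=> a b x y x0 y0 k kab; rewrite fpsM big1 // => i _.
  have [/x0 ->|ai] := ltnP i a; first by rewrite mul0r.
  rewrite y0 ?mulr0 // ltn_subLR; last by rewrite -ltnS.
  by apply: leq_trans kab _; rewrite leq_add2r.
- by move=> a b x ab xb k ka; apply: xb; apply: leq_trans ka ab.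
- by move=> x x0; apply: fpsP => k; apply: (x0 k.+1).
Qed.

Lemma fps2M f f' i j : (f * f') i j =
  \sum_(k < i.+1) \sum_(l < j.+1) f k l * f' (i - k)%N (j - l)%N.
Proof. by rewrite fpsM fps_sum. Qed.

Lemma van2_filtration : filtration van2.
Proof.
split=> //.
- by move=> N x y x0 y0 i j ij; rewrite !fpsD x0 ?y0 ?addr0.
- move=> a b x y x0 y0 i j ij; rewrite fps2M big1 // => k _.
  rewrite big1 // => l _.
  have [/x0 ->|akl] := ltnP (k + l) a; first by rewrite mul0r.
  rewrite y0 ?mulr0 //.
  have ki : (k <= i)%N by rewrite -ltnS.
  have lj : (l <= j)%N by rewrite -ltnS.
  rewrite -(ltn_add2l (k + l)) addnACA !subnKC //.
  by apply: leq_trans ij _; rewrite leq_add2r.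
- by move=> a b x ab xb i j ij; apply: xb; apply: leq_trans ij ab.
- by move=> x x0; apply: fpsP => i; apply: fpsP => j; apply: (x0 (i + j).+1).
Qed.

Lemma van1M a b h h' : van1 a h -> van1 b h' -> van1 (a + b) (h * h').
Proof. exact: (filtM van1_filtration). Qed.
Lemma van2M a b f f' : van2 a f -> van2 b f' -> van2 (a + b) (f * f').
Proof. exact: (filtM van2_filtration). Qed.

Definition zc1 g := g.1 0%N = 0 /\ g.2 0%N = 0.
Definition zc2 p := p.1 0%N 0%N = 0 /\ p.2 0%N 0%N = 0.

Lemma zc1_van g : zc1 g -> van1 1 g.1 /\ van1 1 g.2.
Proof. by case=> g1 g2; split=> -[]. Qed.
Lemma zc2_van p : zc2 p -> van2 1 p.1 /\ van2 1 p.2.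
Proof. by case=> p1 p2; split=> -[|i] [|j]. Qed.

Lemma sum_widen2 (n N : nat) (F : nat -> nat -> K) : (n <= N)%N ->
  (forall i j, (n <= i)%N || (n <= j)%N -> F i j = 0) ->
  \sum_(i < n) \sum_(j < n) F i j = \sum_(i < N) \sum_(j < N) F i j.
Proof.
move=> nN F0.
rewrite (big_ord_widen N (fun i => \sum_(j < n) F i j)) // [LHS]big_mkcond.
apply: eq_bigr => i _; case: ltnP => [_|ni].
  rewrite (big_ord_widen N (fun j => F i j)) // big_mkcond /=.
  apply: eq_bigr => j _; case: ltnP => // nj.
  by rewrite F0 ?nj ?orbT.
by rewrite big1 // => j _; rewrite F0 ?ni.
Qed.

(** The finite sums that define [subst1] may be extended to all indices below [N]: a term with i > k
    or j > k has order greater than [k]. *)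
Lemma subst1_eval f g : zc1 g ->
  is_eval van1 (@fpsC K) f g.1 g.2 (subst1 f g).
Proof.
move=> /zc1_van[g1 g2] N k kN; rewrite fpsB /peval fps_sum.
under [X in _ - X]eq_bigr => i _ do rewrite fps_sum.
rewrite /= (@sum_widen2 k.+1 N
  (fun i j => f i j * (g.1 ^+ i * g.2 ^+ j) k)) // ?subrr //; last first.
  move=> i j ij; rewrite -[k.+1]addn0 in ij.
  have /(_ k) -> := filtM van1_filtration (filtX van1_filtration g1 (leqnn i))
    (filtX van1_filtration g2 (leqnn j)); first by rewrite mulr0.
  by case/orP: ij; rewrite addn0 => ij; apply: leq_trans ij _;
    rewrite ?leq_addr ?leq_addl.
apply/eqP; rewrite subr_eq0; apply/eqP.
by apply: eq_bigr => i _; apply: eq_bigr => j _; rewrite -fpsCM.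
Qed.

Lemma cst2M c f i j : (cst c * f) i j = c * f i j.
Proof. by rewrite fpsCM fpsCM. Qed.

Definition cstm : {rmorphism K -> fps2 K} := @fpsC (fps K) \o @fpsC K.

Lemma cstm2M c f i j : (cstm c * f) i j = c * f i j.
Proof. exact: cst2M. Qed.

Lemma subst2_eval f p : zc2 p ->
  is_eval van2 cstm f p.1 p.2 (subst2 f p).
Proof.
move=> /zc2_van[p1 p2] N a b abN; rewrite !fpsB /peval !fps_sum.
under [X in _ - X]eq_bigr => i _ do rewrite !fps_sum.
rewrite /= (@sum_widen2 (a + b).+1 N
  (fun i j => f i j * (p.1 ^+ i * p.2 ^+ j) a b)) // ?subrr //; last first.
  move=> i j ij; rewrite -[(a + b).+1]addn0 in ij.
  have /(_ a b) -> := filtM van2_filtration (filtX van2_filtration p1 (leqnn i))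
    (filtX van2_filtration p2 (leqnn j)); first by rewrite mulr0.
  by case/orP: ij; rewrite addn0 => ij; apply: leq_trans ij _;
    rewrite ?leq_addr ?leq_addl.
apply/eqP; rewrite subr_eq0; apply/eqP.
by apply: eq_bigr => i _; apply: eq_bigr => j _; rewrite -cst2M.
Qed.

Lemma fps2XY i j a b : (X ^+ i * Y ^+ j : fps2 K) a b = ((a == i) && (b == j))%:R.
Proof.
rewrite fpsXn_mul /Y -rmorphXn.
case: ltngtP => [ai|ai|->] /=; rewrite ?subnn //=; last by rewrite fpsXn.
by rewrite ifN // subn_eq0 -ltnNge.
Qed.

Lemma is_eval_XY f : is_eval van2 cstm f X Y f.
Proof.
move=> N a b abN; have aN := leq_ltn_trans (leq_addr b a) abN.
have bN := leq_ltn_trans (leq_addl a b) abN.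
rewrite !fpsB /peval !fps_sum.
rewrite (bigD1 (Ordinal aN)) // [X in _ - (_ + X)]big1 => [|i ia]; last first.
  rewrite !fps_sum big1 // => j _.
  rewrite cstm2M fps2XY [a == _]eq_sym; rewrite -val_eqE /= in ia.
  by rewrite (negPf ia) mulr0.
rewrite addr0 !fps_sum (bigD1 (Ordinal bN)) // big1 => [|j jb].
  by rewrite cstm2M fps2XY !eqxx /= addr0 mulr1 subrr.
rewrite cstm2M fps2XY [b == _]eq_sym; rewrite -val_eqE /= in jb.
by rewrite (negPf jb) andbF mulr0.
Qed.

Lemma zcXY : zc2 (X, Y). Proof. by []. Qed.

Lemma subst2_id f : subst2 f (X, Y) = f.
Proof.
apply: (is_eval_uniq van2_filtration (subst2_eval f zcXY)).
exact: is_eval_XY.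
Qed.

Lemma peval_morph (T : comNzRingType) (io : {rmorphism K -> T})
    (phi : fps2 K -> T) N f :
  {morph phi : u v / u + v} -> {morph phi : u v / u * v} ->
  (forall c, phi (cst c) = io c) -> 
  phi (peval cstm N f X Y) = peval io N f (phi X) (phi Y).
Proof.
move=> phiD phiM phiC.
have phi0 : phi 0 = 0 by rewrite -(rmorph0 cstm) phiC rmorph0.
have phi1 : phi 1 = 1 by rewrite -(rmorph1 cstm) phiC rmorph1.
have phiX u i : phi (u ^+ i) = phi u ^+ i.
  by elim: i => [|i IH]; rewrite ?expr0 // !exprS phiM IH.
rewrite /peval (big_morph phi phiD phi0); apply: eq_bigr => i _.
rewrite (big_morph phi phiD phi0); apply: eq_bigr => j _.
by rewrite !phiM !phiX phiC.
Qed.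

(** A ring morphism that is continuous for the filtrations is the evaluation at the images of [X]
    and [Y]. Associativity of substitution comes from this. *)
Lemma is_eval_morph (T : comNzRingType) (V : nat -> T -> Prop)
    (io : {rmorphism K -> T}) (phi : fps2 K -> T) f :
  {morph phi : u v / u + v} -> {morph phi : u v / u * v} ->
  (forall c, phi (cst c) = io c) -> 
  (forall N u, van2 N u -> V N (phi u)) ->
  is_eval V io f (phi X) (phi Y) (phi f).
Proof.
move=> phiD phiM phiC phiV N.
rewrite -(@peval_morph _ io phi N f) // -[phi f](subrK (phi (peval cstm N f X Y))).
rewrite -addrA subrr addr0.
have -> : phi f - phi (peval cstm N f X Y) = phi (f - peval cstm N f X Y).
  by apply: (addIr (phi (peval cstm N f X Y))); rewrite subrK -phiD subrK.
by apply: phiV; apply: is_eval_XY.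
Qed.

Section Subst1.
Variable g : fps K * fps K.
Hypothesis g0 : zc1 g.
Lemma subst1D u w : subst1 (u + w) g = subst1 u g + subst1 w g.
Proof.
apply: (is_eval_uniq van1_filtration (subst1_eval _ g0)).
by apply: is_evalD; [exact: van1_filtration|exact: subst1_eval..].
Qed.
Lemma subst1M u w : subst1 (u * w) g = subst1 u g * subst1 w g.
Proof.
apply: (is_eval_uniq van1_filtration (subst1_eval _ g0)).
have [g1 g2] := zc1_van g0.
by apply: is_evalM; [exact: van1_filtration|done|done|exact: subst1_eval..].
Qed.
Lemma subst1C c : subst1 (cst c) g = fpsC c.
Proof.
apply: (is_eval_uniq van1_filtration (subst1_eval _ g0)).
exact: is_eval_cst van1_filtration _ _ _.
Qed.
Lemma subst1_1 : subst1 1 g = 1.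
Proof. exact: (subst1C 1). Qed.
Lemma subst1_0 : subst1 0 g = 0.
Proof. by rewrite -(rmorph0 cstm) /= subst1C rmorph0. Qed.
Lemma subst1N u : subst1 (- u) g = - subst1 u g.
Proof. by apply/eqP; rewrite -addr_eq0 -subst1D addNr subst1_0. Qed.
Lemma subst1B u w : subst1 (u - w) g = subst1 u g - subst1 w g.
Proof. by rewrite subst1D subst1N. Qed.
Lemma subst1Xn i u : subst1 (u ^+ i) g = subst1 u g ^+ i.
Proof.
by elim: i => [|i IH]; rewrite ?subst1_1 // !exprS subst1M IH.
Qed.
Lemma subst1_X : subst1 X g = g.1.
Proof.
have [g1 g2] := zc1_van g0.
apply: (is_eval_uniq van1_filtration (subst1_eval _ g0)).
by apply: (is_eval_X _ van1_filtration).
Qed.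
Lemma subst1_Y : subst1 Y g = g.2.
Proof.
have [g1 g2] := zc1_van g0.
apply: (is_eval_uniq van1_filtration (subst1_eval _ g0)).
by apply: (is_eval_Y _ van1_filtration).
Qed.
Lemma subst1_van N u : van2 N u -> van1 N (subst1 u g).
Proof.
have [g1 g2] := zc1_van g0 => u0.
exact: (is_eval_filt van1_filtration g1 g2 u0 (subst1_eval u g0)).
Qed.
Lemma subst1_0E u : subst1 u g 0%N = u 0%N 0%N.
Proof. 
rewrite -[LHS]/(\sum_(i < 1) \sum_(j < 1) u i j * (g.1 ^+ i * g.2 ^+ j) 0%N).
by rewrite !big_ord1 !expr0 mulr1 fps1 mulr1. Qed.

Lemma subst1_unique (phi : fps2 K -> fps K) :
  {morph phi : u v / u + v} -> {morph phi : u v / u * v} ->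
  (forall c, phi (cst c) = fpsC c) -> 
  (forall N u, van2 N u -> van1 N (phi u)) ->
  phi X = g.1 -> phi Y = g.2 -> forall f, phi f = subst1 f g.
Proof.
move=> phiD phiM phiC phiV pX pY f.
apply: (is_eval_uniq van1_filtration _ (subst1_eval f g0)).
by rewrite -pX -pY; apply: is_eval_morph.
Qed.
End Subst1.

Section Subst2.
Variable p : fps2 K * fps2 K.
Hypothesis p0 : zc2 p.
Lemma subst2D u w : subst2 (u + w) p = subst2 u p + subst2 w p.
Proof.
apply: (is_eval_uniq van2_filtration (subst2_eval _ p0)).
by apply: is_evalD; [exact: van2_filtration|exact: subst2_eval..].
Qed.
Lemma subst2M u w : subst2 (u * w) p = subst2 u p * subst2 w p.
Proof.
apply: (is_eval_uniq van2_filtration (subst2_eval _ p0)).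
have [p1 p2] := zc2_van p0.
by apply: is_evalM; [exact: van2_filtration|done|done|exact: subst2_eval..].
Qed.
Lemma subst2C c : subst2 (cst c) p = cst c.
Proof.
apply: (is_eval_uniq van2_filtration (subst2_eval _ p0)).
exact: (is_eval_cst cstm van2_filtration).
Qed.
Lemma subst2_1 : subst2 1 p = 1.
Proof. exact: (subst2C 1). Qed.
Lemma subst2_0 : subst2 0 p = 0.
Proof. by rewrite -(rmorph0 cstm) /= subst2C. Qed.
Lemma subst2N u : subst2 (- u) p = - subst2 u p.
Proof. by apply/eqP; rewrite -addr_eq0 -subst2D addNr subst2_0. Qed.
Lemma subst2B u w : subst2 (u - w) p = subst2 u p - subst2 w p.
Proof. by rewrite subst2D subst2N. Qed.
Lemma subst2Xn i u : subst2 (u ^+ i) p = subst2 u p ^+ i.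
Proof.
by elim: i => [|i IH]; rewrite ?subst2_1 // !exprS subst2M IH.
Qed.
Lemma subst2_X : subst2 X p = p.1.
Proof.
have [p1 p2] := zc2_van p0.
apply: (is_eval_uniq van2_filtration (subst2_eval _ p0)).
by apply: (is_eval_X cstm van2_filtration).
Qed.
Lemma subst2_Y : subst2 Y p = p.2.
Proof.
have [p1 p2] := zc2_van p0.
apply: (is_eval_uniq van2_filtration (subst2_eval _ p0)).
by apply: (is_eval_Y cstm van2_filtration).
Qed.
Lemma subst2_van N u : van2 N u -> van2 N (subst2 u p).
Proof.
have [p1 p2] := zc2_van p0 => u0.
exact: (is_eval_filt van2_filtration p1 p2 u0 (subst2_eval u p0)).
Qed.
Lemma subst2_00 u : subst2 u p 0%N 0%N = u 0%N 0%N.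
Proof. 
rewrite -[LHS]/(\sum_(i < 1) \sum_(j < 1)
  u i j * (p.1 ^+ i * p.2 ^+ j) 0%N 0%N).
by rewrite !big_ord1 !expr0 mulr1 !fps1 mulr1. Qed.
End Subst2.

Lemma subst1_coef (f : fps2 K) (g : fps K * fps K) k : (subst1 f g) k =
  \sum_(i < k.+1) \sum_(j < k.+1) f i j * (g.1 ^+ i * g.2 ^+ j) k.
Proof. by []. Qed.

Opaque subst1 subst2.

Lemma zc1_comp p g : zc2 p -> zc1 g -> zc1 (subst1 p.1 g, subst1 p.2 g).
Proof. by case=> p1 p2 g0; split; exact: etrans (subst1_0E _ _) _. Qed.
Lemma zc2_comp p p' : zc2 p -> zc2 p' -> zc2 (subst2 p.1 p', subst2 p.2 p').
Proof. by case=> p1 p2 g0; split; exact: etrans (subst2_00 _ _) _. Qed.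

Lemma subst1_comp f p g : zc2 p -> zc1 g ->
  subst1 (subst2 f p) g = subst1 f (subst1 p.1 g, subst1 p.2 g).
Proof.
move=> p0 g0; apply: (subst1_unique (zc1_comp p0 g0)
  (phi := fun f => subst1 (subst2 f p) g)).
- by move=> u v; rewrite subst2D // subst1D.
- by move=> u v; rewrite subst2M // subst1M.
- by move=> c; rewrite subst2C // subst1C.
- by move=> N u u0; apply: subst1_van => //; apply: subst2_van.
- by rewrite subst2_X.
- by rewrite subst2_Y.
Qed.

Lemma subst2_comp f p p' : zc2 p -> zc2 p' ->
  subst2 (subst2 f p) p' = subst2 f (subst2 p.1 p', subst2 p.2 p').
Proof.
move=> p0 p'0.
apply: (is_eval_uniq van2_filtration _ (subst2_eval f (zc2_comp p0 p'0))).
suff : is_eval van2 cstm f (subst2 (subst2 X p) p') (subst2 (subst2 Y p) p')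
    (subst2 (subst2 f p) p') by rewrite (subst2_X p0) (subst2_Y p0).
apply: (is_eval_morph (phi := fun f => subst2 (subst2 f p) p')).
- by move=> u v; rewrite subst2D // subst2D.
- by move=> u v; rewrite subst2M // subst2M.
- by move=> c; rewrite !subst2C.
- by move=> N u u0; apply: subst2_van => //; apply: subst2_van.
Qed.

End Subst.

(** * Derivatives and pull-backs *)

Opaque fps_mul fps_add fps_opp.
(* Prevents [ring] from comparing power series up to conversion. *)
Ltac series_ring := repeat match goal with
  | |- context [subst1 ?u ?v] =>
    let x := fresh "x" in set x := (subst1 u v); clearbody x
  | |- context [subst2 ?u ?v] =>
    let x := fresh "x" in set x := (subst2 u v); clearbody x
  | |- context [fps_deriv ?u] =>
    let x := fresh "x" in set x := (fps_deriv u); clearbody x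
  | |- context [dX ?u] =>
    let x := fresh "x" in set x := (dX u); clearbody x
  | |- context [dY ?u] =>
    let x := fresh "x" in set x := (dY u); clearbody x
  end; ring.

Section Derivations.
Variable K : comNzRingType.
Implicit Types (f : fps2 K) (h : fps K) (g : fps K * fps K)
  (p : fps2 K * fps2 K).

(** [D] vanishes on polynomials and is continuous up to the loss of one degree. The Leibniz rule
    enters only through the stability of the kernel under products, so that the lemma covers
    derivations along a substitution, such as the difference of the two sides of a chain rule. *)
Lemma derivation_eq0 (T : comNzRingType) (V : nat -> T -> Prop)
    (D : fps2 K -> T) :
  filtration V -> {morph D : u v / u + v} ->
  (forall u v, D u = 0 -> D v = 0 -> D (u * v) = 0) ->
  (forall c, D (cst c) = 0) -> D X = 0 -> D Y = 0 ->
  (forall N u, van2 N.+1 u -> V N (D u)) -> forall f, D f = 0.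
Proof.
move=> VV DD DM DC DX DY DV f; apply: (filt_sep VV) => N.
have D0 : D 0 = 0 by rewrite -(DC 0) /cst !rmorph0.
have DXn u i : D u = 0 -> D (u ^+ i) = 0.
  move=> Du; elim: i => [|i IH]; first by rewrite -(DC 1) /cst !rmorph1.
  by rewrite exprS; apply: DM.
have Dp : D (peval (cstm K) N.+1 f X Y) = 0.
  rewrite /peval (big_morph D DD D0) big1 // => i _.
  rewrite (big_morph D DD D0) big1 // => j _.
  by apply: (DM); [exact: DC|apply: (DM); apply: (DXn)].
rewrite -[f](subrK (peval (cstm K) N.+1 f X Y)) DD Dp addr0.
by apply: DV; apply: is_eval_XY.
Qed.

Lemma dXD f f' : dX (f + f') = dX f + dX f'.
Proof. exact: fps_derivD. Qed.
Lemma dXM f f' : dX (f * f') = dX f * f' + f * dX f'.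
Proof. exact: fps_derivM. Qed.
Lemma dXC c : dX (cst c : fps2 K) = 0.
Proof. exact: fps_derivC. Qed.
Lemma dXX : dX (X : fps2 K) = 1.
Proof. exact: fps_derivX. Qed.
Lemma dXY : dX (Y : fps2 K) = 0.
Proof. exact: fps_derivC. Qed.

Lemma fps_mulrn (A : comNzRingType) (h : fps A) n k : (h *+ n) k = h k *+ n.
Proof. by elim: n => [|n IH]; rewrite ?mulr0n // !mulrS fpsD IH. Qed.

Lemma dX_van N f : van2 N.+1 f -> van2 N (dX f).
Proof.
move=> f0 i j ij; rewrite -[LHS]/((f i.+1 *+ i.+1) j) fps_mulrn f0 ?mul0rn //.
Qed.

Lemma dYD f f' : dY (f + f') = dY f + dY f'.
Proof. by apply: fpsP => i; exact: fps_derivD. Qed.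
Lemma dYM f f' : dY (f * f') = dY f * f' + f * dY f'.
Proof.
apply: fpsP => i; rewrite fpsD !fpsM -big_split /= fps_deriv_sum.
by apply: eq_bigr => j _; rewrite fps_derivM.
Qed.
Lemma dYC c : dY (cst c : fps2 K) = 0.
Proof.
apply: fpsP => -[|i]; first exact: fps_derivC.
by apply: fpsP => k; rewrite /= mul0rn.
Qed.
Lemma dYX : dY (X : fps2 K) = 0.
Proof.
apply: fpsP => i; rewrite -[LHS]/(fps_deriv ((i == 1%N)%:R)).
by rewrite -[_%:R](rmorph_nat (@fpsC K)); exact: fps_derivC.
Qed.
Lemma dYY : dY (Y : fps2 K) = 1.
Proof.
apply: fpsP => -[|i]; first exact: fps_derivX.
by apply: fpsP => k; rewrite /= mul0rn.
Qed.
Lemma dY_van N f : van2 N.+1 f -> van2 N (dY f).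
Proof. by move=> f0 i j ij; rewrite /= f0 ?mul0rn // addnS. Qed.

Lemma fps_deriv_van N h : van1 N.+1 h -> van1 N (fps_deriv h).
Proof. by move=> h0 i iN; rewrite /= h0 ?mul0rn. Qed.

Lemma van_mul1 N h h' : van1 N h -> van1 N (h * h').
Proof. by move=> h0; rewrite mulrC; apply: (filtZ (van1_filtration K)). Qed.
Lemma van_mul2 N f f' : van2 N f -> van2 N (f * f').
Proof. by move=> h0; rewrite mulrC; apply: (filtZ (van2_filtration K)). Qed.

Lemma subst1_chain f g : zc1 g ->
  fps_deriv (subst1 f g) =
  subst1 (dX f) g * fps_deriv g.1 + subst1 (dY f) g * fps_deriv g.2.
Proof.
move=> g0; apply/eqP; rewrite -subr_eq0; apply/eqP.
pose D f := fps_deriv (subst1 f g) -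
  (subst1 (dX f) g * fps_deriv g.1 + subst1 (dY f) g * fps_deriv g.2).
have VV := van1_filtration K.
apply: (derivation_eq0 (D := D) VV) => {f}; rewrite /D.
- move=> u v; rewrite dXD dYD !subst1D // fps_derivD; series_ring.
- move=> u v /eqP; rewrite subr_eq0 => /eqP Eu /eqP; rewrite subr_eq0 => /eqP Ev.
  rewrite dXM dYM !(subst1M, subst1D) // fps_derivM Eu Ev; series_ring.
- by move=> c; rewrite dXC dYC subst1C // fps_derivC !subst1_0 //; series_ring.
- by rewrite dXX dYX subst1_X // subst1_1 // subst1_0 //; series_ring.
- by rewrite dXY dYY subst1_Y // subst1_1 // subst1_0 //; series_ring.
- move=> N u u0; apply: (filtB VV).
    by apply: fps_deriv_van; apply: subst1_van.
  by apply: (filtD VV); apply: van_mul1; apply: subst1_van => //;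
    [apply: dX_van|apply: dY_van].
Qed.

Section Chain2.
Variable D : fps2 K -> fps2 K.
Hypotheses (DD : forall u v, D (u + v) = D u + D v)
  (DM : forall u v, D (u * v) = D u * v + u * D v)
  (DC : forall c, D (cst c) = 0)
  (DV : forall N u, van2 N.+1 u -> van2 N (D u)).

(** An abstract derivation [D] stands for both [dX] and [dY]. *)
Lemma subst2_chain f p : zc2 p ->
  D (subst2 f p) = subst2 (dX f) p * D p.1 + subst2 (dY f) p * D p.2.
Proof.
move=> p0; apply/eqP; rewrite -subr_eq0; apply/eqP.
pose E f := D (subst2 f p) -
  (subst2 (dX f) p * D p.1 + subst2 (dY f) p * D p.2).
have VV := van2_filtration K.
apply: (derivation_eq0 (D := E) VV) => {f}; rewrite /E.
- move=> u v; rewrite dXD dYD !subst2D // DD; series_ring.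
- move=> u v /eqP; rewrite subr_eq0 => /eqP Eu /eqP; rewrite subr_eq0 => /eqP Ev.
  rewrite dXM dYM !(subst2M, subst2D) // DM Eu Ev; series_ring.
- by move=> c; rewrite dXC dYC subst2C // DC !subst2_0 //; series_ring.
- by rewrite dXX dYX subst2_X // subst2_1 // subst2_0 //; series_ring.
- by rewrite dXY dYY subst2_Y // subst2_1 // subst2_0 //; series_ring.
- move=> N u u0; apply: (filtB VV).
    by apply: DV; apply: subst2_van.
  by apply: (filtD VV); apply: van_mul2; apply: subst2_van => //;
    [apply: dX_van|apply: dY_van].
Qed.
End Chain2.

End Derivations.

Section Pullback.
Variable K : comNzRingType.
Implicit Types (w : fps2 K * fps2 K) (p : fps2 K * fps2 K)
  (g : fps K * fps K).

(* [pull1], [pull2], [wedge] over any ring of coefficients. *)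
Definition gpull1 g w : fps K :=
  subst1 w.1 g * fps_deriv g.1 + subst1 w.2 g * fps_deriv g.2.
Definition gpull2 p w : fps2 K * fps2 K :=
  (subst2 w.1 p * dX p.1 + subst2 w.2 p * dX p.2,
   subst2 w.1 p * dY p.1 + subst2 w.2 p * dY p.2).
Definition gwedge w w' : fps2 K := w.1 * w'.2 - w.2 * w'.1.

Definition jac p : fps2 K := dX p.1 * dY p.2 - dY p.1 * dX p.2.
Definition comp2 p p' : fps2 K * fps2 K := (subst2 p.1 p', subst2 p.2 p').
Definition comp1 p g : fps K * fps K := (subst1 p.1 g, subst1 p.2 g).

Lemma gpull1_comp g p w : zc1 g -> zc2 p ->
  gpull1 g (gpull2 p w) = gpull1 (comp1 p g) w.
Proof.
move=> g0 p0; rewrite /gpull1 /gpull2 /comp1; cbn [fst snd].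
rewrite !subst1_chain // !subst1D // !subst1M // !subst1_comp //.
series_ring.
Qed.

Lemma gpull2_comp p' p w : zc2 p' -> zc2 p ->
  gpull2 p' (gpull2 p w) = gpull2 (comp2 p p') w.
Proof.
move=> g0 p0; rewrite /gpull2 /comp2; cbn [fst snd].
rewrite !(subst2_chain (@dXD _) (@dXM _) (@dXC _) (@dX_van _)) //.
rewrite !(subst2_chain (@dYD _) (@dYM _) (@dYC _) (@dY_van _)) //.
rewrite !subst2D // !subst2M // !subst2_comp //.
by congr pair; series_ring.
Qed.

Lemma gwedge_pull2 p w w' : zc2 p ->
  gwedge (gpull2 p w) (gpull2 p w') = subst2 (gwedge w w') p * jac p.
Proof.
move=> p0; rewrite /gwedge subst2B // !subst2M // /jac /gpull2.
cbn [fst snd]; series_ring.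
Qed.

Lemma jac_comp p p' : zc2 p -> zc2 p' ->
  jac (comp2 p p') = subst2 (jac p) p' * jac p'.
Proof.
move=> p0 p'0; rewrite /jac /comp2; cbn [fst snd].
rewrite !(subst2_chain (@dXD _) (@dXM _) (@dXC _) (@dX_van _)) //.
rewrite !(subst2_chain (@dYD _) (@dYM _) (@dYC _) (@dY_van _)) //.
rewrite subst2B // !subst2M //; series_ring.
Qed.

End Pullback.

(** * Orders *)

Section Orders.
Variable K : fieldType.
Implicit Types (f g h : fps K).

Lemma order_uniq f a b : fps_order f a -> fps_order f b -> a = b.
Proof.
by move=> [fa f0a] [fb f0b]; case: (ltngtP a b) => // [/f0b/fa|/f0a/fb].
Qed.

Lemma order_ex f : f <> 0 -> exists k, fps_order f k.
Proof.
move=> f0; have exf : exists k, f k != 0.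
  apply: contrapT => H; apply: f0; apply: fpsP => k; apply/eqP.
  by apply: contrapT => /negP fk; apply: H; exists k.
case: (ex_minnP exf) => k fk kmin; exists k; split; first exact/eqP.
move=> i ik; apply/eqP; apply: contraTT ik => fi.
by rewrite -leqNgt; apply: kmin.
Qed.

Lemma order_neq0 f k : fps_order f k -> f <> 0.
Proof. by move=> [fk _] f0; rewrite f0 in fk. Qed.

Lemma orderM f g a b :
  fps_order f a -> fps_order g b -> fps_order (f * g) (a + b).
Proof.
move=> [fa f0] [gb g0]; split; last first.
  by apply: van1M; [exact: f0|exact: g0].
have ab : (a < (a + b).+1)%N by rewrite ltnS leq_addr.
rewrite fpsM (bigD1 (Ordinal ab)) //= addKn big1 ?addr0 => [|i].
  by apply/eqP; rewrite mulf_eq0; apply/norP; split; apply/eqP.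
rewrite -val_eqE /= => ia; have [ia'|ai] := ltnP i a; first by rewrite f0 ?mul0r.
by rewrite g0 ?mulr0 //; move: (ltn_ord i) ia ai; lia.
Qed.

Lemma fps_mul_eq0 f g : f * g = 0 -> f = 0 \/ g = 0.
Proof.
move=> fg; have [->|/order_ex[a fa]] := EM (f = 0); first by left.
have [->|/order_ex[b gb]] := EM (g = 0); first by right.
by case: (order_neq0 (orderM fa gb)).
Qed.

Lemma orderM_inv f g k : fps_order (f * g) k ->
  exists a b, [/\ fps_order f a, fps_order g b & (a + b)%N = k].
Proof.
move=> fgk; have fg := order_neq0 fgk.
have [|a fa] := @order_ex f; first by move=> f0; apply: fg; rewrite f0 mul0r.
have [|b gb] := @order_ex g; first by move=> f0; apply: fg; rewrite f0 mulr0.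
by exists a, b; split => //; apply: order_uniq fgk; apply: orderM.
Qed.

Lemma order0 f : f 0%N != 0 -> fps_order f 0.
Proof. by move=> /eqP f0; split. Qed.

Lemma orderXn f a n : fps_order f a -> fps_order (f ^+ n) (a * n).
Proof.
move=> fa; elim: n => [|n IH]; last by rewrite exprS mulnS; apply: orderM.
by rewrite muln0; apply: order0; rewrite fps1 oner_eq0.
Qed.

Lemma order_eqM e1 e2 f g a1 a2 k : e1 * f = e2 * g ->
  fps_order e1 a1 -> fps_order e2 a2 -> fps_order f k ->
  exists2 l, fps_order g l & (a1 + k = a2 + l)%N.
Proof.
move=> E o1 o2 fk; have := orderM o1 fk; rewrite E.
move=> /orderM_inv[b [l [o2' gl bl]]]; exists l => //.
by rewrite -bl (order_uniq o2 o2').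
Qed.

Lemma order_van f k N : fps_order f k -> van1 N f -> (N <= k)%N.
Proof. by move=> [fk _] f0; rewrite leqNgt; apply/negP => /f0. Qed.

Lemma van1_order f k : van1 1 f -> fps_order f k -> (0 < k)%N.
Proof. by move=> f0 fk; apply: order_van fk f0. Qed.

Lemma order_fpsX : fps_order (fpsX K) 1.
Proof.
by split=> [|[]//]; rewrite /= ; apply/eqP; rewrite oner_eq0.
Qed.

(** * Weighted orders and orders along a curve *)

Section Weights.
Variables (n m : nat).
Hypotheses (nm : coprime n m) (n0 : (0 < n)%N) (m0 : (0 < m)%N).

Definition weight_order (f : fps2 K) (k : nat) : Prop :=
  (forall i j, (n * i + m * j < k)%N -> f i j = 0) /\
  exists i j, (n * i + m * j = k)%N /\ f i j <> 0.

(** If i < i', coprimality makes i' - i a positive multiple of [m], and then n i' alone reaches n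
    m. *)
Lemma weight_uniq k i j i' j' : (k < n * m)%N ->
  (n * i + m * j = k)%N -> (n * i' + m * j' = k)%N -> i = i' /\ j = j'.
Proof.
move=> kn; wlog ii' : i j i' j' / (i <= i')%N.
  move=> H E E'; case/orP: (leq_total i i') => ii; first exact: H.
  by have [-> ->] := H _ _ _ _ ii E' E.
move=> E E'.
have jj : (m * (j - j') = n * (i' - i))%N by rewrite !mulnBr; lia.
have /eqP : (i' - i = 0)%N.
  apply/eqP; rewrite -leqn0 leqNgt; apply/negP => i0.
  have : (m <= i' - i)%N.
    apply: dvdn_leq => //; rewrite -(@Gauss_dvdr _ n) 1?coprime_sym //.
    by rewrite -jj dvdn_mulr.
  have : (n * i' < n * m)%N by lia.
  by rewrite ltn_pmul2l //; lia.
rewrite subn_eq0 => i'i; have ii : i = i' by lia.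
split=> //; apply/eqP; rewrite -(eqn_pmul2l m0); apply/eqP; rewrite -ii in E'; lia.
Qed.

Lemma weight_order_ex (f : fps2 K) i j : f i j <> 0 ->
  exists2 k, weight_order f k & (k <= n * i + m * j)%N.
Proof.
move=> fij.
(* The bounded quantifiers make the property decidable; they lose nothing, since i and j are at most
   n i + m j. *)
pose P k := [exists i : 'I_k.+1, exists j : 'I_k.+1,
   ((n * i + m * j)%N == k) && (f i j != 0)].
have PP i' j' : f i' j' <> 0 -> P (n * i' + m * j')%N.
  move=> f'; have i'l : (i' < (n * i' + m * j').+1)%N by nia.
  have j'l : (j' < (n * i' + m * j').+1)%N by nia.
  apply/existsP; exists (Ordinal i'l); apply/existsP; exists (Ordinal j'l).
  by rewrite /= eqxx; apply/eqP.
have exP : exists k, P k by exists (n * i + m * j)%N; apply: PP.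
case: (ex_minnP exP) => k Pk kmin; exists k; last by apply: kmin; apply: PP.
split.
  move=> i' j' lt; apply: contrapT => /PP/kmin; by rewrite leqNgt lt.
case/existsP: Pk => i' /existsP[j' /andP[/eqP E /eqP F]].
by exists i', j'.
Qed.

Variables (x z : fps K).
Hypotheses (xn : fps_order x n) (zm : fps_order z m).

Lemma order_monomial i j : fps_order (x ^+ i * z ^+ j) (n * i + m * j).
Proof. by apply: orderM; apply: orderXn. Qed.

(** The monomial of weight [k] is the only one to contribute in degree [k], so nothing can cancel
    it. *)
Lemma weight_order_subst (f : fps2 K) k : (k < n * m)%N -> weight_order f k ->
  fps_order (subst1 f (x, z)) k.
Proof.
move=> knm [f0 [i0 [j0 [E fij]]]].
have mono0 i j l : (l < n * i + m * j)%N -> (x ^+ i * z ^+ j) l = 0.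
  by move=> lt; case: (order_monomial i j) => _; apply.
split; last first.
  move=> l lk; rewrite subst1_coef; cbn [fst snd].
  rewrite big1 // => i _; rewrite big1 // => j _.
  have [lt|le] := ltnP (n * i + m * j) k; first by rewrite f0 ?mul0r.
  by rewrite mono0 ?mulr0 //; apply: leq_trans le.
rewrite subst1_coef; cbn [fst snd].
have i0k : (i0 < k.+1)%N by nia.
have j0k : (j0 < k.+1)%N by nia.
have other i j : (i != i0) || (j != j0) -> f i j * (x ^+ i * z ^+ j) k = 0.
  move=> ne; have [lt|lt|eq] := ltngtP (n * i + m * j) k.
  - by rewrite f0 ?mul0r.
  - by rewrite mono0 ?mulr0.
  - by have [ii jj] := weight_uniq knm eq E; move: ne; rewrite ii jj !eqxx.
rewrite (bigD1 (Ordinal i0k)) //= (bigD1 (Ordinal j0k)) //=.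
rewrite [X in _ + X + _]big1 ?addr0 => [|j]; last first.
  by rewrite -val_eqE /= => ne; rewrite other // ne orbT.
rewrite big1 ?addr0 => [|i]; last first.
  by rewrite -val_eqE /= => ne; rewrite big1 // => j _; rewrite other // ne.
case: (order_monomial i0 j0); rewrite E => mk _.
by apply/eqP; rewrite mulf_eq0; apply/norP; split; apply/eqP.
Qed.

(** Some monomial of weight at most [k] occurs, otherwise the order would exceed [k]. The weighted
    order is therefore below n m, and is the order on the curve by the converse implication. *)
Lemma subst_weight_order (f : fps2 K) k : (k < n * m)%N ->
  fps_order (subst1 f (x, z)) k -> weight_order f k.
Proof.
move=> knm fk; have [[i [j [lt fij]]]|H] :=
    EM (exists i j, (n * i + m * j <= k)%N /\ f i j <> 0).
  have [l fl ll] := weight_order_ex fij.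
  have lk : (l <= k)%N by apply: leq_trans lt.
  by rewrite (order_uniq fk (weight_order_subst (leq_ltn_trans lk knm) fl)).
case: fk => + _; case; rewrite subst1_coef; cbn [fst snd].
rewrite big1 // => i _; rewrite big1 // => j _.
have [le|lt] := leqP (n * i + m * j) k.
  suff -> : f i j = 0 by rewrite mul0r.
  by apply: contrapT => fij; apply: H; exists i, j.
by case: (order_monomial i j) => _ ->; rewrite ?mulr0.
Qed.

End Weights.

(** * Functions on a parametrization contained in a smooth curve u = 0 *)

Section Smooth.
Variables (g : fps K * fps K) (xi u : fps2 K).
Hypotheses (g0 : zc1 g) (xi0 : xi 0%N 0%N = 0) (u0 : u 0%N 0%N = 0).
(** The jacobian determinant at the origin: if it is nonzero, two series without constant term are
    local coordinates. *)
Definition det2 (v w : fps2 K) : K := v 1%N 0%N * w 0%N 1%N - v 0%N 1%N * w 1%N 0%N.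
Hypotheses (dxu : det2 xi u != 0) (ug : subst1 u g = 0).
Let s (f : fps2 K) := subst1 f g.

Lemma van2_2 (f : fps2 K) : f 0%N 0%N = 0 -> f 1%N 0%N = 0 -> f 0%N 1%N = 0 ->
  van2 2 f.
Proof. by move=> f00 f10 f01 [|[|i]] [|[|j]]. Qed.

Lemma van2_1 (f : fps2 K) : f 0%N 0%N = 0 -> van2 1 f.
Proof. by move=> f00 [|i] [|j]. Qed.

Let solve_lin (z : fps2 K) : z 0%N 0%N = 0 ->
  exists c z', van2 2 z' /\ s z = fpsC c * s xi + s z'.
Proof.
(* Cramer's rule: c xi + d u has the linear part of [z], and [u] vanishes on [g]. *)
move=> z0; pose c := det2 z u / det2 xi u; pose d := det2 xi z / det2 xi u.
exists c, (z - (cst c * xi + cst d * u)); split; last first.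
  rewrite /s subst1B // subst1D // !subst1M // !subst1C // ug.
  by rewrite mulr0 addr0 addrC subrK.
apply: van2_2; rewrite !fpsB !fpsD !cst2M.
- by rewrite z0 xi0 u0 !mulr0 addr0 subrr.
- by rewrite /c /d; move: dxu; rewrite /det2 => D; field.
- by rewrite /c /d; move: dxu; rewrite /det2 => D; field.
Qed.

Let split_van N (r : fps2 K) : van2 N.+1 r ->
  exists r1 r2, [/\ van2 N r1, van2 N r2 & r = X * r1 + Y * r2].
Proof.
move=> rN; exists (FPS (fun i => r i.+1)), (fpsC (FPS (fun j => r 0%N j.+1))).
split=> [i j ij|[|i] j ij //|].
- by apply: rN; rewrite addSn ltnS.
- by apply: (rN 0%N).
apply: fpsP => -[|i]; rewrite fpsD /Y -rmorphM /=.
  rewrite fpsXM0 add0r; apply: fpsP => -[|j]; last by rewrite fpsXMS.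
  by rewrite fpsXM0; apply: rN.
by rewrite fpsXMS addr0.
Qed.

(** On the curve [X] and [Y] are multiples of [xi] up to order two, so a form of degree [N] in them
    is a multiple of [xi ^+ N] up to higher order. *)
Let lead N (r : fps2 K) : van2 N r ->
  exists c r', van2 N.+1 r' /\ s r = fpsC c * s xi ^+ N + s r'.
Proof.
have VV := van2_filtration K.
elim: N r => [|N IH] r rN.
  exists (r 0%N 0%N), (r - cst (r 0%N 0%N)); split.
    by apply: van2_1; rewrite fpsB /= subrr.
  by rewrite mulr1 /s subst1B // subst1C // addrC subrK.
have [r1 [r2 [/IH[c1 [r1' [v1 E1]]] /IH[c2 [r2' [v2 E2]]] ->]]] := split_van rN.
have [//|p1 [x1 [vx Ex]]] := solve_lin (z := X).
have [//|p2 [x2 [vy Ey]]] := solve_lin (z := Y).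
exists (p1 * c1 + p2 * c2),
  (x1 * (cst c1 * xi ^+ N) + X * r1' + (x2 * (cst c2 * xi ^+ N) + Y * r2')).
have vxi : van2 N (xi ^+ N) by apply: (filtX VV) => //; apply: van2_1.
split.
  have X1 : van2 1 (X : fps2 K) by exact: van2_1.
  have Y1 : van2 1 (Y : fps2 K) by exact: van2_1.
  apply: (filtD VV); apply: (filtD VV).
  - exact: (van2M vx (filtZ VV _ vxi)).
  - exact: (van2M X1 v1).
  - exact: (van2M vy (filtZ VV _ vxi)).
  - exact: (van2M Y1 v2).
have Es : s (X * r1 + Y * r2) = s X * s r1 + s Y * s r2.
  by rewrite /s subst1D // !subst1M.
rewrite Es E1 E2 !mulrDr {1}Ex {1}Ey rmorphD !rmorphM exprS.
rewrite /s !subst1D // !subst1M // !subst1Xn // !subst1C //.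
series_ring.
Qed.

Lemma smooth_expand N (f : fps2 K) : exists (phi : nat -> K) r,
  van2 N r /\ s f = \sum_(i < N) fpsC (phi i) * s xi ^+ i + s r.
Proof.
elim: N => [|N [phi [r [rN E]]]].
  by exists (fun=> 0), f; split=> //; rewrite big_ord0 add0r.
have [c [r' [r'N Er]]] := lead rN.
exists (fun i => if i == N then c else phi i), r'; split=> //.
rewrite big_ord_recr /= eqxx -addrA -Er E; congr (_ + _).
by apply: eq_bigr => i _; rewrite ltn_eqF.
Qed.

(** As [xi] is a coordinate on u = 0, every function restricts to a series in [xi], and the order of
    such a series on [g] is a multiple of that of [xi]. An expansion up to the degree [b] is enough
    to read off the order. *)
Lemma smooth_order_dvd (f : fps2 K) a b :
  fps_order (s xi) a -> fps_order (s f) b -> (a %| b)%N.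
Proof.
move=> xa fb; have [phi [r [rN E]]] := smooth_expand b.+1 f.
pose S := \sum_(i < b.+1) fpsC (phi i) * s xi ^+ i.
have SE k : (k <= b)%N -> S k = s f k.
  by move=> kb; rewrite E fpsD (subst1_van g0 rN) ?addr0.
have Sb : fps_order S b.
  split; first by rewrite SE //; case: fb.
  by move=> i ib; rewrite SE 1?ltnW //; case: fb => _; apply.
have [/existsP exi|] := boolP [exists i : 'I_b.+1, phi i != 0]; last first.
  move=> /existsPn phi0; case: (order_neq0 Sb); rewrite /S big1 // => i _.
  by have /negPn/eqP -> := phi0 i; rewrite rmorph0 mul0r.
have exi' : exists i, (i < b.+1)%N && (phi i != 0).
  by case: exi => i ?; exists i; rewrite ltn_ord.
case: (ex_minnP exi') => i0 /andP[i0b phi0] i0min.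
suff S0 : fps_order S (a * i0) by rewrite (order_uniq Sb S0) dvdn_mulr.
have xi_i i k : (k < a * i)%N -> (fpsC (phi i) * s xi ^+ i) k = 0.
  by move=> ki; rewrite fpsCM; case: (orderXn i xa) => _ ->; rewrite ?mulr0.
have a0 : (0 < a)%N.
  by apply: van1_order xa => -[|//] _; rewrite /s subst1_0E.
have lt0 i : (i < i0)%N -> phi i = 0.
  move=> ii0; apply/eqP; apply: contraTT (ii0) => phii.
  by rewrite -leqNgt; apply: i0min; rewrite phii (ltn_trans ii0).
split; last first.
  move=> k ki; rewrite /S fps_sum big1 // => i _.
  have [/lt0 ->|ii0] := ltnP i i0; first by rewrite rmorph0 mul0r.
  by rewrite xi_i //; apply: leq_trans ki _; rewrite leq_mul2l ii0 orbT.
rewrite /S fps_sum (bigD1 (Ordinal i0b)) //= big1 ?addr0.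
  rewrite fpsCM; apply/eqP; rewrite mulf_eq0; apply/norP; split=> //.
  by apply/eqP; case: (orderXn i0 xa).
move=> i; rewrite -val_eqE /= neq_ltn => /orP[/lt0 ->|ii0].
  by rewrite rmorph0 mul0r.
by rewrite xi_i // ltn_pmul2l.
Qed.

End Smooth.
End Orders.

(** * Blow-ups *)

Section Blowups.
Variable K : fieldType.
Implicit Types (f : fps2 K) (h : fps K) (g : fps K * fps K)
  (d : option K) (p : seq (option K)).

Lemma fps2M00 f f' : (f * f') 0%N 0%N = f 0%N 0%N * f' 0%N 0%N.
Proof. by rewrite !fpsM0. Qed.
Lemma fps2M01 f f' : (f * f') 0%N 1%N =
  f 0%N 0%N * f' 0%N 1%N + f 0%N 1%N * f' 0%N 0%N.
Proof.
by rewrite fpsM0 fpsM big_ord_recl big_ord_recl big_ord0 addr0.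
Qed.
Lemma fps2M10 f f' : (f * f') 1%N 0%N =
  f 0%N 0%N * f' 1%N 0%N + f 1%N 0%N * f' 0%N 0%N.
Proof.
by rewrite fpsM big_ord_recl big_ord_recl big_ord0 addr0 fpsD !fpsM0.
Qed.

Definition bl d : fps2 K * fps2 K :=
  if d is Some c then (X, X * (Y + cst c)) else (X * Y, Y).
Definition exc d : fps2 K := if d is Some _ then X else Y.

Fixpoint gblowup p : fps2 K * fps2 K :=
  if p is d :: p' then
    let uv := gblowup p' in
    if d is Some c then (uv.1, uv.1 * (uv.2 + cst c)) else (uv.1 * uv.2, uv.2)
  else (X, Y).

Definition blc d g : fps K * fps K :=
  if d is Some c then (g.1, g.1 * (g.2 + fpsC c)) else (g.1 * g.2, g.2).
Definition evp p g := foldr blc g p.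

Lemma zc2_bl d : zc2 (bl d).
Proof. by case: d => [c|]; split; rewrite ?fps2M00 ?mul0r. Qed.

Lemma zc2_gblowup p : zc2 (gblowup p).
Proof.
elim: p => [|d p [IH1 IH2]] //=.
by case: d => [c|]; split; rewrite ?fps2M00 ?IH1 ?mul0r.
Qed.

Lemma zc1_blc d g : zc1 g -> zc1 (blc d g).
Proof. by case=> g1 g2; case: d => [c|]; split; rewrite ?fpsM0 ?g1 ?mul0r. Qed.

Lemma zc1_evp p g : zc1 g -> zc1 (evp p g).
Proof. by move=> g0; elim: p => //= d p; apply: zc1_blc. Qed.

Lemma comp1_bl d g : zc1 g -> comp1 (bl d) g = blc d g.
Proof.
move=> g0; case: d => [c|]; rewrite /comp1 /bl /blc; cbn [fst snd].
  by rewrite subst1M // subst1D // subst1_X // subst1_Y // subst1C.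
by rewrite subst1M // subst1_X // subst1_Y.
Qed.

Lemma comp1_gblowup p g : zc1 g -> comp1 (gblowup p) g = evp p g.
Proof.
move=> g0; elim: p => [|d p IH].
  by rewrite /comp1 /= subst1_X // subst1_Y //; case: (g).
rewrite /evp -[foldr _ _ _]/(blc d (evp p g)) -IH; case: d => [c|];
  rewrite /comp1 /= /blc; cbn [fst snd].
  by rewrite subst1M // subst1D // subst1C.
by rewrite subst1M.
Qed.

(** The recursion peels off the first blow-up, whereas the resolution is followed by adding a last
    one. *)
Lemma gblowup_rcons p d : gblowup (rcons p d) = comp2 (gblowup p) (bl d).
Proof.
have d0 := zc2_bl d; elim: p => [|e p IH].
  rewrite /comp2 /= subst2_X // subst2_Y //.
  by case: d {d0}.
rewrite rcons_cons [LHS]/= IH /comp2; case: e => [c|] /=.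
  by rewrite subst2M // subst2D // subst2C.
by rewrite subst2M.
Qed.

Lemma jac_bl d : jac (bl d) = exc d.
Proof.
case: d => [c|]; rewrite /jac /bl /exc; cbn [fst snd].
  rewrite dXM dYM dXD dYD dXC dYC dXX dYX dXY dYY; ring.
rewrite dXM dYM dXX dYX dXY dYY; ring.
Qed.

Lemma fpsYM f i : (Y * f) i = fpsX K * f i.
Proof. by apply: fpsP => j; rewrite /Y fpsCM. Qed.

Lemma fpsXI f f' : X * f = X * f' -> f = f'.
Proof. exact: (@fpsXnI _ 1). Qed.
Lemma fpsYI f f' : Y * f = Y * f' -> f = f'.
Proof.
move=> E; apply: fpsP => i; apply: (@fpsXnI _ 1).
by rewrite expr1 -!fpsYM E.
Qed.
Lemma subst2_bl_peval d N f i j : (i + j < N)%N ->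
  (subst2 f (bl d)) i j = (subst2 (peval (cstm K) N f X Y) (bl d)) i j.
Proof.
move=> ijN; have d0 := zc2_bl d.
rewrite -[f in LHS](subrK (peval (cstm K) N f X Y)) subst2D // !fpsD.
by rewrite (subst2_van d0 (@is_eval_XY _ f N)) ?add0r.
Qed.

(** The monomial x^i y^j becomes x^(i+j) (y + c)^j: the coefficient of [X ^+ k] is the homogeneous
    part of degree [k] of [f], taken at (1, Y + c). *)
Lemma subst2_blS c f k : (subst2 f (bl (Some c))) k =
  \sum_(j < k.+1) fpsC (f (k - j)%N j) * (fpsX K + fpsC c) ^+ j.
Proof.
have d0 := zc2_bl (Some c); apply: fpsP => l.
rewrite (@subst2_bl_peval _ (k + l).+1) //.
set N := (k + l).+1; set L := fpsX K + fpsC c.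
have -> : subst2 (peval (cstm K) N f X Y) (bl (Some c)) =
    peval (cstm K) N f X (X * fpsC L).
  rewrite (peval_morph (io := cstm K) (phi := fun f => subst2 f (bl (Some c)))).
  - by rewrite (subst2_X d0) (subst2_Y d0) /L rmorphD.
  - by move=> u v; rewrite subst2D.
  - by move=> u v; rewrite subst2M.
  - by move=> a; rewrite subst2C.
have kN : (k < N)%N by rewrite /N ltnS leq_addr.
congr (fps_coef _ l); rewrite /peval fps_sum.
under eq_bigr => i _ do rewrite fps_sum.
have term (i j : nat) : (cstm K (f i j) * (X ^+ i * (X * fpsC L) ^+ j)) k =
    if (i + j == k)%N then fpsC (f i j) * L ^+ j else 0.
  rewrite exprMn [X ^+ i * _]mulrA -exprD mulrCA -rmorphXn /= -rmorphM /= fpsXn_mul.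
  by case: ltngtP => // [ij|->]; [rewrite /= subn_eq0 leqNgt ij|rewrite subnn].
under eq_bigr => i _ do under eq_bigr => j _ do rewrite term.
rewrite exchange_big /= [LHS](bigID (fun j : 'I_N => (j < k.+1)%N)) /=.
rewrite [X in _ + X]big1 ?addr0 => [|j]; last first.
  rewrite -leqNgt => kj; rewrite big1 // => i _; case: eqP => //; lia.
rewrite -(big_ord_widen N (fun j => \sum_(i < N) if (i + j == k)%N
   then fpsC (f i j) * L ^+ j else 0)) //.
apply: eq_bigr => j _; have jk : (j <= k)%N by rewrite -ltnS.
have kjN : (k - j < N)%N by apply: leq_ltn_trans (leq_subr _ _) kN.
rewrite (bigD1 (Ordinal kjN)) //= subnK // eqxx big1 ?addr0 // => i.
rewrite -val_eqE /= => ne; rewrite ifN //; lia.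
Qed.

Lemma subst2_blN f a b : (subst2 f (bl None)) a b =
  if (a <= b)%N then f a (b - a)%N else 0.
Proof.
have d0 := zc2_bl None.
rewrite (@subst2_bl_peval _ (a + b).+1) //.
set N := (a + b).+1.
have -> : subst2 (peval (cstm K) N f X Y) (bl None) =
    peval (cstm K) N f (X * Y) Y.
  rewrite (peval_morph (io := cstm K) (phi := fun f => subst2 f (bl None))).
  - by rewrite (subst2_X d0) (subst2_Y d0).
  - by move=> u v; rewrite subst2D.
  - by move=> u v; rewrite subst2M.
  - by move=> e; rewrite subst2C.
have term (i j : nat) : (cstm K (f i j) * ((X * Y) ^+ i * Y ^+ j)) a b =
    if (a == i) && (b == i + j)%N then f i j else 0.
  rewrite cstm2M exprMn -mulrA -exprD fps2XY.
  by case: (_ && _); rewrite ?mulr1 ?mulr0.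
rewrite /peval !fps_sum.
under eq_bigr => i _.
  rewrite !fps_sum; under eq_bigr => j _ do rewrite term.
  over.
have aN : (a < N)%N by rewrite ltnS leq_addr.
rewrite (bigD1 (Ordinal aN)) //= eqxx /= [X in _ + X]big1 ?addr0 => [|i].
  case: leqP => ab; last by rewrite big1 // => j _; case: eqP => //; lia.
  have baN : (b - a < N)%N by rewrite /N; lia.
  rewrite (bigD1 (Ordinal baN)) //= subnKC // eqxx big1 ?addr0 // => j.
  rewrite -val_eqE /= => ne; rewrite ifN //; lia.
by rewrite -val_eqE /= eq_sym => /negPf ai; rewrite big1 // => j _; rewrite ai.
Qed.

(** The listed coefficients of the quotient tell whether it is a unit and, if it vanishes, whether
    it forms local coordinates with [exc d]. *)
Lemma subst2_bl_div d f : f 0%N 0%N = 0 -> exists F,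
  subst2 f (bl d) = exc d * F /\
  match d with
  | Some c => F 0%N 0%N = f 1%N 0%N + c * f 0%N 1%N /\ F 0%N 1%N = f 0%N 1%N
  | None => F 0%N 0%N = f 0%N 1%N /\ F 1%N 0%N = f 1%N 0%N
  end.
Proof.
move=> f0; case: d => [c|].
  have HG k := subst2_blS c f k; move: (subst2 f (bl (Some c))) HG => G HG.
  exists (FPS (fun k => G k.+1)); split.
    apply: fpsP => -[|k]; last by rewrite fpsXMS.
    rewrite fpsXM0 HG big_ord_recl big_ord0 addr0 mulr1 /= f0.
    exact: rmorph0.
  have E : G 1%N = fpsC (f 1%N 0%N) + fpsC (f 0%N 1%N) * (fpsX K + fpsC c).
    by rewrite HG big_ord_recl big_ord_recl big_ord0 addr0 mulr1 expr1.
  change (G 1%N 0%N = f 1%N 0%N + c * f 0%N 1%N /\ G 1%N 1%N = f 0%N 1%N).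
  by rewrite E !fpsD !fpsCM !fpsD /= !add0r addr0 mulr1 [_ * c]mulrC.
have HG i j := subst2_blN f i j; move: (subst2 f (bl None)) HG => G HG.
exists (FPS (fun i => FPS (fun j => G i j.+1))); split.
  apply: fpsP => i; rewrite fpsYM; apply: fpsP => -[|j]; last by rewrite fpsXMS.
  by rewrite fpsXM0 HG; case: i.
change (G 0%N 1%N = f 0%N 1%N /\ G 1%N 1%N = f 1%N 0%N).
by rewrite !HG.
Qed.

End Blowups.

(** * Toric coordinates along the resolution *)

Section States.
Variable K : fieldType.
Implicit Types (f : fps2 K) (h : fps K) (g : fps K * fps K)
  (d : option K) (p : seq (option K)).

(** Formal divisibility. For an axis [z] and a convergent [f] it agrees with [dvd2], as the quotient
    by [X] or [Y] converges. *)
Definition fdvd (z f : fps2 K) := exists h : fps2 K, f = h * z.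
Definition in_fD p z := fdvd z (gblowup p).1 /\ fdvd z (gblowup p).2.

Lemma in_fD_exc p d : in_fD (rcons p d) (exc d).
Proof.
have [z1 z2] := zc2_gblowup p; rewrite /in_fD gblowup_rcons /comp2.
cbn [fst snd].
have [F1 [-> _]] := subst2_bl_div d z1; have [F2 [-> _]] := subst2_bl_div d z2.
by split; [exists F1|exists F2]; rewrite mulrC.
Qed.

Lemma in_fD_rcons p d (z z' h : fps2 K) : subst2 z (bl d) = h * z' -> in_fD p z ->
  in_fD (rcons p d) z'.
Proof.
move=> E [[h1 E1] [h2 E2]]; rewrite /in_fD gblowup_rcons /comp2 E1 E2.
cbn [fst snd]; have d0 := zc2_bl d; rewrite !(subst2M d0) E !mulrA.
by split; [exists (subst2 h1 (bl d) * h)|exists (subst2 h2 (bl d) * h)].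
Qed.

Definition funit f := f 0%N 0%N != 0.

Lemma funitM f f' : funit f -> funit f' -> funit (f * f').
Proof. by move=> u u'; rewrite /funit fps2M00 mulf_neq0. Qed.
Lemma funitX f i : funit f -> funit (f ^+ i).
Proof.
move=> u; elim: i => [|i IH]; last by rewrite exprS funitM.
by rewrite /funit !fps1 oner_eq0.
Qed.
Lemma funit1 : funit 1.
Proof. by rewrite /funit !fps1 oner_eq0. Qed.
Lemma funit_subst2 f d : funit f -> funit (subst2 f (bl d)).
Proof. by rewrite /funit subst2_00. Qed.
Lemma funit_order f g : zc1 g -> funit f -> fps_order (subst1 f g) 0.
Proof. by move=> g0 u; apply: order0; rewrite subst1_0E. Qed.

(* [v] is, up to a unit, the local equation of a component of the exceptional
   divisor. *)
Definition component p (v : fps2 K) := exists z e : fps2 K,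
  [/\ z = X \/ z = Y, in_fD p z, funit e & v = e * z].

(* Local coordinates (xi, zeta) at the infinitely near point p, in which the
   curve g has orders (a, b); the functions t1, t2 become monomials of exponents
   (i, j), (k, l), and the jacobian determinant of the blow-ups becomes the
   monomial of exponents (i + k - 1, j + l - 1). *)
Record toric N M p g (t1 t2 xi zeta : fps2 K) (a b i j k l : nat) : Prop := Toric {
  toric_xi0 : xi 0%N 0%N = 0;
  toric_zeta0 : zeta 0%N 0%N = 0;
  toric_det : det2 xi zeta != 0;
  toric_a : fps_order (subst1 xi g) a;
  toric_b : fps_order (subst1 zeta g) b;
  toric_cop : coprime a b;
  toric_t1 : exists2 e, funit e &
    subst2 t1 (gblowup p) = e * (xi ^+ i * zeta ^+ j);
  toric_t2 : exists2 e, funit e &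
    subst2 t2 (gblowup p) = e * (xi ^+ k * zeta ^+ l);
  toric_jac : exists e e', [/\ funit e, funit e' &
    e' * (jac (gblowup p) * (xi * zeta)) =
    e * (xi ^+ (i + k) * zeta ^+ (j + l))];
  toric_xi : b = N \/ component p xi;
  toric_zeta : a = M \/ component p zeta }.

Lemma det2C f f' : det2 f f' = - det2 f' f.
Proof. by rewrite /det2; ring. Qed.

Lemma toric_sym N M p g t1 t2 xi zeta a b i j k l :
  toric N M p g t1 t2 xi zeta a b i j k l ->
  toric M N p g t1 t2 zeta xi b a j i l k.
Proof.
case=> x0 z0 dt oa ob cop [e1 u1 E1] [e2 u2 E2] [e [e' [u u' E]]] cx cz.
split=> //.
- by rewrite det2C oppr_eq0.
- by rewrite coprime_sym.
- by exists e1; rewrite // [zeta ^+ _ * _]mulrC.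
- by exists e2; rewrite // [zeta ^+ _ * _]mulrC.
- by exists e, e'; split=> //; rewrite [zeta * _]mulrC E [zeta ^+ _ * _]mulrC.
Qed.

Lemma exc_component p d : component (rcons p d) (exc d).
Proof.
exists (exc d), 1; split; [|exact: in_fD_exc|exact: funit1|by rewrite mul1r].
by case: d; [left|right].
Qed.

(** The strict transform of an exceptional axis passes through the new point only if it is again an
    axis there, namely the one other than [exc d]; the other positions would make [w] a unit. *)
Lemma component_step p d (v w : fps2 K) : v 0%N 0%N = 0 -> w 0%N 0%N = 0 ->
  subst2 v (bl d) = exc d * w -> component p v -> component (rcons p d) w.
Proof.
move=> v0 w0 E [z [e [zXY zD ue vE]]]; have d0 := zc2_bl d.
have u' := funit_subst2 d ue.
have bad : w <> subst2 e (bl d).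
  by move=> wE; move: u'; rewrite /funit -wE w0 eqxx.
move: E; rewrite vE (subst2M d0); case: zXY zD => -> zD.
  rewrite (subst2_X d0); case: d d0 u' bad => [c|] d0 u' bad.
    by rewrite [(bl _).1]/= [exc _]/= mulrC => /fpsXI/esym/bad.
  rewrite [(bl _).1]/= [exc _]/= mulrA [_ * Y]mulrC => /fpsYI <-.
  exists X, (subst2 e (bl None)); split=> //; first by left.
  by apply: (@in_fD_rcons _ _ X _ Y) => //; rewrite (subst2_X d0) mulrC.
rewrite (subst2_Y d0); case: d d0 u' bad => [c|] d0 u' bad.
  rewrite [(bl _).2]/= [exc _]/= mulrCA => /fpsXI wE.
  have c0 : c = 0.
    move: w0; rewrite -wE fps2M00 fpsD [Y _ _]/= add0r => /eqP.
    by rewrite mulf_eq0 (negPf u') => /eqP.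
  have YE : Y + cst c = Y :> fps2 K by rewrite c0 /cst !rmorph0 addr0.
  exists Y, (subst2 e (bl (Some c))); split=> //; first by right.
    by apply: (@in_fD_rcons _ _ Y _ X) => //; rewrite (subst2_Y d0) /= YE.
  by rewrite -wE YE.
by rewrite [(bl _).2]/= [exc _]/= mulrC => /fpsYI/esym/bad.
Qed.

(** One subtraction of Euclid's algorithm. As a < b, the strict transform of [zeta] goes through the
    new point and that of [xi] does not; the new coordinates are [exc d] and the strict transform of
    [zeta]. The order [a] does not change, so it keeps its initial value [M] as long as [zeta] is
    not exceptional. *)
Lemma toric_step N M p d g t1 t2 xi zeta a b i j k l : zc1 g -> (a < b)%N ->
  toric N M p (blc d g) t1 t2 xi zeta a b i j k l ->
  exists zeta', toric N M (rcons p d) g t1 t2 (exc d) zeta'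
    a (b - a) (i + j) j (k + l) l.
Proof.
move=> g0 ab [x0 z0 dt oa ob cop [e1 u1 E1] [e2 u2 E2] [e [e' [u u' E]]] cx cz].
have d0 := zc2_bl d; have p0 := zc2_gblowup p.
have [F [xE FE]] := subst2_bl_div d x0.
have [G [zE GE]] := subst2_bl_div d z0.
move: oa; rewrite -(comp1_bl _ g0) -(subst1_comp _ d0 g0) xE (subst1M g0).
move=> /orderM_inv[o [oF [oo oFo aE]]].
move: ob; rewrite -(comp1_bl _ g0) -(subst1_comp _ d0 g0) zE (subst1M g0).
move=> /orderM_inv[o' [oG [oo' oGo bE]]].
have {oo'} oE := order_uniq oo' oo; rewrite {}oE in bE.
(* If [G] were a unit, [zeta] would have the order of [exc d] on the curve, which is at most [a]. *)
have G0 : G 0%N 0%N = 0.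
  apply/eqP; apply: contraT => G0.
  by have := order_uniq oGo (funit_order g0 G0); lia.
(* As [G] vanishes at the point, the determinant of [xi] and [zeta] factors as the constant term of
   [F] times the determinant of [exc d] and [G]. *)
have [F0 dG] : funit F /\ det2 (exc d) G != 0.
  rewrite /funit; case: d FE GE {d0 xE zE oo} => [c|] [FE1 FE2] [GE1 GE2].
    have H : zeta 1%N 0%N = - (c * zeta 0%N 1%N).
      by apply/eqP; rewrite -addr_eq0 -GE1 G0.
    move: dt; rewrite /det2 H FE1 [exc _ _ _]/= GE2 [X 0%N 1%N]/= mul0r subr0 mul1r.
    have -> : xi 1%N 0%N * zeta 0%N 1%N - xi 0%N 1%N * - (c * zeta 0%N 1%N) =
      (xi 1%N 0%N + c * xi 0%N 1%N) * zeta 0%N 1%N by ring.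
    by rewrite mulf_eq0 => /norP.
  move: dt; rewrite /det2 -GE1 G0 mulr0 sub0r oppr_eq0 mulf_eq0 FE1 GE2.
  by rewrite /= mul0r sub0r mul1r oppr_eq0 => /norP.
have oF0 : oF = 0%N by apply: order_uniq oFo (funit_order g0 F0).
exists G; split=> //.
- by case: d {d0 FE GE xE zE oo dG}.
- by rewrite -aE oF0 addn0.
- by rewrite (_ : (b - a)%N = oG) //; lia.
- by rewrite /coprime -gcdnDl subnKC ?(ltnW ab).
- exists (subst2 e1 (bl d) * F ^+ i); first by rewrite funitM ?funitX ?funit_subst2.
  rewrite gblowup_rcons /comp2 -(subst2_comp _ p0 d0) E1.
  rewrite !(subst2M d0) !(subst2Xn d0) xE zE.
  by rewrite !exprMn exprD; ring.
- exists (subst2 e2 (bl d) * F ^+ k); first by rewrite funitM ?funitX ?funit_subst2.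
  rewrite gblowup_rcons /comp2 -(subst2_comp _ p0 d0) E2.
  rewrite !(subst2M d0) !(subst2Xn d0) xE zE.
  by rewrite !exprMn exprD; ring.
(* The jacobian gains a factor [exc d]. With the one that is now a coordinate, it accounts for the
   two factors [exc d] extracted from [xi] and [zeta]. *)
- exists (subst2 e (bl d) * F ^+ (i + k)), (subst2 e' (bl d) * F).
  split; [by rewrite funitM ?funitX ?funit_subst2|by rewrite funitM ?funit_subst2|].
  rewrite gblowup_rcons (jac_comp p0 d0) jac_bl.
  have := congr1 (fun f => subst2 f (bl d)) E.
  rewrite /= !(subst2M d0) !(subst2Xn d0) xE zE => E'.
  have -> : (i + j + (k + l) = i + k + (j + l))%N by lia.
  transitivity (subst2 e' (bl d) *
    (subst2 (jac (gblowup p)) (bl d) * (exc d * F * (exc d * G)))); first by ring.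
  rewrite E' !exprMn [exc d ^+ (_ + (j + l))]exprD.
  by move: (F ^+ _) (G ^+ _) (exc d ^+ _) (exc d ^+ _) => *; ring.
- by right; apply: exc_component.
- by case: cz => [|cz]; [left|right; apply: component_step cz].
Qed.

End States.

(** * Points of the sequence without normal crossings, and the last point *)

Section NotNormalCrossings.
Variable K : fieldType.
Implicit Types (f : fps2 K) (g : fps K * fps K)
  (d : option K) (p : seq (option K)).

Lemma fdvdXE f : fdvd X f <-> f 0%N = 0.
Proof.
split=> [[h ->]|f0]; first by rewrite mulrC fpsXM0.
exists (FPS (fun k => f k.+1)); rewrite mulrC.
by apply: fpsP => -[|k]; rewrite ?fpsXM0 ?fpsXMS.
Qed.

Lemma fdvdYE f : fdvd Y f <-> forall i, f i 0%N = 0.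
Proof.
split=> [[h ->] i|f0]; first by rewrite mulrC fpsYM fpsXM0.
exists (FPS (fun i => FPS (fun k => f i k.+1))); rewrite mulrC.
apply: fpsP => i; rewrite fpsYM.
by apply: fpsP => -[|k]; rewrite ?fpsXM0 ?fpsXMS.
Qed.

(** Setting [z] to 0 leaves a ring of series in one variable, which is a domain. *)
Lemma fdvd_prime z f f' : z = X \/ z = Y -> fdvd z (f * f') ->
  fdvd z f \/ fdvd z f'.
Proof.
case=> ->; first by rewrite !fdvdXE fpsM0; apply: fps_mul_eq0.
rewrite !fdvdYE => H.
pose F := FPS (fun i => f i 0%N); pose F' := FPS (fun i => f' i 0%N).
have : F * F' = 0.
  apply: fpsP => i; transitivity ((f * f') i 0%N); last exact: H.
  rewrite !fpsM fps_sum.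
  by apply: eq_bigr => k _; rewrite fpsM0.
by case/fps_mul_eq0 => E; [left|right] => i;
  move/(congr1 (fun h : fps K => h i)): E.
Qed.

Lemma det2_multiple (f z h w : fps2 K) : z 0%N 0%N = 0 -> f = h * z ->
  det2 f w = h 0%N 0%N * det2 z w.
Proof.
by move=> z0 ->; rewrite /det2 fps2M10 fps2M01 z0; ring.
Qed.

Lemma pluecker f f' f'' :
  (det2 f f' * f'' 1%N 0%N + det2 f' f'' * f 1%N 0%N + det2 f'' f * f' 1%N 0%N = 0)
  /\ (det2 f f' * f'' 0%N 1%N + det2 f' f'' * f 0%N 1%N + det2 f'' f * f' 0%N 1%N
    = 0).
Proof. by rewrite /det2; split; ring. Qed.

Lemma det2_neq0 f f' f'' : det2 f f' != 0 -> det2 f f'' = 0 -> det2 f' f'' = 0 ->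
  f'' 1%N 0%N = 0 /\ f'' 0%N 1%N = 0.
Proof.
move=> D E E'; have [] := pluecker f f' f''.
rewrite [det2 f'' f]det2C E E' oppr0 !mul0r !addr0 => /eqP + /eqP.
by rewrite !mulf_eq0 !(negPf D) /= => /eqP-> /eqP->.
Qed.

Section Toric.
Variables (p : seq (option K)) (g : fps K * fps K) (u v : fps2 K).
Hypotheses (g0 : zc1 g) (u0 : u 0%N 0%N = 0) (duv : det2 u v != 0)
  (ug : subst1 u g = 0) (DX : in_fD p X -> fdvd X (u * v))
  (DY : in_fD p Y -> fdvd Y (u * v)).

(** A component of D divides [u * v]. It cannot be u = 0, as its equation does not vanish
    identically on the curve; hence it divides [v], and its linear part is proportional to that of
    [v]. *)
Lemma component_det2 w a : fps_order (subst1 w g) a -> component p w ->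
  det2 w v = 0.
Proof.
move=> wa [z [e [zXY zD ue wE]]].
have z0 : z 0%N 0%N = 0 by case: zXY => ->.
have zg : subst1 z g <> 0.
  by move=> zg; apply: (order_neq0 wa); rewrite wE (subst1M g0) zg mulr0.
have /fdvd_prime : fdvd z (u * v) by case: zXY zD => ->; [apply: DX|apply: DY].
case/(_ zXY) => -[h hE].
  have h0 : funit h.
    rewrite /funit; apply: contraNneq duv => h0.
    by rewrite (det2_multiple v z0 hE) h0 mul0r.
  move: ug; rewrite hE (subst1M g0) => /fps_mul_eq0[] //.
  by have /order_neq0 := funit_order g0 h0.
rewrite (det2_multiple v z0 wE) det2C (det2_multiple z z0 hE) /det2.
ring.
Qed.

(** As [zeta] has order 1, which is not the initial value, [xi] is exceptional, hence tangent to [v]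
    and transversal to [u]. Its order then divides 1, so [zeta] is exceptional too, and both
    coordinates would be tangent to [v]. *)
Lemma toric_not_nc_half N M t1 t2 xi zeta a i j k l : N <> 1%N -> M <> 1%N ->
  toric N M p g t1 t2 xi zeta a 1 i j k l -> False.
Proof.
move=> N1 M1 [x0 z0 dt oa ob cop _ _ _ cx cz].
have cxi : component p xi by case: cx => // /esym/N1.
have xv := component_det2 oa cxi.
have xu : det2 xi u != 0.
  apply: contraNneq dt => xu.
  have [] := det2_neq0 duv _ _ (f'' := xi);
    rewrite ?[det2 _ xi]det2C ?xu ?xv ?oppr0 //.
  by move=> x1 x2; rewrite /det2 x1 x2; apply/eqP; ring.
have := smooth_order_dvd g0 x0 u0 xu ug oa ob.
rewrite dvdn1 => /eqP a1; subst a.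
have czeta : component p zeta by case: cz => // /esym/M1.
have zv := component_det2 ob czeta.
have [v1 v2] := det2_neq0 dt xv zv.
by move: duv; rewrite /det2 v1 v2 !mulr0 subrr eqxx.
Qed.

(** One of the two coordinates is transversal to [u]; its order divides the other one, hence is 1 by
    coprimality. *)
Lemma toric_not_nc N M t1 t2 xi zeta a b i j k l : N <> 1%N -> M <> 1%N ->
  toric N M p g t1 t2 xi zeta a b i j k l -> False.
Proof.
move=> N1 M1 T; have [x0 z0 dt oa ob cop _ _ _ _ _] := T.
have [xu|xu] := eqVneq (det2 xi u) 0.
  have zu : det2 zeta u != 0.
    apply: contraNneq duv => zu; have [u1 u2] := det2_neq0 dt xu zu.
    by rewrite /det2 u1 u2 !mul0r subrr.
  have /gcdn_idPl := smooth_order_dvd g0 z0 u0 zu ug ob oa.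
  rewrite gcdnC (eqP cop) => b1; subst b.
  exact: toric_not_nc_half N1 M1 T.
have /gcdn_idPl := smooth_order_dvd g0 x0 u0 xu ug oa ob.
rewrite (eqP cop) => a1; subst a.
exact: toric_not_nc_half M1 N1 (toric_sym T).
Qed.

End Toric.

(* At the last point blown up, both axes are exceptional and may serve as toric
   coordinates. *)
Record terminal (t1 t2 : fps2 K) (n m : nat) q : Prop := Terminal {
  terminal_X : in_fD q X;
  terminal_Y : in_fD q Y;
  terminal_mono : exists i j k l e1 e2 e e', [/\ (i + j = n)%N, (k + l = m)%N,
    [/\ funit e1, funit e2, funit e & funit e'] &
    [/\ subst2 t1 (gblowup q) = e1 * (X ^+ i * Y ^+ j),
        subst2 t2 (gblowup q) = e2 * (X ^+ k * Y ^+ l) &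
        e' * (jac (gblowup q) * (X * Y)) = e * (X ^+ (i + k) * Y ^+ (j + l))]] }.

Lemma toric_terminal_XY N M q g t1 t2 e f i j k l :
  in_fD q X -> in_fD q Y -> funit e -> funit f ->
  toric N M q g t1 t2 (e * X) (f * Y) 1 1 i j k l ->
  terminal t1 t2 (i + j) (k + l) q.
Proof.
move=> qX qY ue uf [_ _ _ _ _ _ [e1 u1 E1] [e2 u2 E2] [h [h' [u u' E]]] _ _].
split=> //; exists i, j, k, l, (e1 * (e ^+ i * f ^+ j)), (e2 * (e ^+ k * f ^+ l)).
exists (h * (e ^+ (i + k) * f ^+ (j + l))), (h' * (e * f)).
split; [by []|by []|by split; rewrite ?funitM ?funitX|].
move: (jac _) E => J; rewrite E1 E2 !exprMn => E.
move: (X : fps2 K) (Y : fps2 K) E => x y E.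
split; [by ring|by ring|].
by transitivity (h' * (J * (e * x * (f * y)))); [ring|rewrite E; ring].
Qed.

(** With orders (1, 1) both coordinates are exceptional, hence are the two axes up to units. The
    curve is smooth and transversal to both, so its next direction is neither axis. *)
Lemma toric_terminal N M q d g t1 t2 xi zeta i j k l : zc1 g ->
  N <> 1%N -> M <> 1%N ->
  toric N M q (blc d g) t1 t2 xi zeta 1 1 i j k l ->
  terminal t1 t2 (i + j) (k + l) q /\
  exists c, [/\ d = Some c, c != 0 & fps_order g.1 1].
Proof.
move=> g0 N1 M1 T; have [x0 z0 dt oa ob _ _ _ _ cx cz] := T.
have [z [e [zXY zD ue xE]]] : component q xi by case: cx => // /esym/N1.
have [z' [e' [zXY' zD' ue' zE]]] : component q zeta by case: cz => // /esym/M1.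
have gq0 := zc1_blc d g0.
have ord1 w v : funit w -> fps_order (subst1 (w * v) (blc d g)) 1 ->
    fps_order (subst1 v (blc d g)) 1.
  move=> uw; rewrite (subst1M gq0) => /orderM_inv[r [r' [H H' <-]]].
  by rewrite (order_uniq H (funit_order gq0 uw)).
have oz : fps_order (subst1 z (blc d g)) 1 by apply: (ord1 e); rewrite -?xE.
have oz' : fps_order (subst1 z' (blc d g)) 1 by apply: (ord1 e'); rewrite -?zE.
have zz' : z <> z'.
  have z00 : z 0%N 0%N = 0 by case: zXY => ->.
  have dzz : det2 z z = 0 by rewrite /det2; ring.
  move=> zz'; move: dt; rewrite xE zE -zz' (@det2_multiple _ z e) // det2C.
  by rewrite (@det2_multiple _ z e') // dzz mulr0 oppr0 mulr0 eqxx.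
have [TT [oX oY]] : terminal t1 t2 (i + j) (k + l) q /\
   fps_order (subst1 X (blc d g)) 1 /\ fps_order (subst1 Y (blc d g)) 1.
  case: zXY zXY' => E [] E'; subst z z' => //.
    split=> //; apply: (@toric_terminal_XY N M q (blc d g) t1 t2 e e') => //.
    by rewrite -xE -zE.
  split=> //; rewrite [(i + j)%N]addnC [(k + l)%N]addnC.
  apply: (@toric_terminal_XY M N q (blc d g) t1 t2 e' e) => //.
  by rewrite -xE -zE; apply: toric_sym.
split=> //; move: oX oY; rewrite (subst1_X gq0) (subst1_Y gq0).
case: d {T oa ob gq0 ord1 oz oz'} => [c|]; rewrite /blc; cbn [fst snd].
  move=> o1 /orderM_inv[r [r' [H H' E]]]; exists c; split=> //.
  have r'0 : r' = 0%N by have := order_uniq o1 H; lia.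
  case: H'; rewrite r'0 fpsD (proj2 g0) add0r => /eqP c0 _.
  by move: c0; rewrite /= .
move=> /orderM_inv[r [r' [H H' E]]] o2.
have r'1 := order_uniq o2 H'; have r0 : r = 0%N by lia.
by case: H; rewrite r0 (proj1 g0).
Qed.

End NotNormalCrossings.

(** * The cuspidal divisor away from the corners *)

Section NonCorner.
Variable K : fieldType.
Implicit Types (f : fps2 K) (g : fps K * fps K).

Lemma order_shift c j k : (j <= k)%N ->
  ((fpsX K + fpsC c) ^+ j) k = (j == k)%:R.
Proof.
elim: j k => [|j IH] k; first by rewrite fps1 eq_sym.
case: k => // k jk; rewrite exprS mulrDl fpsD fpsXMS fpsCM (IH _ jk).
by rewrite (IH _ (leqW jk)) eqSS [(j == k.+1)%N]ltn_eqF // mulr0 addr0.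
Qed.

Lemma shift_free c n (a : nat -> K) :
  \sum_(j < n) fpsC (a j) * (fpsX K + fpsC c) ^+ j = 0 ->
  forall j, (j < n)%N -> a j = 0.
Proof.
elim: n => // n IH; rewrite big_ord_recr /= => E.
have an : a n = 0.
  move: (congr1 (fun h : fps K => h n) E); rewrite fpsD fps_sum big1 => [|i _].
    by rewrite add0r fpsCM order_shift // eqxx mulr1.
  by rewrite fpsCM order_shift 1?ltnW // ltn_eqF ?mulr0.
move: E; rewrite an rmorph0 mul0r addr0 => /IH H j.
by rewrite ltnS leq_eqVlt => /orP[/eqP-> //|/H].
Qed.

Lemma van2_bl c k f F : subst2 f (bl (Some c)) = X ^+ k * F -> van2 k f.
Proof.
move=> E i j ijk; have := congr1 (fun h : fps2 K => h (i + j)%N) E.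
rewrite fpsXn_mul ijk subst2_blS.
move=> /(shift_free (a := fun j' => f (i + j - j')%N j')).
by move=> /(_ j); rewrite addnK; apply; rewrite ltnS leq_addl.
Qed.

Lemma bl_van2 c k f : van2 k f -> forall i, (i < k)%N ->
  subst2 f (bl (Some c)) i = 0.
Proof.
move=> fk i ik; rewrite subst2_blS big1 // => j _; have ji := ltn_ord j.
have -> : f (i - j)%N j = 0 by apply: fk; rewrite subnK // -ltnS.
by rewrite rmorph0 mul0r.
Qed.

Definition mult k f := van2 k f /\ ~ van2 k.+1 f.

Lemma mult_uniq a b f : mult a f -> mult b f -> a = b.
Proof.
move=> [fa fa'] [fb fb']; case: (ltngtP a b) => // ab.
  by case: fa' => i j ij; apply: fb; apply: leq_trans ij ab.
by case: fb' => i j ij; apply: fa; apply: leq_trans ij ab.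
Qed.

(** The exponent of the exceptional curve is the multiplicity at the point blown up. As the
    conclusion does not mention [c], exponents found at different points of E can be identified. *)
Lemma mult_bl c k f F : funit F -> subst2 f (bl (Some c)) = X ^+ k * F -> mult k f.
Proof.
move=> uF E; split; first exact: van2_bl E.
move=> /(@bl_van2 c)/(_ k (ltnSn k)); rewrite E fpsXn_mul ltnn subnn => F0.
by move: uF; rewrite /funit F0 eqxx.
Qed.

Lemma funit_Xn_inj a b (u v : fps2 K) : funit u -> funit v ->
  X ^+ a * u = X ^+ b * v -> a = b.
Proof.
wlog ab : a b u v / (a <= b)%N.
  move=> H uu uv E; case/orP: (leq_total a b) => ab; first exact: H E.
  by apply/esym; apply: H (esym E).
move=> uu uv E; apply/eqP; rewrite eqn_leq ab /= leqNgt; apply/negP => lt.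
have := congr1 (fun h : fps2 K => h a) E; rewrite !fpsXn_mul ltnn subnn lt => u0.
by move: uu; rewrite /funit u0 eqxx.
Qed.

(** Each of the [M] prime factors [X] divides [h] or the cofactor; when none is left, both are
    units. *)
Lemma funit_factor M (h s e : fps2 K) : funit e -> h * s = X ^+ M * e ->
  exists k (e' : fps2 K), funit e' /\ h = X ^+ k * e'.
Proof.
move=> ue; elim: M h s => [|M IH] h s E.
  exists 0%N, h; rewrite mul1r; split=> //.
  have : funit (h * s) by rewrite E mul1r.
  by rewrite /funit fps2M00 mulf_eq0 => /norP[].
have : fdvd X (h * s) by exists (X ^+ M * e); rewrite E exprS -mulrA mulrC.
case/fdvd_prime => [|[h' hE]|[s' sE]]; first by left.
  have [k [e' [ue' h'E]]] : exists k (e' : fps2 K), funit e' /\ h' = X ^+ k * e'.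
    apply: (IH h' s); apply: fpsXI.
    by transitivity (h * s); [rewrite hE; ring|rewrite E exprS mulrA].
  by exists k.+1, e'; split=> //; rewrite hE h'E exprS; ring.
apply: (IH h s'); apply: fpsXI.
by transitivity (h * s); [rewrite sE; ring|rewrite E exprS mulrA].
Qed.

Lemma funit_shift c : c != 0 -> funit (Y + cst c : fps2 K).
Proof. by move=> c0; rewrite /funit !fpsD add0r. Qed.

Lemma orderXn1 k (s : fps K) : fps_order s 1 -> fps_order (s ^+ k) k.
Proof. by move/(@orderXn _ _ _ k); rewrite mul1n. Qed.

Lemma order_Xn_unit k (e : fps2 K) g : zc1 g -> fps_order g.1 1 -> funit e ->
  fps_order (subst1 (X ^+ k * e) g) k.
Proof.
move=> g0 g1 ue; rewrite (subst1M g0) (subst1Xn g0) (subst1_X g0).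
by have := orderM (orderXn1 k g1) (funit_order g0 ue); rewrite addn0.
Qed.

Section Terminal.
Variables (t1 t2 : fps2 K) (n m : nat) (q : seq (option K)) (c : K).
Hypotheses (T : terminal t1 t2 n m q) (n0 : (0 < n)%N) (c0 : c != 0).
Let pc := gblowup (rcons q (Some c)).

Let pcE : pc = comp2 (gblowup q) (bl (Some c)).
Proof. exact: gblowup_rcons. Qed.
Let q0 := zc2_gblowup q.
Let d0 := zc2_bl (Some c).
Let pc0 : zc2 pc. Proof. exact: zc2_gblowup. Qed.

(** At [q] such a curve has order 1 on both axes, so that a monomial X^a Y^b has order a + b on
    it. *)
Lemma terminal_curve g : zc1 g -> fps_order g.1 1 ->
  fps_order (subst1 t1 (comp1 pc g)) n /\ fps_order (subst1 t2 (comp1 pc g)) m.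
Proof.
move=> g0 g1.
have [_ _ [i [j [k [l [e1 [e2 [e [e' [<- <- [u1 u2 _ _] [E1 E2 _]]]]]]]]]]] := T.
have gc0 := zc1_blc (Some c) g0.
have o1 : fps_order (blc (Some c) g).1 1 by [].
have o2 : fps_order (blc (Some c) g).2 1.
  rewrite /blc -[1%N]addn0; apply: orderM => //; apply: order0.
  by rewrite fpsD (proj2 g0) add0r.
have H t a b f : funit f -> subst2 t (gblowup q) = f * (X ^+ a * Y ^+ b) ->
    fps_order (subst1 t (comp1 pc g)) (a + b).
  move=> uf E; have -> : subst1 t (comp1 pc g) =
      subst1 (subst2 t (gblowup q)) (blc (Some c) g).
    transitivity (subst1 (subst2 t pc) g).
      exact/esym/(subst1_comp t pc0 g0).
    rewrite pcE /comp2 -(subst2_comp t q0 d0) -(comp1_bl _ g0).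
    exact: (subst1_comp (subst2 t (gblowup q)) d0 g0).
  rewrite E !(subst1M gc0) !(subst1Xn gc0) (subst1_X gc0) (subst1_Y gc0).
  by apply: (@orderM _ _ _ 0); [apply: funit_order|apply: orderM; apply: orderXn1].
by split; [apply: H E1|apply: H E2].
Qed.

(** The jacobian at [q] has multiplicity n + m - 2 by its monomial form, and the last blow-up
    contributes one more factor [X]. *)
Lemma terminal_jac : exists2 e, funit e & jac pc = X ^+ (n + m).-1 * e.
Proof.
have [_ _ [i [j [k [l [e1 [e2 [e [e' [iE kE [_ _ u u'] [_ _ E]]]]]]]]]]] := T.
have uY := funit_shift c0.
pose f' := subst2 e' (bl (Some c)) * (Y + cst c).
pose f := subst2 e (bl (Some c)) * (Y + cst c) ^+ (j + l).
have uf' : funit f' by rewrite funitM ?funit_subst2.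
have uf : funit f by rewrite funitM ?funitX ?funit_subst2.
have JE : jac pc * f' = X ^+ (n + m).-1 * f.
  apply: fpsXI; rewrite [RHS]mulrA -exprS prednK; last by rewrite addn_gt0 n0.
  have -> : (n + m = i + k + (j + l))%N by lia.
  rewrite pcE (jac_comp q0 d0) jac_bl [exc _]/=.
  have := congr1 (fun f => subst2 f (bl (Some c))) E.
  cbv beta; rewrite !(subst2M d0) !(subst2Xn d0) (subst2_X d0) (subst2_Y d0).
  rewrite [(bl _).1]/= [(bl _).2]/= => E'.
  transitivity (subst2 e' (bl (Some c)) *
    (subst2 (jac (gblowup q)) (bl (Some c)) * (X * (X * (Y + cst c))))).
    by rewrite /f'; ring.
  by rewrite E' /f exprMn [X ^+ (_ + (j + l))]exprD; ring.
have [r [e3 [u3 JE3]]] := funit_factor uf JE.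
have : X ^+ r * (e3 * f') = X ^+ (n + m).-1 * f by rewrite mulrA -JE3.
by move=> /(funit_Xn_inj (funitM u3 uf') uf) <-; exists e3.
Qed.

Section Dicritical.
Variables (w e : fps2 K * fps2 K) (w1 w2 h f' : fps2 K) (i : nat).
Hypotheses (uw2 : funit w2) (wE : gpull2 pc w = (h * w1, h * w2))
  (uf' : funit f') (JE : subst2 (gwedge w e) pc = X ^+ i * f').

Lemma wedge_mult : mult i (subst2 (gwedge w e) (gblowup q)).
Proof.
apply: (@mult_bl c _ _ f' uf'); rewrite -JE pcE /comp2.
exact: (subst2_comp _ q0 d0).
Qed.

(** E-transversality shows that the common factor [h] of the pull-back vanishes on E alone. Its
    exponent exceeds by one the multiplicity [kap] of the form at [q], since the strict transform is
    transversal to E; so it is the same at every non-corner point. *)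
Lemma dicritical_factor : exists kap u, [/\ funit u, h = X ^+ kap.+1 * u,
  mult kap (gpull2 (gblowup q) w).2 & van2 kap (gpull2 (gblowup q) w).1].
Proof.
have [eJ uJ jE] := terminal_jac.
(* [h] divides the pull-back of w /\ e, which is a power of [X] times a unit: the jacobian curve
   misses the point. *)
have hs : h * (w1 * (gpull2 pc e).2 - w2 * (gpull2 pc e).1) =
    X ^+ (i + (n + m).-1) * (f' * eJ).
  rewrite exprD; transitivity (gwedge (gpull2 pc w) (gpull2 pc e)).
    by rewrite wE /gwedge; cbn [fst snd]; ring.
  by rewrite (gwedge_pull2 _ _ pc0) JE jE; ring.
have [k [u [uu hE]]] := funit_factor (funitM uf' uJ) hs.
have := wE; rewrite pcE -(gpull2_comp _ d0 q0).
move: (gpull2 (gblowup q) w) => [A B]; rewrite /gpull2; cbn [fst snd].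
rewrite [(bl _).1]/= [(bl _).2]/= dXM dYM dXD dYD dXC dYC dXX dYX dXY dYY hE.
move=> EP; have EA := congr1 fst EP; have EB := congr1 snd EP.
cbn [fst snd] in EA, EB.
have {}EB : X * subst2 B (bl (Some c)) = X ^+ k * (u * w2).
  by rewrite mulrA -EB; ring.
(* The exponent is positive, because the second component of the pull-back carries a factor [X]
   while [u * w2] is a unit. *)
case: k EA EB hE {EP} => [|k] EA EB hE.
  have : funit (u * w2) by apply: funitM.
  by rewrite -[u * w2]mul1r -[1](expr0 X) -EB /funit fps2M00 mul0r eqxx.
have {}EB : subst2 B (bl (Some c)) = X ^+ k * (u * w2).
  by apply: fpsXI; rewrite EB exprS -mulrA.
exists k, u; split; [exact: uu|reflexivity|exact: mult_bl (funitM uu uw2) EB|].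
apply: (@van2_bl c _ _ (X * u * w1 - (u * w2) * (Y + cst c))).
transitivity (X ^+ k.+1 * u * w1 - subst2 B (bl (Some c)) * (Y + cst c)).
  by rewrite -EA; ring.
by rewrite EB exprS; ring.
Qed.

End Dicritical.

Lemma order_transform g f f' i : zc1 g -> fps_order g.1 1 -> funit f' ->
  subst2 f pc = X ^+ i * f' -> fps_order (subst1 f (comp1 pc g)) i.
Proof.
move=> g0 g1 uf' E; rewrite -(subst1_comp f pc0 g0) E.
exact: order_Xn_unit.
Qed.

Section Curve.
Variables (g : fps K * fps K) (w : fps2 K * fps2 K) (w1 w2 h u : fps2 K) (kap : nat).
Hypotheses (g0 : zc1 g) (g1 : fps_order g.1 1) (uw2 : funit w2) (uu : funit u)
  (wE : gpull2 pc w = (h * w1, h * w2)) (hE : h = X ^+ kap.+1 * u)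
  (inv : gpull1 (comp1 pc g) w = 0).

(** Let a dx + b dy be the pull-back of [e]. Invariance gives w1 x' + w2 y' = 0 along the curve,
    hence h w2 (a x' + b y') = - x' h (w1 b - w2 a), and h (w1 b - w2 a) is the pull-back of the
    coefficient of w /\ e times the jacobian. *)
Lemma invariant_pull1 e : exists E1 E2, [/\ fps_order E1 kap.+1,
  fps_order E2 (n + m).-1 &
  E1 * gpull1 (comp1 pc g) e = E2 * subst1 (gwedge w e) (comp1 pc g)].
Proof.
have [eJ uJ jE] := terminal_jac.
have oh : fps_order (subst1 h g) kap.+1 by rewrite hE; apply: order_Xn_unit.
have ow2 : fps_order (subst1 w2 g) 0 by apply: funit_order.
have og1 : fps_order (fps_deriv g.1) 0.
  by case: g1 => H _; apply: order0; rewrite /= mulr1n; apply/eqP.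
have oJ : fps_order (subst1 (jac pc) g) (n + m).-1.
  by rewrite jE; apply: order_Xn_unit.
exists (subst1 h g * subst1 w2 g), (- (fps_deriv g.1 * subst1 (jac pc) g)).
split; first by rewrite -[kap.+1]addn0; apply: orderM.
  have [oM1 oM2] := orderM og1 oJ; split.
    by rewrite fpsN => /eqP; rewrite oppr_eq0 => /eqP.
  by move=> r rl; rewrite fpsN oM2 ?oppr0.
have E0 : subst1 w1 g * fps_deriv g.1 + subst1 w2 g * fps_deriv g.2 = 0.
  have := inv; rewrite -(gpull1_comp _ g0 pc0) wE /gpull1; cbn [fst snd].
  rewrite !(subst1M g0) -!mulrA -mulrDr => /fps_mul_eq0[h0|//].
  by case: (order_neq0 oh).
have := congr1 (fun f => subst1 f g) (gwedge_pull2 w e pc0).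
cbv beta; rewrite wE -(gpull1_comp _ g0 pc0) (subst1M g0).
rewrite [subst1 (subst2 _ _) g](subst1_comp _ pc0 g0) -/(comp1 pc g).
move: (gpull2 pc e) => [a b]; rewrite /gwedge /gpull1; cbn [fst snd].
rewrite (subst1B g0) !(subst1M g0) => EJ.
move: (subst1 _ (comp1 pc g)) EJ => J EJ.
move: (fps_deriv g.1) (fps_deriv g.2) (subst1 (jac pc) g) (subst1 h g)
  (subst1 a g) (subst1 b g) (subst1 w1 g) (subst1 w2 g) E0 EJ
  => x y jj hh aa bb v1 v2 E0 EJ.
transitivity (hh * bb * (v1 * x + v2 * y) - x * (hh * v1 * bb - hh * v2 * aa)).
  by ring.
by rewrite E0 EJ; ring.
Qed.

Lemma invariant_order e j : fps_order (gpull1 (comp1 pc g) e) j ->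
  exists2 k, fps_order (subst1 (gwedge w e) (comp1 pc g)) k &
    (kap.+1 + j = (n + m).-1 + k)%N.
Proof.
move=> oj; have [E1 [E2 [o1 o2 E]]] := invariant_pull1 e.
exact: order_eqM E o1 o2 oj.
Qed.

Lemma invariant_order_inv e k :
  fps_order (subst1 (gwedge w e) (comp1 pc g)) k ->
  exists2 j, fps_order (gpull1 (comp1 pc g) e) j &
    (kap.+1 + j = (n + m).-1 + k)%N.
Proof.
move=> ok; have [E1 [E2 [o1 o2 E]]] := invariant_pull1 e.
by have [j oj jE] := order_eqM (esym E) o2 o1 ok; exists j.
Qed.

End Curve.
End Terminal.
End NonCorner.

(** * Convergence *)

Section Convergence.
Variable K : numFieldType.
Implicit Types (f g h : fps K) (F G : fps2 K) (M r : K).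

(** The order of [K] forces [M] and [r] to be real; as rates are at least 1, two of them are
    dominated by their product. *)
Definition conv1 f := exists M r, [/\ 0 <= M, 1 <= r &
  forall k, `|f k| <= M * r ^+ k].
Definition conv2 F := exists M r, [/\ 0 <= M, 1 <= r &
  forall i j, `|F i j| <= M * r ^+ (i + j)].

Lemma bound_mono M r r' k : 0 <= M -> 1 <= r -> 1 <= r' ->
  M * r ^+ k <= M * (r * r') ^+ k.
Proof.
move=> M0 r1 r'1; rewrite ler_wpM2l // lerXn2r ?nnegrE ?mulr_ge0 //;
  try exact: le_trans ler01 _.
by rewrite ler_peMr // (le_trans ler01).
Qed.

Lemma conv1D f g : conv1 f -> conv1 g -> conv1 (f + g).
Proof.
move=> [M [r [M0 r1 H]]] [M' [r' [M'0 r'1 H']]].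
exists (M + M'), (r * r'); split; rewrite ?addr_ge0 ?mulr_ege1 // => k.
rewrite fpsD (le_trans (ler_normD _ _)) // mulrDl lerD //.
  by rewrite (le_trans (H k)) // bound_mono.
by rewrite (le_trans (H' k)) // mulrC mulrC [r * r']mulrC bound_mono.
Qed.

Lemma conv2D F G : conv2 F -> conv2 G -> conv2 (F + G).
Proof.
move=> [M [r [M0 r1 H]]] [M' [r' [M'0 r'1 H']]].
exists (M + M'), (r * r'); split; rewrite ?addr_ge0 ?mulr_ege1 // => i j.
rewrite !fpsD (le_trans (ler_normD _ _)) // mulrDl lerD //.
  by rewrite (le_trans (H i j)) // bound_mono.
by rewrite (le_trans (H' i j)) // [r * r']mulrC bound_mono.
Qed.

Lemma conv2N F : conv2 F -> conv2 (- F).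
Proof.
move=> [M [r [M0 r1 H]]]; exists M, r; split=> // i j.
by rewrite !fpsN normrN.
Qed.

(** The number of terms in a product of series is absorbed by doubling the rate. *)
Lemma double_bound M r n k : 0 <= M -> 0 <= r -> (n <= 2 ^ k)%N ->
  M * r ^+ k *+ n <= M * (2 * r) ^+ k.
Proof.
move=> M0 r0 nk; rewrite exprMn [2 ^+ k * _]mulrC mulrA -[leLHS]mulr_natr.
by rewrite ler_wpM2l ?mulr_ge0 ?exprn_ge0 // -natrX ler_nat.
Qed.

Lemma expr_split_le r r' i k : (i <= k)%N -> 1 <= r -> 1 <= r' ->
  r ^+ i * r' ^+ (k - i) <= (r * r') ^+ k.
Proof.
move=> ik r1 r'1; rewrite exprMn ler_pM ?exprn_ge0 ?(le_trans ler01) //.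
  by rewrite ler_weXn2l.
by rewrite ler_weXn2l // leq_subr.
Qed.

Lemma conv1M f g : conv1 f -> conv1 g -> conv1 (f * g).
Proof.
move=> [M [r [M0 r1 H]]] [M' [r' [M'0 r'1 H']]].
exists (M * M'), (2 * (r * r')); split; rewrite ?mulr_ge0 ?mulr_ege1 ?ler1n // => k.
rewrite fpsM (le_trans (ler_norm_sum _ _ _)) //.
apply: (@le_trans _ _ (\sum_(i < k.+1) M * M' * (r * r') ^+ k)).
  apply: ler_sum => i _; rewrite normrM.
  apply: le_trans (ler_pM _ _ (H i) (H' _)) _ => //.
  rewrite mulrACA ler_wpM2l ?mulr_ge0 // expr_split_le // -ltnS //.
rewrite sumr_const card_ord; apply: double_bound; first exact: mulr_ge0.
  by apply: mulr_ge0; apply: le_trans ler01 _.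
exact: ltn_expl.
Qed.

Lemma conv2M F G : conv2 F -> conv2 G -> conv2 (F * G).
Proof.
move=> [M [r [M0 r1 H]]] [M' [r' [M'0 r'1 H']]].
exists (M * M'), (2 * (r * r')); split; rewrite ?mulr_ge0 ?mulr_ege1 ?ler1n // => a b.
rewrite fps2M (le_trans (ler_norm_sum _ _ _)) //.
apply: (@le_trans _ _ (\sum_(i < a.+1) \sum_(j < b.+1) M * M' * (r * r') ^+ (a + b))).
  apply: ler_sum => i _; rewrite (le_trans (ler_norm_sum _ _ _)) //.
  apply: ler_sum => j _; rewrite normrM.
  apply: le_trans (ler_pM _ _ (H i j) (H' _ _)) _ => //.
  have ia : (i <= a)%N by rewrite -ltnS.
  have jb : (j <= b)%N by rewrite -ltnS.
  rewrite mulrACA ler_wpM2l ?mulr_ge0 //.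
  have -> : (a - i + (b - j) = a + b - (i + j))%N by lia.
  by rewrite expr_split_le // leq_add.
under eq_bigr => i _ do rewrite sumr_const card_ord.
rewrite sumr_const card_ord -mulrnA; apply: double_bound; first exact: mulr_ge0.
  by apply: mulr_ge0; apply: le_trans ler01 _.
by rewrite expnD mulnC; apply: leq_mul; apply: ltn_expl.
Qed.

Lemma conv1_fpsC c : conv1 (fpsC c).
Proof.
exists `|c|, 1; split=> // k; rewrite expr1n mulr1 /=.
by case: eqP; rewrite ?normr0.
Qed.

Lemma conv2_lift f : conv1 f -> conv2 (FPS (fun i => fpsC (f i))).
Proof.
move=> [M [r [M0 r1 H]]]; exists M, r; split=> // i [|j] /=.
  by rewrite addn0.
by rewrite normr0 mulr_ge0 // exprn_ge0 // (le_trans ler01).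
Qed.

Lemma conv2_fpsC f : conv1 f -> conv2 (fpsC f).
Proof.
move=> [M [r [M0 r1 H]]]; exists M, r; split=> // -[|i] j //=.
by rewrite normr0 mulr_ge0 // exprn_ge0 // (le_trans ler01).
Qed.

Lemma conv1_X : conv1 (fpsX K).
Proof.
exists 1, 1; split=> // k; rewrite expr1n mulr1 /=.
by case: eqP; rewrite ?normr0 ?normr1.
Qed.

Lemma conv2_Y : conv2 Y. Proof. exact: conv2_fpsC conv1_X. Qed.
Lemma conv2_cst c : conv2 (cst c). Proof. exact: conv2_fpsC (conv1_fpsC c). Qed.
Lemma conv2_X : conv2 X.
Proof.
have := conv2_lift conv1_X; congr conv2; apply: fpsP => i /=.
by apply: fpsP => j /=; case: (i == 1)%N; case: j.
Qed.
Lemma conv2_1 : conv2 1. Proof. exact: conv2_cst. Qed.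
Lemma conv2Xn F k : conv2 F -> conv2 (F ^+ k).
Proof.
move=> F0; elim: k => [|k IH]; first exact: conv2_1.
by rewrite exprS; apply: conv2M.
Qed.

Lemma conv2_divX F : conv2 (X * F) -> conv2 F.
Proof.
move=> [M [r [M0 r1 H]]]; exists (M * r), r.
split=> //; first by rewrite mulr_ge0 // (le_trans ler01).
by move=> i j; have := H i.+1 j; rewrite fpsXMS addSn exprS mulrA.
Qed.
Lemma conv2_divY F : conv2 (Y * F) -> conv2 F.
Proof.
move=> [M [r [M0 r1 H]]]; exists (M * r), r.
split=> //; first by rewrite mulr_ge0 // (le_trans ler01).
by move=> i j; have := H i j.+1; rewrite fpsYM fpsXMS addnS exprS mulrA.
Qed.

Lemma conv1_divX f : conv1 (fpsX K * f) -> conv1 f.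
Proof.
move=> [M [r [M0 r1 H]]]; exists (M * r), r.
split=> //; first by rewrite mulr_ge0 // (le_trans ler01).
by move=> i; have := H i.+1; rewrite fpsXMS exprS mulrA.
Qed.

Lemma conv1_deriv f : conv1 f -> conv1 (fps_deriv f).
Proof.
move=> [M [r [M0 r1 H]]]; exists (M * r), (2 * r).
have r0 : 0 <= r by rewrite (le_trans ler01).
split; rewrite ?mulr_ge0 ?mulr_ege1 ?ler1n // => k.
rewrite /= normrMn.
apply: le_trans (double_bound (mulr_ge0 M0 r0) r0 (ltn_expl k (ltnSn 1))).
by rewrite lerMn2r -mulrA -exprS H orbT.
Qed.

(** Strong recursion, used to solve triangular systems for the coefficients of a series; the values
    not yet known are replaced by 0. *)
Lemma course_of_values (P : nat -> (nat -> K) -> K) : exists phi : nat -> K,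
  forall k, phi k = P k (fun i => if (i < k)%N then phi i else 0).
Proof.
pose s := fix s N := if N is N'.+1 then rcons (s N') (P N' (nth 0 (s N'))) else [::].
have sz N : size (s N) = N by elim: N => //= N IH; rewrite size_rcons IH.
pose phi k := nth 0 (s k.+1) k.
have nthE N i : (i < N)%N -> nth 0 (s N) i = phi i.
  elim: N => // N IH; rewrite ltnS leq_eqVlt => /orP[/eqP-> //|iN].
  by rewrite [s _]/= nth_rcons sz iN IH.
exists phi => k; rewrite {1}/phi [s _]/= nth_rcons sz ltnn eqxx.
congr (P k _); apply/funext => i; case: ltnP => [|ki]; first exact: nthE.
by rewrite nth_default // sz.
Qed.

Lemma conv1_inv g : conv1 g -> g 0%N != 0 -> exists2 e, conv1 e & e * g = 1.
Proof.
move=> [M [r [M0 r1 H]]] g0.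
have [phi phiE] := course_of_values (fun k p =>
  (g 0%N)^-1 * ((k == 0%N)%:R - \sum_(i < k) p i * g (k - i)%N)).
have E k : phi k = (g 0%N)^-1 * ((k == 0%N)%:R - \sum_(i < k) phi i * g (k - i)%N).
  rewrite [LHS]phiE; congr (_ * (_ - _)).
  by apply: eq_bigr => i _; rewrite ltn_ord.
exists (FPS phi); last first.
  apply: fpsP => k; rewrite fps1 fpsM big_ord_recr subnn /=.
  by rewrite [phi k]E mulrAC mulVf // mul1r addrC subrK.
have r0 : 0 <= r by rewrite (le_trans ler01).
(* [rho] satisfies rho^(k+1) = r rho^k + N r rho^k, the recursion that bounds the sums in
   [sum_le]. *)
pose N := `|(g 0%N)^-1| * M; pose rho := r * (1 + N).
have N0 : 0 <= N by rewrite mulr_ge0.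
have N1 : 1 <= 1 + N by rewrite lerDl.
have sum_le k : N * (\sum_(i < k) rho ^+ i * r ^+ (k - i)) <= rho ^+ k.
  elim: k => [|k IH]; first by rewrite big_ord0 mulr0.
  rewrite big_ord_recr /= subSnn.
  have -> : \sum_(i < k) rho ^+ i * r ^+ (k.+1 - i) =
      r * \sum_(i < k) rho ^+ i * r ^+ (k - i).
    rewrite mulr_sumr; apply: eq_bigr => i _.
    by rewrite subSn ?exprS 1?ltnW // mulrCA.
  set S := \sum_(i < k) _ in IH *.
  have -> : N * (r * S + rho ^+ k * r ^+ 1) = r * (N * S) + N * r * rho ^+ k by ring.
  have -> : rho ^+ k.+1 = r * rho ^+ k + N * r * rho ^+ k.
    by rewrite exprS {1}/rho; ring.
  by rewrite lerD2r ler_wpM2l.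
exists `|(g 0%N)^-1|, rho; split; rewrite ?mulr_ege1 // => k /=.
elim/ltn_ind: k => k IH; rewrite E normrM ler_wpM2l //.
case: k IH => [|k] IH; first by rewrite big_ord0 subr0 normr1.
rewrite sub0r normrN (le_trans _ (sum_le k.+1)) //.
rewrite (le_trans (ler_norm_sum _ _ _)) // mulr_sumr; apply: ler_sum => i _.
rewrite normrM; apply: le_trans (ler_pM _ _ (IH i (ltn_ord i)) (H _)) _ => //.
by rewrite mulrACA.
Qed.

(** The rate in [k] does not depend on the exponent [n]. In the Lagrange formula the exponent grows
    with the degree, so repeated use of [conv1M] would not do. *)
Lemma conv1_pow f M r : 0 <= M -> 0 <= r -> (forall k, `|f k| <= M * r ^+ k) ->
  forall n k, `|(f ^+ n) k| <= (2 * M) ^+ n * (2 * r) ^+ k.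
Proof.
move=> M0 r0 H; have M20 : 0 <= 2 * M by rewrite mulr_ge0.
have r20 : 0 <= 2 * r by rewrite mulr_ge0.
elim=> [|n IH] k.
  rewrite mul1r fps1; case: eqP => [->|_]; first by rewrite normr1.
  by rewrite normr0 exprn_ge0.
rewrite exprS fpsM (le_trans (ler_norm_sum _ _ _)) //.
apply: (@le_trans _ _ (\sum_(i < k.+1)
   M * (2 * M) ^+ n * r ^+ k * (2 ^+ (k - i)))).
  apply: ler_sum => i _; rewrite normrM.
  apply: le_trans (ler_pM _ _ (H i) (IH _)) _ => //.
  rewrite mulrACA -!mulrA ler_wpM2l // ler_wpM2l ?exprn_ge0 // exprMn.
  have ik : (i <= k)%N by rewrite -ltnS.
  by rewrite [2 ^+ _ * _]mulrC mulrA -exprD subnKC.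
rewrite -mulr_sumr.
have sum2 : \sum_(i < k.+1) 2 ^+ (k - i) <= 2 * 2 ^+ k :> K.
  rewrite -exprS; elim: (k) => [|l IHl].
    by rewrite big_ord_recl big_ord0 addr0 ler_weXn2l ?ler1n.
  by rewrite big_ord_recl subn0 [leRHS]exprS mulr_natl mulr2n lerD.
apply: le_trans (ler_wpM2l _ sum2) _; first by rewrite !mulr_ge0 ?exprn_ge0.
by rewrite [(2 * M) ^+ n.+1]exprS [(2 * r) ^+ k]exprMn le_eqVlt; apply/orP; left;
  apply/eqP; ring.
Qed.

(** * Lagrange inversion and convergence of the equation of a smooth branch *)

Lemma fps_derivXn f n : fps_deriv (f ^+ n.+1) = fps_deriv f * f ^+ n *+ n.+1.
Proof.
elim: n => [|n IH]; first by rewrite expr1 mulr1.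
rewrite exprS fps_derivM IH [f ^+ n.+1]exprS [RHS]mulrS; congr (_ + _).
by rewrite mulrnAr mulrCA.
Qed.

(* Lagrange inversion: the residue of [E ^ (j + 1) * dg], where [E = t / g]. *)
Lemma lagrange_residue (E g : fps K) j : g 0%N = 0 -> E * g = fpsX K ->
  (E ^+ j.+1 * fps_deriv g) j = (j == 0%N)%:R.
Proof.
move=> g0 Eg; have dEg : E * fps_deriv g = 1 - fps_deriv E * g.
  by rewrite -(fps_derivX K) -Eg fps_derivM; ring.
case: j => [|j].
  by rewrite expr1 dEg fpsB fps1 fpsM0 g0 mulr0 subr0.
have -> : E ^+ j.+2 * fps_deriv g = E ^+ j.+1 - fpsX K * (fps_deriv E * E ^+ j).
  rewrite -Eg; transitivity (E ^+ j.+1 * (E * fps_deriv g)).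
    by rewrite exprS; ring.
  by rewrite dEg exprS; ring.
have := congr1 (fun f : fps K => f j) (fps_derivXn E j).
rewrite fps_mulrn /= => /eqP; rewrite -subr_eq0 -mulrnBl mulrn_eq0 /= => /eqP H.
by rewrite fpsB fpsXMS H.
Qed.

(** Makes composition of series in one variable a case of [subst1]. *)
Definition series_in_X f : fps2 K := FPS (fun i => fpsC (f i)).

Lemma subst1_lift f g s k : (subst1 (series_in_X f) (g, s)) k =
  \sum_(i < k.+1) f i * (g ^+ i) k.
Proof.
rewrite subst1_coef; cbn [fst snd]; apply: eq_bigr => i _.
rewrite big_ord_recl big1 ?addr0 => [|j _]; last by rewrite /= mul0r.
by rewrite mulr1.
Qed.

(** The system for the coefficients is triangular with diagonal entries [(g ^+ k) k], nonzero
    because [g] has order 1. Thus a branch (g, h) is the graph of a series. *)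
Lemma comp_inverse g h : fps_order g 1 ->
  exists phi, forall s, h = subst1 (series_in_X phi) (g, s).
Proof.
move=> g1; have gk i : fps_order (g ^+ i) i by have := orderXn i g1; rewrite mul1n.
have [phi phiE] := course_of_values (fun k p =>
  (h k - \sum_(i < k) p i * (g ^+ i) k) / (g ^+ k) k).
exists (FPS phi) => s; apply: fpsP => k; rewrite subst1_lift big_ord_recr /=.
have gkk : (g ^+ k) k != 0 by case: (gk k) => /eqP.
rewrite [phi k]phiE divfK //.
have -> : \sum_(i < k) (if (i < k)%N then phi i else 0) * (g ^+ i) k =
    \sum_(i < k) phi i * (g ^+ i) k by apply: eq_bigr => i _; rewrite ltn_ord.
by rewrite addrC subrK.
Qed.

(** Here h' = phi'(g) g' and g^i E^(k+1) = t^i E^(k+1-i), so that [lagrange_residue] retains only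
    the term i = k of phi'. *)
Lemma lagrange_inversion g h phi (E : fps K) k : fps_order g 1 -> E * g = fpsX K ->
  h = subst1 (series_in_X phi) (g, 0) ->
  (fps_deriv h * E ^+ k.+1) k = phi k.+1 *+ k.+1.
Proof.
move=> g1 Eg hE; have g0 : g 0%N = 0 by case: g1 => _ ->.
have gk i : fps_order (g ^+ i) i by have := orderXn i g1; rewrite mul1n.
have gz : zc1 (g, 0 : fps K) by [].
have -> : fps_deriv h = subst1 (series_in_X (fps_deriv phi)) (g, 0) * fps_deriv g.
  rewrite hE subst1_chain //; cbn [fst snd].
  have -> : fps_deriv (0 : fps K) = 0 by apply: fpsP => i; rewrite /= mul0rn.
  rewrite mulr0 addr0; congr (subst1 _ _ * _); apply: fpsP => i.
  by rewrite /= -rmorphMn.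
rewrite -[RHS]/(fps_deriv phi k); move: (fps_deriv phi) => psi.
pose S := \sum_(i < k.+1) fpsC (psi i) * g ^+ i.
have dV : van1 k.+1 (subst1 (series_in_X psi) (g, 0) - S).
  move=> l lk; rewrite fpsB subst1_lift /S fps_sum.
  rewrite (big_ord_widen k.+1 (fun i => psi i * (g ^+ i) l)) // big_mkcond.
  apply/eqP; rewrite subr_eq0; apply/eqP; apply: eq_bigr => i _; rewrite fpsCM.
  by case: ltnP => // li; case: (gk i) => _ ->; rewrite ?mulr0.
have term i : (i <= k)%N -> (fpsC (psi i) * g ^+ i * (fps_deriv g * E ^+ k.+1)) k =
    psi i * (k - i == 0)%N%:R.
  move=> ik; have -> : E ^+ k.+1 = E ^+ i * E ^+ (k - i).+1.
    by rewrite -exprD; congr (_ ^+ _); lia.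
  rewrite -mulrA fpsCM; congr (_ * _).
  transitivity ((fpsX K ^+ i * (E ^+ (k - i).+1 * fps_deriv g)) k).
    by rewrite -Eg exprMn; congr (fps_coef _ k); ring.
  by rewrite fpsXn_mul ltnNge ik /= lagrange_residue.
rewrite -mulrA -[subst1 _ _](subrK S) mulrDl fpsD (van_mul1 _ dV) // add0r.
rewrite /S mulr_suml fps_sum big_ord_recr big1 /= => [|i _].
  by rewrite add0r term // subnn mulr1.
by rewrite term 1?ltnW // subn_eq0 leqNgt ltn_ord mulr0.
Qed.

Lemma conv1_comp_inverse g h phi : conv1 g -> conv1 h -> fps_order g 1 ->
  h = subst1 (series_in_X phi) (g, 0) -> conv1 phi.
Proof.
move=> cg ch g1 hE.
pose g' := FPS (fun k => g k.+1).
have gE : g = fpsX K * g'.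
  apply: fpsP => -[|k]; last by rewrite fpsXMS.
  by rewrite fpsXM0; case: g1 => _ ->.
have [E [ME [r [ME0 r1 HE]]] E1] : exists2 E, conv1 E & E * g' = 1.
  by apply: conv1_inv; [apply: conv1_divX; rewrite -gE|apply/eqP; case: g1].
have Eg : E * g = fpsX K by rewrite gE mulrCA E1 mulr1.
have [M [r' [M0 r'1 H]]] := conv1_deriv ch.
have r0 : 0 <= r by rewrite (le_trans ler01).
have r'0 : 0 <= r' by rewrite (le_trans ler01).
pose N := 1 + ME; have N0 : 0 <= N by rewrite addr_ge0.
have N1 : 1 <= N by rewrite lerDl.
have HN k : `|E k| <= N * r ^+ k.
  by rewrite (le_trans (HE k)) // ler_wpM2r ?exprn_ge0 // lerDr.
have two1 : 1 <= 2 :> K by rewrite ler1n.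
(* The terms of the Lagrange formula are at most M r'^i (2 N)^(k+1) (2 r)^(k-i); the outer factor 2
   of [rho] pays for their number k + 1. *)
pose A := M * (2 * N); pose rho := 2 * (2 * N * (r' * (2 * r))).
have A0 : 0 <= A by rewrite !mulr_ge0.
have rho1 : 1 <= rho by rewrite !mulr_ege1.
exists (`|phi 0%N| + A), rho; split; rewrite ?addr_ge0 // => -[|k].
  by rewrite mulr1 lerDl.
apply: (@le_trans _ _ (A * rho ^+ k)); last first.
  apply: (@le_trans _ _ (A * rho ^+ k.+1)).
    by rewrite ler_wpM2l // ler_weXn2l.
  by rewrite ler_wpM2r ?lerDr // exprn_ge0 // (le_trans ler01).
apply: (@le_trans _ _ `|phi k.+1 *+ k.+1|).
  by rewrite normrMn mulrS lerDl mulrn_wge0.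
rewrite -(lagrange_inversion _ g1 Eg hE) fpsM.
apply: le_trans (ler_norm_sum _ _ _) _.
apply: le_trans (double_bound A0 _ (ltn_expl k (ltnSn 1))); last first.
  by rewrite !mulr_ge0.
rewrite -[k.+1 in leRHS]card_ord -sumr_const; apply: ler_sum => i _.
have ik : (i <= k)%N by rewrite -ltnS.
rewrite normrM.
apply: le_trans (ler_pM _ _ (H i) (conv1_pow N0 r0 HN k.+1 (k - i))) _ => //.
have N20 : 0 <= 2 * N by rewrite mulr_ge0.
rewrite /A; move: (2 * N) N20 => N2 N20.
rewrite [leLHS]mulrACA [N2 ^+ _]exprS [(N2 * _) ^+ k]exprMn.
rewrite [leRHS](_ : _ = M * (N2 * N2 ^+ k) * (r' * (2 * r)) ^+ k); last by ring.
by rewrite ler_wpM2l ?mulr_ge0 ?exprn_ge0 // expr_split_le ?mulr_ege1.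
Qed.

End Convergence.

(** * Adapted coordinates and the resolution of a cusp *)

Lemma fps_comp_lift (K : numFieldType) (f s : fps K) :
  fps_comp f s = subst1 (series_in_X f) (s, 0).
Proof. by apply: fpsP => k; rewrite subst1_lift. Qed.
Opaque fps_comp.

Section Puiseux.
Variable K : numFieldType.
Implicit Types (f s : fps K) (g : fps K * fps K).

Lemma liftD f s : series_in_X (f + s) = series_in_X f + series_in_X s.
Proof. by apply: fpsP => i; rewrite fpsD /= rmorphD. Qed.
Lemma liftM f s : series_in_X (f * s) = series_in_X f * series_in_X s.
Proof.
apply: fpsP => i; rewrite fpsM [series_in_X _ _]/= fpsM rmorph_sum.
by apply: eq_bigr => j _; rewrite rmorphM.
Qed.
Lemma liftC c : series_in_X (fpsC c) = cst c :> fps2 K.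
Proof. by apply: fpsP => i /=; case: (i == 0%N); rewrite ?rmorph0. Qed.

Section Comp.
Variables (s : fps K).
Hypothesis s1 : fps_order s 1.
Let sz : zc1 (s, 0). Proof. by split=> //; case: s1 => _ ->. Qed.

Lemma fps_compD f f' : fps_comp (f + f') s = fps_comp f s + fps_comp f' s.
Proof. by rewrite !fps_comp_lift liftD subst1D. Qed.
Lemma fps_compM f f' : fps_comp (f * f') s = fps_comp f s * fps_comp f' s.
Proof. by rewrite !fps_comp_lift liftM subst1M. Qed.
Lemma fps_compC c : fps_comp (fpsC c) s = fpsC c.
Proof. by rewrite !fps_comp_lift liftC subst1C. Qed.
Lemma fps_compXn f i : fps_comp (f ^+ i) s = fps_comp f s ^+ i.
Proof.
elim: i => [|i IH]; first exact: (fps_compC 1).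
by rewrite !exprS fps_compM IH.
Qed.
Lemma fps_comp_sum N (F : nat -> fps K) :
  fps_comp (\sum_(i < N) F i) s = \sum_(i < N) fps_comp (F i) s.
Proof.
elim: N => [|N IH]; last by rewrite !big_ord_recr fps_compD IH.
by rewrite !big_ord0 -(rmorph0 (@fpsC K)) fps_compC.
Qed.

Lemma fps_comp_order f k : fps_order (fps_comp f s) k -> fps_order f k.
Proof.
have sk i : fps_order (s ^+ i) i by have := orderXn i s1; rewrite mul1n.
have E l : van1 l f -> fps_comp f s l = f l * (s ^+ l) l.
  move=> f0; rewrite fps_comp_lift subst1_lift big_ord_recr big1 /= ?add0r // => i _.
  by rewrite f0 ?mul0r.
move=> [fk f0].
have fv l : (l <= k)%N -> van1 l f.
  elim: l => [_ []//|l IH lk i]; rewrite ltnS leq_eqVlt => /orP[/eqP->|]; last first.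
    by apply: IH; apply: ltnW.
  have := f0 l lk; rewrite E; last by apply: IH; apply: ltnW.
  by move/eqP; rewrite mulf_eq0 => /orP[/eqP//|/eqP sl]; case: (sk l) => /(_ sl).
split; last exact: fv.
by move=> fk0; apply: fk; rewrite E ?fk0 ?mul0r //; apply: fv.
Qed.
End Comp.

Definition poly_in (N : nat) (b : nat -> K) (z : fps2 K) : fps2 K :=
  \sum_(i < N) cst (b i) * z ^+ i.

Lemma poly_in_subst2 N b z p : zc2 p ->
  subst2 (poly_in N b z) p = poly_in N b (subst2 z p).
Proof.
move=> p0; rewrite /poly_in.
rewrite (big_morph (fun f : fps2 K => subst2 f p) (subst2D p0) (subst2_0 p0)).
by apply: eq_bigr => i _; rewrite (subst2M p0) (subst2C p0) (subst2Xn p0).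
Qed.

Lemma poly_in_subst1 N b z g : zc1 g ->
  subst1 (poly_in N b z) g = \sum_(i < N) fpsC (b i) * (subst1 z g) ^+ i.
Proof.
move=> g0; rewrite /poly_in.
rewrite (big_morph (fun f : fps2 K => subst1 f g) (subst1D g0) (subst1_0 g0)).
by apply: eq_bigr => i _; rewrite (subst1M g0) (subst1C g0) (subst1Xn g0).
Qed.

Lemma conv2_poly_in N b z : conv2 z -> conv2 (poly_in N b z).
Proof.
move=> z0; rewrite /poly_in; apply: (big_ind (@conv2 K)) => [||i _].
- by rewrite -(rmorph0 (cstm K)); apply: conv2_cst.
- exact: conv2D.
- by apply: conv2M; [apply: conv2_cst|apply: conv2Xn].
Qed.

Lemma poly_in_X N b i j : (poly_in N b X) i j =
  if (i < N)%N && (j == 0)%N then b i else 0.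
Proof.
rewrite /poly_in !fps_sum.
have term (k : nat) : (cst (b k) * X ^+ k) i j =
    if (i == k) && (j == 0)%N then b k else 0.
  rewrite cst2M -[X ^+ k]mulr1 -(expr0 Y) fps2XY.
  by case: (_ && _); rewrite ?mulr1 ?mulr0.
under eq_bigr => k _ do rewrite term.
have [iN|Ni] := ltnP i N; last first.
  by rewrite big1 // => k _; rewrite ifN // gtn_eqF // (leq_trans (ltn_ord k)).
rewrite (bigD1 (Ordinal iN)) //= eqxx big1 ?addr0 // => k.
by rewrite -val_eqE /= eq_sym => /negPf ->.
Qed.

Lemma poly_in_Y N b i j : (poly_in N b Y) i j =
  if (j < N)%N && (i == 0)%N then b j else 0.
Proof.
rewrite /poly_in !fps_sum.
have term (k : nat) : (cst (b k) * Y ^+ k) i j =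
    if (j == k) && (i == 0)%N then b k else 0.
  rewrite cst2M -[Y ^+ k]mul1r -(expr0 X) fps2XY andbC.
  by case: (_ && _); rewrite ?mulr1 ?mulr0.
under eq_bigr => k _ do rewrite term.
have [iN|Ni] := ltnP j N; last first.
  by rewrite big1 // => k _; rewrite ifN // gtn_eqF // (leq_trans (ltn_ord k)).
rewrite (bigD1 (Ordinal iN)) //= eqxx big1 ?addr0 // => k.
by rewrite -val_eqE /= eq_sym => /negPf ->.
Qed.

(** The exponents of [y] below [m] are multiples of [n], and x = t^n: these terms form a polynomial
    in [x], and subtracting it leaves the order [m]. *)
Lemma puiseux_orders (n m : nat) (x y s : fps K) : (1 < n)%N -> (n < m)%N ->
  coprime n m -> fps_order s 1 -> y 0%N = 0 -> fps_comp x s = fpsX K ^+ n ->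
  fps_comp y s m <> 0 ->
  (forall i, (i < m)%N -> ~~ (n %| i)%N -> fps_comp y s i = 0) ->
  exists b, b 0%N = 0 /\ fps_order x n /\
    fps_order (y - \sum_(i < m) fpsC (b i) * x ^+ i) m.
Proof.
move=> n1 nm cop s1 y0 xE ym yi; have n0 : (0 < n)%N by apply: ltnW.
pose a := fps_comp y s.
pose b i := if (n * i < m)%N then a (n * i)%N else 0.
exists b; split.
  by rewrite /b muln0 (leq_trans _ nm) // /a fps_comp_lift subst1_0E.
split.
  apply: (fps_comp_order s1); rewrite xE -{2}[n]mul1n.
  exact: orderXn (order_fpsX K).
have ndvd : ~~ (n %| m)%N.
  by apply/negP => /gcdn_idPl; rewrite (eqP cop) => n1E; rewrite -n1E in n1.
apply: (fps_comp_order s1).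
have E l : fps_comp (y - \sum_(i < m) fpsC (b i) * x ^+ i) s l =
    a l - \sum_(i < m) b i * (l == n * i)%N%:R.
  have -> : y - \sum_(i < m) fpsC (b i) * x ^+ i =
      y + fpsC (-1) * \sum_(i < m) fpsC (b i) * x ^+ i.
    by rewrite rmorphN rmorph1 mulN1r.
  rewrite (fps_compD s1) (fps_compM s1) (fps_compC s1) fpsD fpsCM mulN1r.
  congr (_ - _).
  rewrite (fps_comp_sum s1 m (fun i => fpsC (b i) * x ^+ i)) fps_sum;
  apply: eq_bigr => i _.
  by rewrite (fps_compM s1) (fps_compC s1) (fps_compXn s1) xE fpsCM -exprM fpsXn.
have nod l : ~~ (n %| l)%N -> \sum_(i < m) b i * (l == n * i)%N%:R = 0.
  move=> nl; rewrite big1 // => i _; case: eqP => [lE|_]; last by rewrite mulr0.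
  by rewrite lE dvdn_mulr in nl.
split; first by rewrite E nod // subr0.
move=> l lm; rewrite E; have [nl|nl] := boolP (n %| l)%N; last first.
  by rewrite nod // subr0; apply: yi.
have [i lE] : exists i, l = (n * i)%N by exists (l %/ n)%N; rewrite mulnC divnK.
have im : (i < m)%N by rewrite lE in lm; nia.
rewrite (bigD1 (Ordinal im)) //= big1 ?addr0 => [|k].
  by rewrite lE eqxx mulr1 /b -lE lm subrr.
rewrite -val_eqE /= lE eqn_pmul2l // eq_sym => /negPf ->.
by rewrite mulr0.
Qed.

(* [s] is the inverse change of coordinates of [t]. *)
Record adapted (n m : nat) g (t s : fps2 K * fps2 K) : Prop := Adapted {
  adapted_t0 : zc2 t;
  adapted_s0 : zc2 s;
  adapted_st : comp2 s t = (X, Y);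
  adapted_det : det2 t.1 t.2 != 0;
  adapted_conv : conv2 t.1 /\ conv2 t.2;
  adapted_n : fps_order (subst1 t.1 g) n;
  adapted_m : fps_order (subst1 t.2 g) m }.

Lemma puiseux_adapted n m g s : (1 < n)%N -> (n < m)%N ->
  coprime n m -> fps_order s 1 -> zc1 g -> fps_comp g.1 s = fpsX K ^+ n ->
  fps_comp g.2 s m <> 0 ->
  (forall i, (i < m)%N -> ~~ (n %| i)%N -> fps_comp g.2 s i = 0) ->
  exists t t', adapted n m g t t'.
Proof.
move=> n1 nm cop s1 g0 xE ym yi; have [g1 g2] := g0.
have [b [b0 [on om]]] := puiseux_orders n1 nm cop s1 g2 xE ym yi.
have P00 : poly_in m b X 0%N 0%N = 0 by rewrite poly_in_X b0; case: ifP.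
have P01 : poly_in m b X 0%N 1%N = 0 by rewrite poly_in_X andbF.
have t0 : zc2 (X, Y - poly_in m b X).
  by split=> //; rewrite [LHS]fpsB P00 subr0.
have s0 : zc2 (X, Y + poly_in m b X) by split=> //; rewrite [LHS]fpsD P00 addr0.
exists (X, Y - poly_in m b X), (X, Y + poly_in m b X); split=> //; cbn [fst snd].
- rewrite /comp2; cbn [fst snd].
  rewrite (subst2D t0) (subst2_X t0) (subst2_Y t0) (poly_in_subst2 _ _ _ t0).
  by rewrite (subst2_X t0) subrK.
- by rewrite /det2 !fpsB P01 /= subr0 mulr1 mul0r subr0 oner_eq0.
- split; first exact: conv2_X.
  by apply: conv2D; [exact: conv2_Y|apply: conv2N; apply: conv2_poly_in; exact: conv2_X].
- by rewrite (subst1_X g0).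
- by rewrite (subst1B g0) (subst1_Y g0) (poly_in_subst1 _ _ _ g0) (subst1_X g0).
Qed.

Lemma puiseux_adapted_swap n m g s : (1 < n)%N -> (n < m)%N ->
  coprime n m -> fps_order s 1 -> zc1 g -> fps_comp g.2 s = fpsX K ^+ n ->
  fps_comp g.1 s m <> 0 ->
  (forall i, (i < m)%N -> ~~ (n %| i)%N -> fps_comp g.1 s i = 0) ->
  exists t t', adapted n m g t t'.
Proof.
move=> n1 nm cop s1 g0 xE ym yi; have [g1 g2] := g0.
have [b [b0 [on om]]] := puiseux_orders n1 nm cop s1 g1 xE ym yi.
have P00 : poly_in m b Y 0%N 0%N = 0 by rewrite poly_in_Y b0; case: ifP.
have Q00 : poly_in m b X 0%N 0%N = 0 by rewrite poly_in_X b0; case: ifP.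
have P10 : poly_in m b Y 1%N 0%N = 0 by rewrite poly_in_Y andbF.
have t0 : zc2 (Y, X - poly_in m b Y).
  by split=> //; rewrite [LHS]fpsB P00 subr0.
have s0 : zc2 (Y + poly_in m b X, X) by split=> //; rewrite [LHS]fpsD Q00 addr0.
exists (Y, X - poly_in m b Y), (Y + poly_in m b X, X); split=> //; cbn [fst snd].
- rewrite /comp2; cbn [fst snd].
  rewrite (subst2D t0) (subst2_X t0) (subst2_Y t0) (poly_in_subst2 _ _ _ t0).
  by rewrite (subst2_X t0) subrK.
- by rewrite /det2 !fpsB P10 /= subr0 mulr1 mul0r sub0r oppr_eq0 oner_eq0.
- split; first exact: conv2_Y.
  by apply: conv2D; [exact: conv2_X|apply: conv2N; apply: conv2_poly_in; exact: conv2_Y].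
- by rewrite (subst1_Y g0).
- by rewrite (subst1B g0) (subst1_X g0) (poly_in_subst1 _ _ _ g0) (subst1_Y g0).
Qed.

End Puiseux.

(** * Euclid's algorithm along the infinitely near points *)

Section Walk.
Variable K : fieldType.

(** Each direction of the path performs one step on the orders. The path cannot end at a toric
    point, as the curve has normal crossings at its end; so a point with equal orders is reached
    strictly before, and equal coprime orders are 1. *)
Lemma walk N M t1 t2 p g (u v : fps2 K) : zc1 g -> N <> 1%N -> M <> 1%N ->
  u 0%N 0%N = 0 -> det2 u v != 0 -> subst1 u g = 0 ->
  (in_fD p X -> fdvd X (u * v)) -> (in_fD p Y -> fdvd Y (u * v)) ->
  forall l r xi zeta a b i j k h, p = r ++ l ->
  toric N M r (evp l g) t1 t2 xi zeta a b i j k h ->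
  exists r' d l', p = r' ++ d :: l' /\ exists xi zeta i j k h,
    toric N M r' (blc d (evp l' g)) t1 t2 xi zeta 1 1 i j k h.
Proof.
move=> g0 N1 M1 u0 duv ug DX DY.
elim=> [|d l IH] r xi zeta a b i j k h pE T.
  rewrite cats0 in pE; subst r.
  by case: (toric_not_nc g0 u0 duv ug DX DY N1 M1 T).
have lg0 := zc1_evp l g0.
have pE' : p = rcons r d ++ l by rewrite cat_rcons.
have := T; rewrite -[evp (d :: l) g]/(blc d (evp l g)) => T'.
have [ab|ba|ab] := ltngtP a b.
- have [zeta' T1] := toric_step lg0 ab T'.
  exact: IH pE' T1.
- have [zeta' T1] := toric_step lg0 ba (toric_sym T').
  exact: IH pE' (toric_sym T1).
- subst b; have a1 : a = 1%N by have := toric_cop T; rewrite /coprime gcdnn => /eqP.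
  by subst a; exists r, d, l; split=> //; exists xi, zeta, i, j, k, h.
Qed.

Lemma toric_start n m g (t : fps2 K * fps2 K) : coprime n m -> zc2 t ->
  det2 t.1 t.2 != 0 -> fps_order (subst1 t.1 g) n -> fps_order (subst1 t.2 g) m ->
  toric m n [::] g t.1 t.2 t.1 t.2 n m 1 0 0 1.
Proof.
move=> cop [t10 t20] dt on om; split=> //; try by left.
- by exists 1; rewrite ?funit1 // subst2_id mul1r mulr1.
- by exists 1; rewrite ?funit1 // subst2_id !mul1r.
- exists 1, 1; split; [exact: funit1|exact: funit1|].
  by rewrite /jac /= dXX dYY dXY dYX; ring.
Qed.

(** Otherwise the blow-ups would send the curve (t, 0) to the origin, whereas [t1] has the finite
    order [n] on its image. *)
Lemma terminal_not_inY t1 t2 n m q c : terminal t1 t2 n m q -> c != 0 ->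
  t1 0%N 0%N = 0 -> ~ in_fD (rcons q (Some c)) (Y : fps2 K).
Proof.
move=> T c0 t0 [[h1 E1] [h2 E2]].
have g0 : zc1 (fpsX K, 0 : fps K) by [].
have [on _] := terminal_curve T c0 g0 (order_fpsX K).
apply: (order_neq0 on); rewrite /comp1 E1 E2 !(subst1M g0) !(subst1_Y g0) !mulr0.
apply: fpsP => k; rewrite subst1_coef big1 // => i _; rewrite big1 // => j _.
cbn [fst snd]; case: (nat_of_ord i) => [|i']; last by rewrite exprS !mul0r mulr0.
case: (nat_of_ord j) => [|j']; last by rewrite [0 ^+ j'.+1]exprS mul0r !mulr0.
by rewrite t0 mul0r.
Qed.

Lemma terminal_corner (t1 t2 : fps2 K) n m q d : terminal t1 t2 n m q ->
  ~ (in_fD (rcons q d) X /\ in_fD (rcons q d) Y) ->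
  exists2 c, c != 0 & d = Some c.
Proof.
move=> T; case: d => [c|] H; last first.
  case: H; split; last exact: in_fD_exc.
  apply: (@in_fD_rcons _ _ _ X _ Y) (terminal_X T).
  by rewrite (subst2_X (zc2_bl None)) mulrC.
exists c => //; apply: contra_notN H => /eqP c0; subst c; split.
  exact: in_fD_exc.
apply: (@in_fD_rcons _ _ _ Y _ X) (terminal_Y T).
by rewrite (subst2_Y (zc2_bl _)) /= /cst !rmorph0 addr0.
Qed.

Lemma van1_funit N (h w : fps K) : w 0%N != 0 -> van1 N (h * w) -> van1 N h.
Proof.
move=> w0; elim: N => [|N IH] hw; first by [].
have {}IH : van1 N h by apply: IH => k kN; apply: hw; apply: leqW.
move=> k; rewrite ltnS leq_eqVlt => /orP[/eqP->|]; last exact: IH.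
have := hw N (ltnSn N); rewrite fpsM big_ord_recr big1 /= => [|i _].
  by rewrite add0r subnn => /eqP; rewrite mulf_eq0 (negPf w0) orbF => /eqP.
by rewrite IH ?mul0r.
Qed.

Lemma excXn_div c N (h w : fps2 K) : funit w ->
  (if c is Some _ then forall k, (k < N)%N -> (h * w) k = 0
   else forall i, van1 N ((h * w) i)) ->
  exists h', h = exc (c : option K) ^+ N * h'.
Proof.
move=> uw; have w0 : w 0%N <> 0 by move=> w0; move: uw; rewrite /funit w0 eqxx.
case: c => [c|] H; cbn [exc].
  suff hN k : (k < N)%N -> h k = 0.
    by exists (FPS (fun k => h (N + k)%N)); apply: fps_div_Xn.
  elim/ltn_ind: k => k IH kN; have := H k kN.
  rewrite fpsM big_ord_recr big1 /= => [|i _].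
    by rewrite add0r subnn => /fps_mul_eq0[].
  by rewrite IH ?mul0r //; apply: ltn_trans kN.
suff hN i : van1 N (h i).
  exists (FPS (fun i => FPS (fun j => h i (N + j)%N))).
  apply: fpsP => i; rewrite /Y -rmorphXn fpsCM /=.
  exact: fps_div_Xn (hN i).
elim/ltn_ind: i => i IH; apply: (van1_funit uw) => k kN.
have := H i k kN; rewrite fpsM big_ord_recr fpsD /= subnn fps_sum big1 ?add0r //.
by move=> l _; apply: (van_mul1 _ (IH l (ltn_ord l))).
Qed.

(** Corners are included, because the point where nu_E is computed is arbitrary. One component of
    the pull-back is [exc c] times the transform of a component at [q], and is also [h] times a
    unit. *)
Lemma dicritical_exc q c (w w' : fps2 K * fps2 K) h kap :
  van2 kap (gpull2 (gblowup q) w).1 -> van2 kap (gpull2 (gblowup q) w).2 ->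
  gpull2 (gblowup (rcons q c)) w = (h * w'.1, h * w'.2) ->
  funit (if c is Some _ then w'.2 else w'.1) ->
  exists h', h = exc c ^+ kap.+1 * h'.
Proof.
rewrite gblowup_rcons -(gpull2_comp _ (zc2_bl c) (zc2_gblowup q)).
move: (gpull2 (gblowup q) w) => [A B] /= vA vB EP uw.
have EA := congr1 fst EP; have EB := congr1 snd EP; move: EA EB {EP}.
rewrite /gpull2; cbn [fst snd].
case: c uw => [c|] uw EA EB; apply: (excXn_div uw).
  move=> k kk; rewrite -EB [(bl _).1]/= [(bl _).2]/= dYM dYD dYC dYX dYY.
  have -> : subst2 A (bl (Some c)) * 0 + subst2 B (bl (Some c)) *
    (0 * (Y + cst c) + X * (1 + 0)) = X * subst2 B (bl (Some c)) by ring.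
  case: k kk => [|k] kk; first by rewrite fpsXM0.
  by rewrite fpsXMS (bl_van2 c vB).
move=> i k kk; rewrite -EA [(bl _).1]/= [(bl _).2]/= dXM dXX dXY.
have -> : subst2 A (bl None) * (1 * Y + X * 0) + subst2 B (bl None) * 0 =
  Y * subst2 A (bl None) by ring.
rewrite fpsYM; case: k kk => [|k] kk; first by rewrite fpsXM0.
rewrite fpsXMS subst2_blN; case: leqP => // ik; apply: vA.
by rewrite subnKC.
Qed.

End Walk.

(** Take j < n with m j congruent to [k] modulo [n]. If m j > k, then m j >= k + n, hence k <= m (n
    - 1) - n, which is below the bound. *)
Lemma numerical_semigroup n m k : coprime n m -> (0 < n)%N -> (0 < m)%N ->
  ((n - 1) * (m - 1) <= k)%N -> exists i j, k = (n * i + m * j)%N.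
Proof.
move=> cop n0 m0 ck.
have [j jn jE] : exists2 j, (j < n)%N & m * j = k %[mod n].
  case: (egcdnP n m0) => u v uE _; rewrite gcdnC (eqP cop) in uE.
  exists ((k * u) %% n)%N; first by rewrite ltn_mod.
  rewrite modnMmr; have -> : (m * (k * u) = k * v * n + k)%N by nia.
  by rewrite modnMDl.
have jk : (m * j <= k)%N.
  rewrite leqNgt; apply/negP => kj.
  have /dvdnP[i iE] : (n %| m * j - k)%N by rewrite -eqn_mod_dvd ?jE // ltnW.
  have i0 : (0 < i)%N by move: iE kj; case: i => //; lia.
  nia.
have /dvdnP[i iE] : (n %| k - m * j)%N by rewrite -eqn_mod_dvd ?jE.
by exists i, j; lia.
Qed.

(** * Identification of the last point blown up *)

Section Cuspidal.
Variable K : numFieldType.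

Lemma conv2_gblowup (p : seq (option K)) : conv2 (gblowup p).1 /\ conv2 (gblowup p).2.
Proof.
elim: p => [|d p [IH1 IH2]]; first by split; [exact: conv2_X|exact: conv2_Y].
case: d => [c|]; split=> //.
  by apply: conv2M IH1 _; apply: conv2D IH2 _; exact: conv2_cst.
exact: conv2M.
Qed.

Lemma conv1_evp (p : seq (option K)) (g : fps K * fps K) :
  conv1 g.1 -> conv1 g.2 -> conv1 (evp p g).1 /\ conv1 (evp p g).2.
Proof.
move=> g1 g2; elim: p => [|d p [IH1 IH2]]; first by split.
case: d => [c|]; split=> //.
  by apply: conv1M IH1 _; apply: conv1D IH2 _; exact: conv1_fpsC.
exact: conv1M.
Qed.

(* [normal_crossings_at] over K, with formal divisibility. *)
Definition gnc (g : fps K * fps K) p := exists g' : fps K * fps K,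
  [/\ zc1 g', conv1 g'.1, conv1 g'.2 & g = evp p g'] /\
  exists u v : fps2 K, [/\ u 0%N 0%N = 0, v 0%N 0%N = 0, det2 u v != 0,
     conv2 u & conv2 v] /\
  [/\ subst1 u g' = 0, in_fD p X -> fdvd X (u * v) & in_fD p Y -> fdvd Y (u * v)].

(** The strict transform is a graph y = phi(x) with phi convergent, and [X] is the only exceptional
    axis away from the corners: [Y - series_in_X phi] and [X] are the required coordinates. *)
Lemma terminal_nc (t1 t2 : fps2 K) n m q c (g g1 : fps K * fps K) :
  terminal t1 t2 n m q -> c != 0 -> t1 0%N 0%N = 0 ->
  zc1 g1 -> conv1 g1.1 -> conv1 g1.2 -> fps_order g1.1 1 ->
  g = evp (rcons q (Some c)) g1 -> gnc g (rcons q (Some c)).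
Proof.
move=> T c0 t10 g10 cg1 cg2 og1 gE; exists g1; split=> //.
have [phi phiE] := comp_inverse g1.2 og1.
have cphi := conv1_comp_inverse cg1 cg2 og1 (phiE 0).
have clift : conv2 (series_in_X phi) by apply: conv2_lift.
have phi0 : phi 0%N = 0.
  have := congr1 (fun h : fps K => h 0%N) (phiE 0).
  by rewrite subst1_0E (proj2 g10) => ->.
have cu : conv2 (Y - series_in_X phi).
  by apply: conv2D; [exact: conv2_Y|exact: conv2N].
exists (Y - series_in_X phi), X; split.
  split=> //; last exact: conv2_X.
    by rewrite !fpsB /= phi0 subrr.
  by rewrite /det2 !fpsB /= mulr0 sub0r mulr1 subr0 oppr_eq0 oner_eq0.
split.
- rewrite (subst1B g10) (subst1_Y g10) {1}(phiE g1.2).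
  by rewrite -surjective_pairing subrr.
- by exists (Y - series_in_X phi).
- by move=> D; case: (terminal_not_inY T c0 t10).
Qed.

(** A path ending with normal crossings goes through a terminal point, and the curve has normal
    crossings at the very next point. Minimality leaves no further point. *)
Lemma cuspidal_terminal m n (g : fps K * fps K) q t s :
  (1 < n)%N -> (n < m)%N -> coprime n m -> adapted n m g t s ->
  (exists d, gnc g (rcons q d)) ->
  (forall p, gnc g p -> ((size q).+1 <= size p)%N) -> exists c g1,
  [/\ terminal t.1 t.2 n m q, c != 0, zc1 g1, fps_order g1.1 1 &
      g = comp1 (gblowup (rcons q (Some c))) g1].
Proof.
move=> n1 nm cop [t0 s0 st dt _ on om] [d0 [g' [[g'0 cg1 cg2 gE] NC]]] qmin.
have [u [v [[u0 v0 duv _ _] [ug DX DY]]]] := NC.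
have nN : n <> 1%N by lia.
have mN : m <> 1%N by lia.
have T0 := toric_start cop t0 dt on om.
rewrite gE in T0.
have [r [d [l [pE [xi [zeta [i [j [k [h T]]]]]]]]]] :=
  walk g'0 mN nN u0 duv ug DX DY (erefl : rcons q d0 = [::] ++ rcons q d0) T0.
have lg0 := zc1_evp l g'0; have [cl1 cl2] := conv1_evp l cg1 cg2.
have [TT [c [dE c0 og1]]] := toric_terminal lg0 mN nN T.
subst d.
have gE' : g = evp (rcons r (Some c)) (evp l g').
  by rewrite gE pE /evp -cat_rcons foldr_cat.
have NC' := terminal_nc TT c0 (proj1 t0) lg0 cl1 cl2 og1 gE'.
have := qmin _ NC'; rewrite size_rcons => qr.
have l0 : l = [::].
  move: qr (congr1 size pE); rewrite size_rcons size_cat addnS ltnS => qr [sE].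
  by move: qr; rewrite sE -[leqRHS]addn0 leq_add2l leqn0 => /nilP.
subst l; have qr' : q = r by move: pE; rewrite cats1 => /rcons_inj[].
subst r; exists c, g'.
have gE1 : g = comp1 (gblowup (rcons q (Some c))) g' by rewrite comp1_gblowup.
(* The exponents i + j and k + l are the orders of the adapted coordinates on the curve, that is,
   [n] and [m]. *)
have [oi oj] := terminal_curve TT c0 g'0 og1.
rewrite -gE1 in oi oj.
by rewrite -(order_uniq on oi) -(order_uniq om oj) in TT.
Qed.

End Cuspidal.

(** * Comparison of the semimodules *)

Section Core.
Variable K : numFieldType.
Implicit Types (g : fps K * fps K) (e : fps2 K * fps2 K).

(* [Gamma] and [Lambda] over K. *)
Definition gGamma g k := exists2 h : fps2 K, conv2 h & fps_order (subst1 h g) k.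
Definition gLambda g k := exists2 e, conv2 e.1 /\ conv2 e.2 &
  exists2 j, fps_order (gpull1 g e) j & k = j.+1.

Variables (n m : nat) (C0 : fps K * fps K) (q : seq (option K))
  (t s : fps2 K * fps2 K) (w : fps2 K * fps2 K).
Hypotheses (n1 : (1 < n)%N) (nm : (n < m)%N) (cop : coprime n m)
  (A0 : adapted n m C0 t s) (T : terminal t.1 t.2 n m q).
Hypothesis dic : forall c, exists h w' : _, 
  gpull2 (gblowup (rcons q (Some c))) w = (h * w'.1, h * w'.2) /\ funit w'.2.

Definition noncorner_curve g := exists c g',
  [/\ c != 0, zc1 g', fps_order g'.1 1,
      g = comp1 (gblowup (rcons q (Some c))) g' & gpull1 g w = 0].

Let n0 : (0 < n)%N. Proof. exact: ltnW. Qed.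
Let m0 : (0 < m)%N. Proof. by lia. Qed.

Lemma noncorner_orders g : noncorner_curve g ->
  zc1 g /\ fps_order (subst1 t.1 g) n /\ fps_order (subst1 t.2 g) m.
Proof.
move=> [c [g' [c0 g'0 g'1 -> _]]]; split.
  exact: zc1_comp (zc2_gblowup _) g'0.
exact: (terminal_curve T c0 g'0 g'1).
Qed.

Lemma adapted_subst1 g (f : fps2 K) : zc1 g ->
  subst1 f g = subst1 (subst2 f s) (subst1 t.1 g, subst1 t.2 g).
Proof.
have [t0 s0 st _ _ _ _] := A0 => g0.
have -> : (subst1 t.1 g, subst1 t.2 g) = comp1 t g by [].
rewrite /comp1 -(subst1_comp (subst2 f s) t0 g0) (subst2_comp f s0 t0).
by rewrite -/(comp2 s t) st subst2_id.
Qed.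

Lemma noncorner_order_lt g g' (f : fps2 K) k : noncorner_curve g ->
  noncorner_curve g' -> (k < n * m)%N ->
  fps_order (subst1 f g) k -> fps_order (subst1 f g') k.
Proof.
move=> /noncorner_orders[g0 [gn gm]] /noncorner_orders[g'0 [gn' gm']] kn.
rewrite (adapted_subst1 f g0) (adapted_subst1 f g'0).
move/(subst_weight_order cop n0 m0 gn gm kn).
exact: (weight_order_subst cop n0 m0 gn' gm' kn).
Qed.

Lemma noncorner_Gamma g : noncorner_curve g ->
  forall k, ((n - 1) * (m - 1) <= k)%N -> gGamma g k.
Proof.
move=> /noncorner_orders[g0 [gn gm]] k ck.
have [i [j ->]] := numerical_semigroup cop n0 m0 ck.
have [_ _ _ _ [c1 c2] _ _] := A0.
exists (t.1 ^+ i * t.2 ^+ j); first by apply: conv2M; apply: conv2Xn.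
rewrite (subst1M g0) !(subst1Xn g0).
by apply: orderM; apply: orderXn.
Qed.

(** Below n m the same function has the same order on both curves; from n m on, every integer is in
    the semigroup. *)
Lemma noncorner_Gamma_sub g g' : noncorner_curve g -> noncorner_curve g' ->
  forall k, gGamma g k -> gGamma g' k.
Proof.
move=> Hg Hg' k [h ch hk]; have [kn|nk] := ltnP k (n * m).
  by exists h => //; apply: noncorner_order_lt hk.
by apply: noncorner_Gamma => //; nia.
Qed.

Variables (lam : seq nat) (ws : nat -> fps2 K * fps2 K).
Hypothesis tr : forall i, (i < size lam)%N -> forall c, c != 0 -> exists a f',
  funit f' /\ subst2 (gwedge w (ws i)) (gblowup (rcons q (Some c))) = X ^+ a * f'.
Hypothesis sp : forall k, gLambda C0 k <->
  exists l c, [/\ l \in lam, gGamma C0 c & k = (l + c)%N].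
Hypothesis wsP : forall i, (i < size lam)%N -> (conv2 (ws i).1 /\ conv2 (ws i).2) /\
  exists2 j, fps_order (gpull1 C0 (ws i)) j & nth 0%N lam i = j.+1.
Variables (cG cL nu : nat).
Hypotheses (cGP : forall d, (forall k, (d <= k)%N -> gGamma C0 k) -> (cG <= d)%N)
  (cLP : forall k, (cL <= k)%N -> gLambda C0 k)
  (nuP : forall kap, van2 kap (gpull2 (gblowup q) w).1 ->
     van2 kap (gpull2 (gblowup q) w).2 -> (kap.+1 <= nu)%N)
  (hle : (nu + cL < cG + 2 * (n + m))%N).
Hypothesis C0P : noncorner_curve C0.

(** Provides one form of the basis, whose jacobian serves to read off the exponent of [w] along
    E. *)
Lemma lam_neq0 : (0 < size lam)%N.
Proof.
have : gLambda C0 cL by apply: cLP.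
by move/sp => [l [c [+ _ _]]]; case: lam.
Qed.

Lemma noncorner_kap c : c != 0 -> exists kap h w1 w2 u,
  [/\ gpull2 (gblowup (rcons q (Some c))) w = (h * w1, h * w2), funit w2,
      funit u, h = X ^+ kap.+1 * u &
      mult kap (gpull2 (gblowup q) w).2 /\ van2 kap (gpull2 (gblowup q) w).1].
Proof.
move=> c0; have [h [w' [wE uw]]] := dic c.
have [a [f' [uf E]]] := tr lam_neq0 c0.
have [kap [u [uu hE mB vA]]] := dicritical_factor T n0 c0 uw wE uf E.
by exists kap, h, w'.1, w'.2, u.
Qed.

(** A single [kap] serves all the curves: at each non-corner point it is the multiplicity at [q] of
    the same series. *)
Lemma noncorner_order_eq : exists2 kap, (kap.+1 <= nu)%N &
  forall g, noncorner_curve g -> forall e,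
  (forall j, fps_order (gpull1 g e) j -> exists2 k,
     fps_order (subst1 (gwedge w e) g) k & (kap.+1 + j = (n + m).-1 + k)%N) /\
  (forall k, fps_order (subst1 (gwedge w e) g) k -> exists2 j,
     fps_order (gpull1 g e) j & (kap.+1 + j = (n + m).-1 + k)%N).
Proof.
have [c [g' [c0 _ _ _ _]]] := C0P.
have [kap [_ [_ [_ [_ [_ _ _ _ [mB vA]]]]]]] := noncorner_kap c0.
exists kap; first by apply: nuP vA _; case: mB.
move=> g [d [g1 [d0 g10 og1 -> inv]]] e.
have [kap' [h [w1 [w2 [u [wE uw2 uu hE [mB' _]]]]]]] := noncorner_kap d0.
have kE := mult_uniq mB' mB; subst kap'.
split=> r.
  exact: (invariant_order T n0 d0 g10 og1 uw2 uu wE hE inv).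
exact: (invariant_order_inv T n0 d0 g10 og1 uw2 uu wE hE inv).
Qed.

Lemma noncorner_jacobian g g' i a : noncorner_curve g -> noncorner_curve g' ->
  (i < size lam)%N -> fps_order (subst1 (gwedge w (ws i)) g) a ->
  fps_order (subst1 (gwedge w (ws i)) g') a.
Proof.
move=> [c [g1 [c0 g10 og1 -> _]]] [c' [g1' [c'0 g10' og1' -> _]]] il H.
have [b [f [uf E]]] := tr il c0; have [b' [f' [uf' E']]] := tr il c'0.
have bb' : b = b' := mult_uniq (wedge_mult uf E) (wedge_mult uf' E').
rewrite (order_uniq H (order_transform g10 og1 uf E)) bb'.
exact: order_transform g10' og1' uf' E'.
Qed.

Lemma noncorner_Lambda g : noncorner_curve g ->
  forall k, gLambda g k <-> gLambda C0 k.
Proof.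
move=> Hg k; have [kap kapnu ord] := noncorner_order_eq.
have cGle : (cG <= (n - 1) * (m - 1))%N by apply: cGP; apply: noncorner_Gamma.
split=> [[e ce [j ej kE]]|].
  have [|kL] := leqP cL k; first exact: cLP.
  have [r or jr] := (ord g Hg e).1 j ej.
  (* From r = (kap + 1) + (j + 1) - (n + m), kap + 1 <= nu and j + 1 < cL, [hle] gives r < cG + n +
     m - 1, and the latter is at most n m by [cGle]. *)
  have rnm : (r < n * m)%N by nia.
  have [j' oj' jr'] := (ord C0 C0P e).2 r (noncorner_order_lt Hg C0P rnm or).
  exists e => //; exists j' => //; lia.
move/sp => [l [c [/(nthP 0%N)[i il <-] Gc kE]]].
have [[cw1 cw2] [j oj lE]] := wsP il.
have [h ch hc] := noncorner_Gamma_sub C0P Hg Gc.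
have [g0 _] := noncorner_orders Hg.
(* The jacobian of a basis form has the same order on both curves without any bound on this order,
   by transversality. *)
have ojg : fps_order (gpull1 g (ws i)) j.
  have [r or jr] := (ord C0 C0P (ws i)).1 j oj.
  have [j' oj' jr'] := (ord g Hg (ws i)).2 r (noncorner_jacobian C0P Hg il or).
  by rewrite (_ : j = j') //; lia.
exists (h * (ws i).1, h * (ws i).2); first by split; apply: conv2M.
exists (c + j)%N; last by rewrite kE lE; lia.
have -> : gpull1 g (h * (ws i).1, h * (ws i).2) = subst1 h g * gpull1 g (ws i).
  by rewrite /gpull1; cbn [fst snd]; rewrite !(subst1M g0); series_ring.
exact: orderM.
Qed.

End Core.

(** * Complex germs *)

Lemma gwedge_d00 (K : comNzRingType) (u v : fps2 K) :
  gwedge (dX u, dY u) (dX v, dY v) 0%N 0%N =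
  u 1%N 0%N * v 0%N 1%N - u 0%N 1%N * v 1%N 0%N.
Proof. by rewrite /gwedge !fpsB !fpsM0. Qed.

Lemma gwedge_dX (K : comNzRingType) (w : fps2 K * fps2 K) :
  gwedge w (dX X, dY X) = - w.2.
Proof. by rewrite /gwedge dXX dYX; cbn [fst snd]; ring. Qed.
Lemma gwedge_dY (K : comNzRingType) (w : fps2 K * fps2 K) :
  gwedge w (dX Y, dY Y) = w.1.
Proof. by rewrite /gwedge dXY dYY; cbn [fst snd]; ring. Qed.

Lemma conv2_div_exc (K : numFieldType) (c : option K) k (h : fps2 K) :
  conv2 (exc c ^+ k * h) -> conv2 h.
Proof.
elim: k => [|k IH]; first by rewrite mul1r.
rewrite exprS -mulrA => H; apply: IH; move: H.
by case: (c) => [d|]; [exact: conv2_divX|exact: conv2_divY].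
Qed.

Definition gscale (K : comNzRingType) (f : fps2 K) (w : fps2 K * fps2 K) :
  fps2 K * fps2 K := (f * w.1, f * w.2).

Lemma addr_pair (U V : nmodType) (a c : U) (b d : V) :
  (a, b) + (c, d) = (a + c, b + d).
Proof. by []. Qed.

(** With u = X and v = Y, the form h (w1 du + w2 dv) is logarithmic with residue coefficient a = u h
    w1 and b = h w2; both sides carry the extra factor [X] that clears du/u. *)
Lemma log_equation_X (K : comNzRingType) (h : fps2 K) (w : fps2 K * fps2 K) k :
  gscale X (gscale (X ^+ k.+1 * h) w) = gscale (X ^+ k.+1)
    (gscale (X * (h * w.1)) (dX X, dY X) + gscale (X * (h * w.2)) (dX Y, dY Y)).
Proof.
rewrite dXX dYX dXY dYY /gscale addr_pair; cbn [fst snd].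
by congr pair; ring.
Qed.

Lemma log_equation_Y (K : comNzRingType) (h : fps2 K) (w : fps2 K * fps2 K) k :
  gscale Y (gscale (Y ^+ k.+1 * h) w) = gscale (Y ^+ k.+1)
    (gscale (Y * (h * w.2)) (dX Y, dY Y) + gscale (Y * (h * w.1)) (dX X, dY X)).
Proof.
rewrite dXX dYX dXY dYY /gscale addr_pair; cbn [fst snd].
by congr pair; ring.
Qed.

Section Bridge.
Variable R : realType.
Local Notation C := R[i].

Local Open Scope complex_scope.
(** The constants in [convergent1] and [convergent2] may have any sign: they are replaced by |M| and
    1 + |r|. *)
Lemma real_bound (M r : R) : exists M' r' : C, [/\ 0 <= M', 1 <= r' &
  forall k, (M * r ^+ k)%:C <= M' * r' ^+ k].
Proof.
exists (`|M|%:C), ((1 + `|r|)%:C); split.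
- by rewrite -(rmorph0 (real_complex R)) lecR.
- by rewrite -(rmorph1 (real_complex R)) lecR lerDl.
- move=> k; rewrite -rmorphXn -rmorphM lecR.
  rewrite (le_trans (ler_norm _)) // normrM ler_wpM2l // normrX.
  by rewrite lerXn2r ?nnegrE ?addr_ge0 // lerDr.
Qed.

Lemma complex_bound (M r : C) : 0 <= M -> 1 <= r -> exists M' r' : R,
  forall k, M * r ^+ k = (M' * r' ^+ k)%:C.
Proof.
case: M => M M'; case: r => r r'; rewrite !lecE /= => /andP[/eqP-> _] /andP[/eqP-> _].
by exists M, r => k; rewrite rmorphM rmorphXn.
Qed.

Lemma convergent1E (f : fps C) : convergent1 f <-> conv1 f.
Proof.
split=> [[M [r H]]|[M [r [M0 r1 H]]]].
  have [M' [r' [M0 r1 H']]] := real_bound M r.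
  by exists M', r'; split=> // k; apply: le_trans (H k) (H' k).
have [M' [r' E]] := complex_bound M0 r1.
by exists M', r' => k; rewrite -E.
Qed.

Lemma convergent2E (f : fps2 C) : convergent2 f <-> conv2 f.
Proof.
split=> [[M [r H]]|[M [r [M0 r1 H]]]].
  have [M' [r' [M0 r1 H']]] := real_bound M r.
  by exists M', r'; split=> // i j; apply: le_trans (H i j) (H' _).
have [M' [r' E]] := complex_bound M0 r1.
by exists M', r' => i j; rewrite -E.
Qed.

Lemma dvd2_fdvd (z f : fps2 C) : dvd2 z f -> fdvd z f.
Proof. by case=> h _ ->; exists h. Qed.

Lemma fdvd_dvd2 (z f : fps2 C) : z = X \/ z = Y -> conv2 f -> fdvd z f -> dvd2 z f.
Proof.
move=> zXY cf [h hE]; exists h => //; apply/convergent2E; move: cf.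
rewrite hE mulrC; case: zXY => ->; [exact: conv2_divX|exact: conv2_divY].
Qed.

Lemma in_D_fD (p : near_point R) (z : fps2 C) : z = X \/ z = Y ->
  in_D p z <-> in_fD p z.
Proof.
move=> zXY; have [c1 c2] := conv2_gblowup p.
split=> [[/dvd2_fdvd D1 /dvd2_fdvd D2]|[D1 D2]]; first by split.
by split; apply: fdvd_dvd2.
Qed.

Lemma is_param_zc (g : param R) : is_param g -> [/\ zc1 g, conv1 g.1 & conv1 g.2].
Proof.
by case=> /convergent1E c1 /convergent1E c2 g1 g2.
Qed.

Lemma wedge_d1 (u v : fps2 C) : wedge (d1 u) (d1 v) 0%N 0%N = det2 u v.
Proof. exact: gwedge_d00. Qed.

Lemma normal_crossings_gnc (g : param R) p : normal_crossings_at g p <-> gnc g p.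
Proof.
split=> [[g' [[/is_param_zc[g'0 c1 c2] E1 E2]]]|[g' [[g'0 c1 c2 gE]]]].
  move=> [u [v [[cu cv u0 v0 duv] ug [DX DY]]]]; exists g'; split.
    split=> //; rewrite -(comp1_gblowup p g'0) /comp1.
    have -> : subst1 (gblowup p).1 g' = g.1 by [].
    have -> : subst1 (gblowup p).2 g' = g.2 by [].
    by case: (g).
  exists u, v; split.
    by split; [|exact: v0|apply/eqP; rewrite -wedge_d1|apply/convergent2E..].
  split=> // D; apply: dvd2_fdvd; [apply: DX|apply: DY]; apply/in_D_fD => //.
    by left.
  by right.
move=> [u [v [[u0 v0 duv cu cv] [ug DX DY]]]].
exists g'; split.
  split.
  - by split; [exact/convergent1E|exact/convergent1E|case: g'0..].
  - by rewrite gE -(comp1_gblowup p g'0).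
  - by rewrite gE -(comp1_gblowup p g'0).
exists u, v; split=> //.
  by split; [exact/convergent2E|exact/convergent2E| | |rewrite wedge_d1; apply/eqP].
split=> D; apply: fdvd_dvd2; try (by [left|right]); try exact: conv2M.
  by apply: DX; apply/in_D_fD => //; left.
by apply: DY; apply/in_D_fD => //; right.
Qed.

Lemma transversal_funit (c : option C) (w : form1 R) : transversal_E c w ->
  funit (if c is Some _ then w.2 else w.1).
Proof.
case: c => [c|] H; apply/eqP => w0; apply: H.
  have E : wedge w (d1 X) = - w.2 := gwedge_dX w.
  by change (wedge w (d1 X) 0%N 0%N = 0); rewrite E !fpsN w0 oppr0.
have E : wedge w (d1 Y) = w.1 := gwedge_dY w.
by change (wedge w (d1 Y) 0%N 0%N = 0); rewrite E w0.
Qed.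

Lemma log_divisible_dicritical (q : near_point R) (c : option C) (w w' : form1 R)
    (h h' : fps2 C) k :
  pull2 (blowup (rcons q c)) w = scale1 h w' -> is_form1 w' -> convergent2 h ->
  h = exc c ^+ k.+1 * h' -> log_divisible q c w k.+1.
Proof.
move=> E [/convergent2E c1 /convergent2E c2] /convergent2E ch hE.
have ch' : conv2 h' by apply: (@conv2_div_exc _ c k.+1); rewrite -hE.
case: c E hE => [c|] E hE.
  exists (X * (h' * w'.1)), (h' * w'.2); split.
  - by apply/convergent2E; apply: conv2M; [exact: conv2_X|apply: conv2M].
  - by apply/convergent2E; apply: conv2M.
  rewrite E hE; exact: log_equation_X.
exists (Y * (h' * w'.2)), (h' * w'.1); split.
- by apply/convergent2E; apply: conv2M; [exact: conv2_Y|apply: conv2M].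
- by apply/convergent2E; apply: conv2M.
rewrite E hE; exact: log_equation_Y.
Qed.

Lemma cusp_adapted m n (g : param R) : cusp m n g -> exists t s, adapted n m g t s.
Proof.
case=> [[/is_param_zc[g0 _ _] _] /andP[n1 nm] cop H].
have s1 (s : fps C) : s 0%N = 0 -> s 1%N <> 0 -> fps_order s 1.
  by move=> s0 s1; split=> // -[].
case: H => -[s [_ /s1 s0 /s0 os xE [ym yi]]].
  exact: puiseux_adapted n1 nm cop os g0 xE ym yi.
exact: puiseux_adapted_swap n1 nm cop os g0 xE ym yi.
Qed.

Lemma Gamma_gGamma (g : param R) k : Gamma g k <-> gGamma g k.
Proof. by split=> -[h /convergent2E ch hk]; exists h. Qed.

Lemma Lambda_gLambda (g : param R) k : Lambda g k <-> gLambda g k.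
Proof.
split=> [[e [/convergent2E c1 /convergent2E c2] [j ej kE]]|[e [c1 c2] [j ej kE]]].
  by exists e => //; exists j.
by exists e; [split; apply/convergent2E|exists j].
Qed.

End Bridge.

Theorem theorem3 (R : realType) (m n : nat)
    (C : param R) (hC : cusp m n C)
    (q : near_point R) (hE : cuspidal_divisor C q)
    (omega : form1 R) (hF : foliation omega)
    (hdic : totally_dicritical q omega)
    (hinv : invariant_curve omega C)
    (lam : seq nat) (ws : seq (form1 R)) (hws : min_std_basis C lam ws)
    (htr : total_transversality q ws omega)
    (cG cL : nat) (hcG : conductor (Gamma C) cG) (hcL : conductor (Lambda C) cL)
    (P : option R[i]) (nu : nat) (hnu : nu_E q P omega nu)
    (hle : nu%:Z <= cG%:Z - cL%:Z + 2 * (n%:Z + m%:Z) - 1) :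
  Lambda_constant q omega.
Proof.
have [t [s ad]] := cusp_adapted hC.
have [_ /andP[n1 nm] cop _] := hC.
have [c0 [g0 [T c00 g00 og0 CE]]] : exists c g1,
  [/\ terminal t.1 t.2 n m q, c != 0, zc1 g1, fps_order g1.1 1 &
      C = comp1 (gblowup (rcons q (Some c))) g1].
  apply: (cuspidal_terminal n1 nm cop ad).
    by case: hE => -[d /normal_crossings_gnc D _]; exists d.
  by move=> p /normal_crossings_gnc; case: hE => _; apply.
have C0P : noncorner_curve q omega C by exists c0, g0.
have [[[lamS sp] _] wsS wsP] := hws.
have dic c : exists h w' : _,
    gpull2 (gblowup (rcons q (Some c))) omega = (h * w'.1, h * w'.2) /\ funit w'.2.
  have [w' [[_ [h _ hE']] tE _]] := hdic (Some c).
  by exists h, w'; split; [exact: hE'|exact: transversal_funit tE].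
have tr i : (i < size lam)%N -> forall c, c != 0 -> exists a f', funit f' /\
    subst2 (gwedge omega (nth 0 ws i)) (gblowup (rcons q (Some c))) = X ^+ a * f'.
  move=> il c c_neq0; rewrite -wsS in il.
  have [f' [_ [a [b [E _ jD _ _]]]] f00] := htr i il (Some c).
  exists a, f'; split; first exact/eqP.
  (* At a non-corner point Y = 0 is not exceptional, so the total transform of the jacobian curve
     carries no factor [Y]. *)
  case: b E jD => [|b] E jD; first by rewrite expr0 mulr1 in E.
  case: (terminal_not_inY T c_neq0 (proj1 (adapted_t0 ad))).
  by apply/in_D_fD; [right|apply: jD].
have sp' k : gLambda C k <->
    exists l c, [/\ l \in lam, gGamma C c & k = (l + c)%N].
  rewrite -Lambda_gLambda sp.
  by split=> -[l [c [ll /Gamma_gGamma Gc kE]]]; exists l, c.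
have wsP' i : (i < size lam)%N -> (conv2 (nth 0 ws i).1 /\ conv2 (nth 0 ws i).2) /\
    exists2 j, fps_order (gpull1 C (nth 0 ws i)) j & nth 0%N lam i = j.+1.
  move=> il; have [[/convergent2E c1 /convergent2E c2] [j oj jE]] := wsP i il.
  split; first exact: (conj c1 c2).
  exists j; [exact: oj|exact: jE].
have cGP d : (forall k, (d <= k)%N -> gGamma C k) -> (cG <= d)%N.
  by move=> H; apply: (proj2 hcG) => k kd; exact/Gamma_gGamma/H.
have cLP k : (cL <= k)%N -> gLambda C k.
  by move=> kL; apply/Lambda_gLambda; apply: (proj1 hcL).
(* The multiplicity at [q] bounds nu_E from below at the given point [P], which may be a corner. *)
have nuP kap : van2 kap (gpull2 (gblowup q) omega).1 ->
    van2 kap (gpull2 (gblowup q) omega).2 -> (kap.+1 <= nu)%N.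
  move=> vA vB; apply: (proj2 hnu).
  have [w' [[[fw' _] [h ch hE']] tE _]] := hdic P.
  have [h' hh'] := dicritical_exc (w' := w') vA vB hE' (transversal_funit tE).
  exact: log_divisible_dicritical hE' fw' ch hh'.
have hle' : (nu + cL < cG + 2 * (n + m))%N by move: hle; lia.
have core := noncorner_Lambda n1 nm cop ad T dic tr sp' wsP' cGP cLP nuP hle' C0P.
(* The corners of E are the directions of the two axes at [q], so a curve of Cusp_E meets E in a
   direction [Some d] with d nonzero. *)
have cusp_nc g : Cusp_E q omega g -> noncorner_curve q omega g.
  case=> _ inv [c [g' [ns [/is_param_zc[g'0 _ _] E1 E2] o1]]].
  have [d d0 cd] : exists2 d, d != 0 & c = Some d.
    apply: (terminal_corner T) => -[DX DY].
    by apply: ns; split; apply/in_D_fD => //; [left|right].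
  subst c; exists d, g'; split; [exact: d0|exact: g'0| | |exact: inv].
    have {}o1 : g'.1 1%N <> 0 by rewrite -(subst1_X g'0).
    by split=> [//|[|//] _]; case: g'0.
  rewrite [LHS]surjective_pairing; exact: (congr2 pair (esym E1) (esym E2)).
move=> g1 g2 /cusp_nc/core H1 /cusp_nc/core H2 k.
by rewrite !Lambda_gLambda H1 H2.
Qed.
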